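(* Let $p\ge1$, $\beta_0\in\mathbb R^p$, let $X$ be a random vector in $\mathbb R^p$ with Lebesgue density $f^X$ such that $\mathbb P(\|X\|\le B)=1$ for some $B>0$ and $\mathbb P(v^\top X=0)=0$ for every $v\ne0$. Let $\epsilon$ be independent of $X$ with density $f(t)=c_\alpha\exp(-d^{-\alpha}|t|^\alpha)$, where $\alpha\ge1$ is an integer, $d>0$, $c_\alpha=\frac{\alpha}{2d\Gamma(1/\alpha)}$, and let $Y=\beta_0^\top X+\epsilon$ with density $f^Y(y)=\int f(y-\beta_0^\top x)f^X(x)dx$. Let $\tilde X_1,\dots,\tilde X_n$ be i.i.d. copies of $X$ and $\tilde Y_1,\dots,\tilde Y_n$ i.i.d. copies of $Y$, the two samples independent, with $n\to\infty$ (and $m\to\infty$ with $m/n\to\lambda\in(0,1)$). Define $$\psi(x)=-\int\frac{\int zf'(y-\beta_0^\top z)f^X(z)dz}{f^Y(y)}\,f(y-\beta_0^\top x)\,dy.$$ Then $$\frac1n\sum_{j=1}^n\frac{\frac1n\sum_{i=1}^n\tilde X_if'(\tilde Y_j-\beta_0^\top\tilde X_i)}{\frac1n\sum_{i=1}^nf(\tilde Y_j-\beta_0^\top\tilde X_i)}=\frac1n\sum_{j=1}^n\frac{\int xf'(\tilde Y_j-\beta_0^\top x)f^X(x)dx}{f^Y(\tilde Y_j)}+\Big(\frac1n\sum_{i=1}^n\psi(\tilde X_i)-\mathbb E\psi(X)\Big)+o_{\mathbb P}\big(n^{-1/2}\big).$$ Furthermore, as $n\to\infty$, $$\sqrt n\,\frac1n\sum_{j=1}^n\frac{\int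 xf'(\tilde Y_j-\beta_0^\top x)f^X(x)dx}{f^Y(\tilde Y_j)}\to_dW_1,\qquad \sqrt n\Big(\frac1n\sum_{i=1}^n\psi(\tilde X_i)-\mathbb E\psi(X)\Big)\to_dW_2,$$ where $W_1,W_2$ are independent centered Gaussian vectors in $\mathbb R^p$ with covariance matrices $$\Gamma_1=\int\frac{\big(\int xf'(y-\beta_0^\top x)f^X(x)dx\big)\big(\int x^\top f'(y-\beta_0^\top x)f^X(x)dx\big)}{f^Y(y)}\,dy,$$ $$\Gamma_2=\int\Big(\int\frac{f(y-\beta_0^\top x)\int zf'(y-\beta_0^\top z)f^X(z)dz}{f^Y(y)}dy\Big)\Big(\int\frac{f(y-\beta_0^\top x)\int z^\top f'(y-\beta_0^\top z)f^X(z)dz}{f^Y(y)}dy\Big)f^X(x)\,dx$$ respectively.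
   Context: $f'$ is the derivative of $f$ (existing except possibly at $0$ when $\alpha=1$). Here $\tilde X_i$ and $\tilde Y_j$ form the unmatched sample of a linear regression model $Y=\beta_0^\top X+\epsilon$; $o_{\mathbb P}$ refers to the joint law of the two samples. *)

(* Defs.v *)
From HB Require Import structures.
From mathcomp Require Import all_boot all_order all_algebra.
From mathcomp Require Import all_classical all_reals all_analysis.
Set Implicit Arguments. Unset Strict Implicit. Unset Printing Implicit Defensive.
Import Order.TTheory GRing.Theory Num.Def Num.Theory.
Import numFieldNormedType.Exports.
Local Open Scope classical_set_scope.
Local Open Scope ring_scope.

Section Defs.
Variable R : realType.

Definition dotv (p : nat) (u v : 'rV[R]_p) : R := \sum_(k < p) u 0 k * v 0 k.
Definition normv (p : nat) (u : 'rV[R]_p) : R := Num.sqrt (dotv u u).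

(** Borel sigma-algebra on R^p: generated by the orthants {x | x <= a}. *)
Definition orthants (p : nat) : set (set 'rV[R]_p) :=
  [set [set x : 'rV[R]_p | forall k, x 0 k <= a 0 k] | a in [set: 'rV[R]_p]].
Definition RpM (p : nat) := g_sigma_algebraType (@orthants p).

Definition lebRint (F : R -> R) : R := Rintegral (@lebesgue_measure R) setT F.

(** Lebesgue integral on R^p, computed as the iterated integral
    int dx_0 ... int dx_{p-1} F(x) (equal to the Lebesgue integral for
    integrable F, by Fubini). *)
Fixpoint iRint (k : nat) (F : seq R -> R) : R :=
  match k with
  | 0 => F [::]
  | k'.+1 => lebRint (fun t => iRint k' (fun s => F (t :: s)))
  end.
Definition intRp (p : nat) (F : 'rV[R]_p -> R) : R :=
  iRint p (fun s => F (\row_(k < p) nth 0 s k)).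

Definition Gamma (s : R) : R :=
  Rintegral (@lebesgue_measure R) [set t : R | 0 < t]
    (fun t => t `^ (s - 1) * expR (- t)).

Definition c_alpha (alpha : nat) (d : R) : R :=
  alpha%:R / (2 * d * Gamma (alpha%:R)^-1).
Definition fnoise (alpha : nat) (d : R) (t : R) : R :=
  c_alpha alpha d * expR (- (d ^- alpha * `|t| ^+ alpha)).
Definition fnoise' (alpha : nat) (d : R) : R -> R := derive1 (fnoise alpha d).

Section Model.
Variables (p : nat) (alpha : nat) (d : R) (b : 'rV[R]_p) (fX : 'rV[R]_p -> R).
Local Notation f := (fnoise alpha d).
Local Notation f' := (fnoise' alpha d).

Definition fY (y : R) : R := intRp (fun x => f (y - dotv b x) * fX x).

Definition Gvec (y : R) : 'rV[R]_p :=
  \row_(k < p) intRp (fun x => x 0 k * f' (y - dotv b x) * fX x).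

Definition psi (x : 'rV[R]_p) : 'rV[R]_p :=
  \row_(k < p) - lebRint (fun y => Gvec y 0 k / fY y * f (y - dotv b x)).

Definition Epsi : 'rV[R]_p := \row_(k < p) intRp (fun x => psi x 0 k * fX x).

Definition Gamma1 : 'M[R]_p :=
  \matrix_(k < p, l < p) lebRint (fun y => Gvec y 0 k * Gvec y 0 l / fY y).

Definition Hvec (x : 'rV[R]_p) : 'rV[R]_p :=
  \row_(k < p) lebRint (fun y => f (y - dotv b x) * Gvec y 0 k / fY y).
Definition Gamma2 : 'M[R]_p :=
  \matrix_(k < p, l < p) intRp (fun x => Hvec x 0 k * Hvec x 0 l * fX x).

Definition Sstat (n : nat) (Xs : nat -> 'rV[R]_p) (Ys : nat -> R) : 'rV[R]_p :=
  n%:R^-1 *: \sum_(j < n)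
    ((n%:R^-1 * \sum_(i < n) f (Ys j - dotv b (Xs i)))^-1 *:
      (n%:R^-1 *: \sum_(i < n) (f' (Ys j - dotv b (Xs i)) *: Xs i))).
Definition T1stat (n : nat) (Ys : nat -> R) : 'rV[R]_p :=
  n%:R^-1 *: \sum_(j < n) ((fY (Ys j))^-1 *: Gvec (Ys j)).
Definition T2stat (n : nat) (Xs : nat -> 'rV[R]_p) : 'rV[R]_p :=
  n%:R^-1 *: \sum_(i < n) psi (Xs i) - Epsi.
End Model.

Definition std_gauss_pdf (p : nat) (z : 'rV[R]_p) : R :=
  \prod_(k < p) normal_pdf 0 1 (z 0 k).

End Defs.

(* Main.v *)
Require Import Defs.
From HB Require Import structures.
From mathcomp Require Import all_boot all_order all_algebra.
From mathcomp Require Import all_classical all_reals all_analysis.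
From mathcomp Require Import measurable_realfun ring lra.
Set Implicit Arguments. Unset Strict Implicit. Unset Printing Implicit Defensive.
Import Order.TTheory GRing.Theory Num.Def Num.Theory.
Import numFieldNormedType.Exports.
Local Open Scope classical_set_scope.
Local Open Scope ring_scope.

(** With w(x,y) = f(y - b.x) / fY(y), s(x,y) = x f'(y - b.x) / fY(y) and
    g = E s(X,.), one has E w(X,y) = 1, and the j-th summand of the statistic is
    S_j / W_j = g(Y_j) + K_j + K_j (1 - W_j) / W_j, where S_j, W_j, K_j are the
    means over i of s, w and k = s - g w at (X_i, Y_j). As E k(X,y) = 0, both K_j
    and 1 - W_j are O(n^-1/2) in L2, so the last term is O(1/n) in L1. Since
    f' is odd, E s(x,Y) = 0, hence E k(x,Y) = psi(x) and the double mean of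
    k(X_i,Y_j) - psi(X_i) is degenerate in both variables, so O(1/n) in L2.
    As X is bounded, f(y - b.x) / f(y - b.x') <= exp(C (1 + |y|)^(alpha-1)),
    which dominates all these kernels and is integrable against fY because
    f decays like exp(-|y|^alpha / d^alpha).
    The central limit theorem is proved on E cos(c + t.S_n), by a Lindeberg
    telescoping; it passes to bounded continuous h through Bernstein
    polynomials in sin(theta x_i), which are combinations of such cosines. *)

(** * Integrability, independence and densities *)

(** The expansion rests on S/W - g = (S - g W)/W: centring by g w rather than by g makes the
    numerator average to zero over X for every fixed y, and 1/W = 1 + (1 - W)/W then isolates a
    product of two small factors. The random denominator needs no exceptional event: every w(X_i, y)
    is bounded below by the inverse of an envelope in y alone, so 1/W_j is at most that envelope at
    Y_j, and second moments suffice. The integrals of the statement are iterated real integrals, in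
    which an infinite value is read as 0; they are not a priori integrals against a measure. They
    are turned into expectations under [P], where all estimates are made. The law of the samples is
    known only on rectangles, and every independence used is drawn from there by a pi-lambda
    argument. The pairs (X_j, Y_j) are treated as one sequence, which gives joint convergence; the
    limits are independent because the cross covariance vanishes. The free phase c in the cosines
    carries the real and imaginary parts of a characteristic function together. *)

Notation Rintg m f := (Rintegral m setT f).
Notation L1 m f := (m.-integrable setT (EFin \o f)).

Section L1_theory.
Context d (T : measurableType d) (R : realType) (m : {measure set T -> \bar R}).
Implicit Types f g : T -> R.

Lemma L1_meas f : L1 m f -> measurable_fun setT f.
Proof. by move=> /(measurable_int m)/measurable_EFinP. Qed.

Lemma eq_L1 f g : f =1 g -> L1 m f -> L1 m g.
Proof. by move=> fg; have -> : f = g by exact/funext. Qed.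

Lemma L1D f g : L1 m f -> L1 m g -> L1 m (fun x => f x + g x).
Proof. exact: (@integrableD _ _ _ m setT measurableT (EFin \o f) (EFin \o g)). Qed.

Lemma L1B f g : L1 m f -> L1 m g -> L1 m (fun x => f x - g x).
Proof. exact: (@integrableB _ _ _ m setT measurableT (EFin \o f) (EFin \o g)). Qed.

Lemma L1Z (k : R) f : L1 m f -> L1 m (fun x => k * f x).
Proof. exact: (@integrableZl _ _ _ m setT measurableT k (EFin \o f)). Qed.

Lemma L1_abs f : L1 m f -> L1 m (fun x => `|f x|).
Proof. exact: integrable_norm. Qed.

Lemma L1_le f g : measurable_fun setT f -> (forall x, `|f x| <= g x) ->
  L1 m g -> L1 m f.
Proof.
move=> mf fg; apply: le_integrable => //; first exact/measurable_EFinP.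
move=> x _ /=; rewrite lee_fin; exact: le_trans (fg x) (ler_norm _).
Qed.

Lemma L1_0 : L1 m (fun=> 0).
Proof. exact: integrable0. Qed.

Lemma L1_sum I (s : seq I) (F : I -> T -> R) : (forall i, L1 m (F i)) ->
  L1 m (fun x => \sum_(i <- s) F i x).
Proof.
move=> LF; elim: s => [|i s IH].
  by apply: eq_L1 L1_0 => x; rewrite big_nil.
apply: eq_L1 (L1D (LF i) IH) => x; by rewrite big_cons.
Qed.

Lemma Rint_sum I (s : seq I) (F : I -> T -> R) : (forall i, L1 m (F i)) ->
  Rintg m (fun x => \sum_(i <- s) F i x) = \sum_(i <- s) Rintg m (F i).
Proof.
move=> LF; elim: s => [|i s IH].
  rewrite big_nil (@eq_Rintegral _ _ _ m setT (fun=> 0)).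
    by rewrite Rintegral_cst// mul0r.
  by move=> x _; rewrite big_nil.
rewrite big_cons -IH -RintegralD//; last exact: L1_sum.
by apply: eq_Rintegral => x _; rewrite big_cons.
Qed.

Lemma eq_Rint f g : f =1 g -> Rintg m f = Rintg m g.
Proof. by move=> fg; apply: eq_Rintegral => x _. Qed.

Lemma Rintg0 : Rintg m (fun=> 0) = 0.
Proof. by rewrite Rintegral_cst// mul0r. Qed.

Lemma RintN f : L1 m f -> Rintg m (fun x => - f x) = - Rintg m f.
Proof.
move=> Lf; rewrite -[RHS]mulN1r -RintegralZl//.
by apply: eq_Rint => x; rewrite mulN1r.
Qed.

Lemma Rint_le_abs f g : L1 m f -> L1 m g -> (forall x, `|f x| <= g x) ->
  `|Rintg m f| <= Rintg m g.
Proof.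
move=> Lf Lg fg; apply: le_trans (le_normr_Rintegral measurableT Lf) _.
by apply: le_Rintegral => //; exact: L1_abs.
Qed.

Lemma ge0_L1 f : measurable_fun setT f -> (forall x, 0 <= f x) ->
  (\int[m]_x (f x)%:E < +oo)%E -> L1 m f.
Proof.
move=> mf f0 foo; apply/integrableP; split; first exact/measurable_EFinP.
by under eq_integral do rewrite /= ger0_norm//.
Qed.

(** [fine] sends [+oo] to 0, so a nonzero real integral of a nonnegative function certifies that the
    extended integral is finite. *)
Lemma ge0_Rint_neq0 f : Rintg m f != 0 -> measurable_fun setT f ->
  (forall x, 0 <= f x) -> L1 m f.
Proof.
move=> I0 mf f0; apply: ge0_L1 => //; rewrite ltey; apply: contra I0 => /eqP I.
by rewrite /Rintegral I.
Qed.

Lemma L1_EFin f : L1 m f -> (\int[m]_x (f x)%:E = (Rintg m f)%:E)%E.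
Proof. by move=> Lf; rewrite /Rintegral fineK//; exact: integrable_fin_num. Qed.

Lemma L1_indic A : measurable A -> (m A < +oo)%E -> L1 m (\1_A : T -> R).
Proof.
move=> mA mAoo; apply: ge0_L1; [exact: measurable_indic|by []|].
by rewrite integral_indic// setIT.
Qed.

End L1_theory.

Section prob_L1.
Context d (T : measurableType d) (R : realType) (P : probability T R).
Implicit Types f g : T -> R.

Lemma L1_cst (k : R) : L1 P (fun=> k).
Proof. exact: finite_measure_integrable_cst. Qed.

Lemma L1_bdd f (M : R) : measurable_fun setT f -> (forall x, `|f x| <= M) -> L1 P f.
Proof. by move=> mf fM; apply: L1_le (L1_cst M). Qed.

Lemma Rint_cst (k : R) : Rintg P (fun=> k) = k.
Proof. rewrite Rintegral_cst//; by rewrite [X in fine X](@probability_setT _ _ _ P) mulr1. Qed.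

End prob_L1.

(** Both sides are differences of the integrals of positive and negative parts, so the nonnegative
    case gives the formula without integrability. *)
Lemma integral_pushforwardT d1 d2 (T1 : measurableType d1) (T2 : measurableType d2)
    (R : realType) (m : {measure set T1 -> \bar R}) (phi : T1 -> T2) (f : T2 -> \bar R) :
  measurable_fun setT phi -> measurable_fun setT f ->
  (\int[pushforward m phi]_y f y = \int[m]_x f (phi x))%E.
Proof.
move=> mphi mf; rewrite [LHS]integralE [RHS]integralE; congr (_ - _)%E.
  rewrite (ge0_integral_pushforward mphi)//; last exact: measurable_funepos.
  by rewrite -funepos_comp preimage_setT.
rewrite (ge0_integral_pushforward mphi)//; last exact: measurable_funeneg.
by rewrite -funeneg_comp preimage_setT.
Qed.

(** * Independence: Fubini's theorem and the pi-lambda argument *)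

Section indep.
Context d0 d1 d2 (Om : measurableType d0) (T1 : measurableType d1)
  (T2 : measurableType d2) (R : realType) (P : probability Om R).
Variables (U : Om -> T1) (W : Om -> T2).
Hypotheses (mU : measurable_fun setT U) (mW : measurable_fun setT W).

Definition indep := forall A B, measurable A -> measurable B ->
  P (U @^-1` A `&` W @^-1` B) = (P (U @^-1` A) * P (W @^-1` B))%E.

(** By uniqueness of product measures the law of (W, U) is the product of the marginals, and Fubini
    applies. The pair is swapped so that the inner integral runs over U. *)
Lemma indep_Fubini (F : T1 * T2 -> R) : indep -> measurable_fun setT F ->
  L1 P (fun w => F (U w, W w)) ->
  Rintg P (fun w => F (U w, W w)) = Rintg P (fun w => Rintg P (fun w' => F (U w', W w))).
Proof.
move=> UW mF LF.
pose U' : {mfun Om >-> T1} := HB.pack U (isMeasurableFun.Build _ _ _ _ U mU).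
pose W' : {mfun Om >-> T2} := HB.pack W (isMeasurableFun.Build _ _ _ _ W mW).
pose V w := (W w, U w).
have mV : measurable_fun setT V by exact: measurable_fun_pair.
pose V' : {mfun Om >-> (T2 * T1)%type} := HB.pack V (isMeasurableFun.Build _ _ _ _ V mV).
pose mu := distribution P U'; pose nu := distribution P W'.
pose G z := (F (z.2, z.1))%:E.
have muV (A : set (T2 * T1)) : measurable A -> (nu \x mu)%E A = distribution P V' A.
  apply: product_measure_unique => A2 A1 mA2 mA1.
  by rewrite /mu /nu /distribution /pushforward/= muleC -UW// setIC.
have mG : measurable_fun setT G.
  by apply/measurable_EFinP; apply: measurableT_comp => //; exact: measurable_fun_pair.
have LV : (distribution P V').-integrable setT G.
  exact: (integrable_pushforward mV mG).
have Lmn : (nu \x mu)%E.-integrable setT G.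
  apply/integrableP; split=> //; move/integrableP : LV => [_ h].
  by rewrite (eq_measure_integral (distribution P V')) => [|A mA _]; [exact: h|exact: muV].
have E1 : (\int[P]_w (F (U w, W w))%:E = \int[nu \x mu]_z G z)%E.
  rewrite [RHS](eq_measure_integral (distribution P V')); last by move=> A mA _; exact: muV.
  by rewrite (integral_pushforward mV mG).
pose N := fun y : T2 => (\int[mu]_x (F (x, y))%:E)%E.
have E2 : (\int[nu \x mu]_z G z = \int[nu]_y N y)%E.
  by rewrite -[LHS](integral12_prod_meas1 Lmn).
have mS y : measurable_fun setT (fun x => (F (x, y))%:E).
  by apply/measurable_EFinP; exact: measurable_fun_pair1.
have LN : nu.-integrable setT N by exact: (integrable_fubini_F Lmn).
have LNW : P.-integrable setT (N \o W).
  apply/integrableP; split; first by apply: measurableT_comp => //; exact: measurable_int LN.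
  move/integrableP : (LN) => [mN].
  by rewrite ge0_integral_pushforward//; exact: measurableT_comp.
rewrite [LHS]/Rintegral E1 E2.
have -> : (\int[nu]_y N y = \int[P]_w N (W w))%E.
  by rewrite (integral_pushforward mW (measurable_int _ LN)).
have inner w : (N (W w) = \int[P]_w' (F (U w', W w))%:E)%E.
  exact: (integral_pushforwardT P mU (mS _)).
(* The slice integral is finite only almost everywhere, so the extended inner integral and its
   [fine] are compared up to a null set. *)
rewrite /Rintegral; congr fine; apply: ae_eq_integral => //.
- exact: measurable_int LNW.
- apply/measurable_EFinP; apply: measurableT_comp => //.
  rewrite (_ : (fun w => _) = N \o W); first exact: measurable_int LNW.
  by apply/funext => w; rewrite /= inner.
- apply: filterS (integrable_ae measurableT LNW) => w /(_ I) /= Nf _.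
  by rewrite -inner fineK.
Qed.
End indep.

Section pi_lambda_indep.
Context d (Om : measurableType d) (R : realType) (P : probability Om R).
Implicit Types G H : set (set Om).

Definition indep_sets G H := forall A B, G A -> H B -> P (A `&` B) = (P A * P B)%E.

Lemma indep_setsC G H : indep_sets G H -> indep_sets H G.
Proof. by move=> GH A B HA GB; rewrite setIC GH// muleC. Qed.

(** Dynkin induction with [B] fixed: the sets satisfying the product formula against [B] are stable
    under complements and disjoint countable unions. A second use with the roles exchanged extends
    the other family. *)
Lemma indep_sets_sigmal G H : G `<=` measurable -> H `<=` measurable ->
  setI_closed G -> indep_sets G H -> indep_sets <<s G >> H.
Proof.
move=> mG mH GI GH A B sA HB; move: A sA.
have mB := mH _ HB.
have sGm : <<s G >> `<=` (measurable : set (set Om)).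
  exact: (smallest_sub (@sigma_algebra_measurable _ Om) mG).
pose GT := g_sigma_algebraType G.
have mPf C : measurable C -> P C \is a fin_num by move=> mC; exact: fin_num_measure.
apply: (@dynkin_induction _ GT G
  [set A | P (A `&` B) = (P A * P B)%E]) => //=.
- by rewrite setTI (@probability_setT _ _ _ P) mul1e.
- by move=> A GA; exact: GH.
- move=> A mA AB; have mA' := sGm _ mA.
  have -> : ~` A `&` B = B `\` (A `&` B) by rewrite setDE setCI setIUr setICr setU0 setIC.
  rewrite measureD//; last 2 first.
    exact: measurableI.
    by rewrite ltey_eq fin_num_measure.
  rewrite [B `&` _]setIC -setIA setIid.
  rewrite [X in (X - _)%E](_ : _ = (1 * P B)%E) ?mul1e//.
  rewrite probability_setC// muleBl ?mPf// ?AB ?mul1e//.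
  by rewrite -AB.
- move=> F mF tF FB.
  have mF' n : measurable (F n : set Om) by exact: (sGm _ (mF n)).
  have tFB : trivIset [set: nat] (fun k => F k `&` B).
    move=> i j _ _ [x [[Fix _] [Fjx _]]]; exact: (tF i j I I (ex_intro _ x (conj Fix Fjx))).
  rewrite setI_bigcupl !measure_bigcup//=; last first.
    by move=> n _; exact: measurableI.
  have PB : P B = (fine (P B))%:E by rewrite fineK ?mPf.
  rewrite muleC PB -nneseriesZl//; apply: eq_eseriesr => n _.
  by rewrite FB -PB muleC.
Qed.

Lemma indep_sets_sigma G H : G `<=` measurable -> H `<=` measurable ->
  setI_closed G -> setI_closed H -> indep_sets G H -> indep_sets <<s G >> <<s H >>.
Proof.
move=> mG mH GI HI GH.
apply: indep_sets_sigmal => //.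
  exact: (smallest_sub (@sigma_algebra_measurable _ Om) mH).
by apply/indep_setsC/indep_sets_sigmal => //; exact: indep_setsC.
Qed.

Lemma indep_of_sigma d1 d2 (T1 : measurableType d1) (T2 : measurableType d2) G H
    (U : Om -> T1) (W : Om -> T2) :
  G `<=` measurable -> H `<=` measurable ->
  setI_closed G -> setI_closed H -> indep_sets G H ->
  @measurable_fun _ _ (g_sigma_algebraType G) T1 setT U ->
  @measurable_fun _ _ (g_sigma_algebraType H) T2 setT W ->
  indep P U W.
Proof.
move=> mG mH GI HI GH mU mW A B mA mB.
have sU : <<s G >> (U @^-1` A) by rewrite -[_ @^-1` _]setTI; exact: mU.
have sW : <<s H >> (W @^-1` B) by rewrite -[_ @^-1` _]setTI; exact: mW.
exact: (indep_sets_sigma mG mH GI HI GH).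
Qed.

End pi_lambda_indep.

(** * Measures with a density, reflection of Lebesgue measure, integrals with a parameter *)

Section density.
Context d (T : measurableType d) (R : realType).
Variables (m nu : {measure set T -> \bar R}) (f : T -> R).
Hypotheses (mf : measurable_fun setT f) (f0 : forall x, 0 <= f x).
Hypothesis nuE : forall A, measurable A -> nu A = (\int[m]_(x in A) (f x)%:E)%E.
Local Open Scope ereal_scope.
Import HBNNSimple.

(** [nu] is given by its values on sets only, so the formula is checked on simple functions and
    passes to the limit by monotone convergence on both sides. *)
Lemma ge0_integral_density (g : T -> \bar R) : measurable_fun setT g ->
  (forall x, 0 <= g x) -> \int[nu]_x g x = \int[m]_x (g x * (f x)%:E).
Proof.
move=> mg g0; pose h := nnsfun_approx measurableT mg.
have mfE : measurable_fun setT (EFin \o f) by exact/measurable_EFinP.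
have hm n : measurable_fun setT (EFin \o h n).
  by apply/measurable_EFinP; exact: measurable_funP.
transitivity (lim (\int[nu]_x (EFin \o h n) x @[n --> \oo])).
  rewrite -monotone_convergence//.
  - apply: eq_integral => x _; apply/esym/cvg_lim => //.
    by apply: cvg_nnsfun_approx => // ? _; exact: g0.
  - by move=> n x _ /=; rewrite lee_fin.
  - by move=> x _ a b ab; rewrite lee_fin; exact/lefP/nd_nnsfun_approx.
transitivity (lim (\int[m]_x ((EFin \o h n) x * (f x)%:E) @[n --> \oo])); last first.
  rewrite -monotone_convergence//.
  - apply: eq_integral => x _; apply/cvg_lim => //.
    by apply: cvgeZr => //; apply: cvg_nnsfun_approx => // ? _; exact: g0.
  - by move=> n; exact: emeasurable_funM.
  - by move=> n x _ /=; rewrite mule_ge0// lee_fin.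
  - move=> x _ a b ab /=; rewrite lee_wpmul2r ?lee_fin//.
    exact/lefP/nd_nnsfun_approx.
apply: congr_lim; apply/funext => n.
under eq_integral do rewrite /= fimfunE -fsumEFin//.
under [RHS]eq_integral => x _.
  rewrite /= fimfunE -fsumEFin// ge0_mule_fsuml; last first.
    by move=> y; rewrite lee_fin; exact: nnfun_muleindic_ge0.
  over.
rewrite ge0_integral_fsum//; last 2 first.
- by move=> y; apply/measurable_EFinP/measurable_funM => //; apply: measurable_indic; exact: measurable_funPTI.
- by move=> y x _; exact: nnfun_muleindic_ge0.
rewrite ge0_integral_fsum//; last 2 first.
- move=> y; apply: emeasurable_funM; last exact: mfE.
  by apply/measurable_EFinP/measurable_funM.
- by move=> y x _; rewrite mule_ge0 ?lee_fin//; exact: nnfun_muleindic_ge0.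
apply: eq_fsbigr => r rhn.
have r0 : (0 <= r)%R by move: rhn; rewrite inE => -[t _ <-].
have mI : measurable (h n @^-1` [set r]) by exact: measurable_funPTI.
under eq_integral do rewrite EFinM.
under [RHS]eq_integral do rewrite EFinM -muleA.
have mIE : measurable_fun setT (fun x => (\1_(h n @^-1` [set r]) x)%:E : \bar R).
  by apply/measurable_EFinP; exact: measurable_indic.
rewrite ge0_integralZl_EFin//.
rewrite integral_indic// setIT ge0_integralZl_EFin//; last 2 first.
- by move=> x _; rewrite mule_ge0 ?lee_fin.
- by apply: emeasurable_funM.
congr (_ * _); rewrite nuE// integral_mkcond; apply: eq_integral => x _.
by rewrite muleC epatch_indic.
Qed.

Lemma L1_density (g : T -> R) : measurable_fun setT g ->
  L1 nu g <-> L1 m (fun x => g x * f x)%R.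
Proof.
move=> mg.
have E : \int[nu]_x `|(g x)%:E| = \int[m]_x `|(g x * f x)%:E|.
  rewrite ge0_integral_density//; last first.
    by apply: measurableT_comp => //; exact/measurable_EFinP.
  apply: eq_integral => x _ /=.
  by rewrite normrM EFinM (ger0_norm (f0 x)).
split=> /integrableP[_ h]; apply/integrableP; split.
- by apply/measurable_EFinP; exact: measurable_funM.
- by rewrite -E.
- exact/measurable_EFinP.
- by rewrite E.
Qed.

Lemma Rint_density (g : T -> R) : measurable_fun setT g ->
  Rintg nu g = Rintg m (fun x => g x * f x)%R.
Proof.
move=> mg; rewrite /Rintegral; congr fine.
have mgE : measurable_fun setT (EFin \o g) by exact/measurable_EFinP.
rewrite integralE [RHS]integralE; congr (_ - _).
  rewrite ge0_integral_density//; last exact: measurable_funepos.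
  by apply: eq_integral => x _; rewrite !funeposE /= maxe_pMl ?lee_fin// mul0e EFinM.
rewrite ge0_integral_density//; last exact: measurable_funeneg.
by apply: eq_integral => x _; rewrite !funenegE /= maxe_pMl ?lee_fin// mul0e -?EFinN -?EFinM ?mulNr.
Qed.

End density.

(** The image measure gives []u, v]] the length of [[c - v, c - u[], and Lebesgue measure is
    determined by its values on half-open intervals. *)
Lemma integral_lebesgue_reflect (R : realType) (c : R) (F : measurableTypeR R -> \bar R) :
  measurable_fun setT F ->
  (\int[@lebesgue_measure R]_y F (c - y)%R = \int[@lebesgue_measure R]_y F y)%E.
Proof.
move=> mF.
have mphi : @measurable_fun _ _ (measurableTypeR R) (measurableTypeR R) setT (fun y => c - y).
  exact: (@measurable_funB _ R R).
pose phi : {mfun (measurableTypeR R) >-> (measurableTypeR R)} :=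
  HB.pack (fun y : R => c - y) (isMeasurableFun.Build _ _ _ _ _ mphi).
have E A : measurable A -> lebesgue_measure A = pushforward (@lebesgue_measure R) phi A.
  apply: lebesgue_measure_unique => //= _ [[u v]] _ <-.
  rewrite /pushforward/=.
  rewrite (_ : _ @^-1` _ = `[c - v, c - u[%classic); last first.
    by apply/seteqP; split => x /=; rewrite !in_itv/=; lra.
  rewrite !lebesgue_measure_itv/= !lte_fin; case: ifPn; case: ifPn; rewrite -?EFinB => *; try (congr _%:E; lra); exfalso; lra.
rewrite -(@integral_pushforwardT _ _ _ _ _ (@lebesgue_measure R) phi F mphi)//.
by apply: (@eq_measure_integral _ _ _ _ (@lebesgue_measure R) (pushforward (@lebesgue_measure R) phi)) => A mA _; exact: (esym (E _ mA)).
Qed.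

Lemma Rint_lebesgue_reflect (R : realType) (c : R) (F : measurableTypeR R -> R) : measurable_fun setT F ->
  Rintg (@lebesgue_measure R) (fun y => F (c - y)) = Rintg (@lebesgue_measure R) F.
Proof.
move=> mF; rewrite /Rintegral; congr fine.
by apply: (integral_lebesgue_reflect c (F := EFin \o F)); exact/measurable_EFinP.
Qed.

Lemma L1_lebesgue_reflect (R : realType) (c : R) (F : measurableTypeR R -> R) :
  L1 (@lebesgue_measure R) F -> L1 (@lebesgue_measure R) (fun y => F (c - y)).
Proof.
move=> /integrableP[mF h]; apply/integrableP; split.
  apply: (measurableT_comp mF); exact: (@measurable_funB _ R R).
rewrite (integral_lebesgue_reflect c (F := fun y => `|(F y)%:E|%E))//.
exact: measurableT_comp.
Qed.

(** By Tonelli the integrals of positive and negative parts are measurable in the parameter, hence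
    so are their difference and its [fine]; no slice has to be integrable. *)
Lemma measurable_Rint_param d1 d2 (T1 : measurableType d1) (T2 : measurableType d2)
    (R : realType) (m : {sigma_finite_measure set T2 -> \bar R}) (F : T1 * T2 -> R) :
  measurable_fun setT F -> measurable_fun setT (fun x => Rintg m (fun y => F (x, y))).
Proof.
move=> mF; have mFE : measurable_fun setT (EFin \o F) by exact/measurable_EFinP.
rewrite /Rintegral; apply: (@measurableT_comp _ _ _ _ _ _ fine); first exact: fine_measurable.
rewrite (_ : (fun x => _) = (fubini_F m (EFin \o F)^\+ \- fubini_F m (EFin \o F)^\-)%E).
  apply: emeasurable_funB; apply: measurable_fun_fubini_tonelli_F => //.
    exact: measurable_funepos.
  exact: measurable_funeneg.
apply/funext => x; rewrite integralE /fubini_F /=; congr (_ - _)%E;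
  by apply: eq_integral => y _; rewrite ?funeposE ?funenegE.
Qed.

(** * Iterated Lebesgue integrals on R^p *)

Lemma sigma_finite_product d1 d2 (T1 : measurableType d1) (T2 : measurableType d2)
    (R : realType) (m1 : {sigma_finite_measure set T1 -> \bar R})
    (m2 : {sigma_finite_measure set T2 -> \bar R}) : sigma_finite setT (m1 \x m2)%E.
Proof.
have /sigma_finiteP[F [UF ndF Foo]] := sigma_finiteT m1.
have /sigma_finiteP[G [UG ndG Goo]] := sigma_finiteT m2.
exists (fun n => F n `*` G n).
  apply/esym; rewrite -subTset => -[x y] _.
  have [n _ Fx] : (\bigcup_n F n) x by rewrite -UF.
  have [k _ Gy] : (\bigcup_n G n) y by rewrite -UG.
  exists (maxn n k) => //; split => /=.
    by move: x Fx; exact/subsetPset/ndF/leq_maxl.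
  by move: y Gy; exact/subsetPset/ndG/leq_maxr.
move=> k; have [? ?] := Foo k; have [? ?] := Goo k.
split; first exact: measurableX.
by rewrite product_measure1E// lte_mul_pinfty// ge0_fin_numE.
Qed.

Section row_measurable.
Variable R : realType.
Local Notation mR := (measurableTypeR R).

(** The half-space x_k <= a is the union over n of the orthants with bound a at [k] and n
    elsewhere. *)
Lemma measurable_coord p (k : 'I_p) : measurable_fun setT (fun x : RpM R p => x 0 k : mR).
Proof.
apply: (@measurability _ _ (RpM R p) mR setT _ _ (RGenOInfty.measurableE R)).
move=> _ [_ [a ->] <-]; rewrite setTI -setCitvl preimage_setC; apply: measurableC.
pose D n := [set x : RpM R p | forall l, x 0 l <= (\row_l (if l == k then a else n%:R)) 0 l].
rewrite [X in measurable X](_ : _ = \bigcup_n D n).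
  apply: bigcup_measurable => n _; apply: sub_sigma_algebra.
  by exists (\row_l (if l == k then a else n%:R)).
apply/seteqP; split => x /=.
  rewrite in_itv/= => xa; pose M := \sum_l `|x 0 l|.
  exists (truncn M).+1 => // l; rewrite mxE; case: eqP => [->//|_].
  apply: le_trans (ltW (truncnS_gt _)); rewrite /M (bigD1 l)//=.
  apply: le_trans (ler_norm _) _; rewrite lerDl; exact: sumr_ge0.
by move=> [n _] /(_ k); rewrite mxE eqxx in_itv.
Qed.

Lemma measurable_RpM d (T : measurableType d) p (U : T -> RpM R p) :
  (forall k, measurable_fun setT (fun w => U w 0 k : mR)) -> measurable_fun setT U.
Proof.
move=> mU; apply: (@measurability _ _ T (RpM R p) setT U (@orthants R p)) => //.
move=> _ [_ [a _ <-] <-]; rewrite setTI.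
rewrite (_ : _ @^-1` _ = \bigcap_(k in [set: 'I_p]) ((fun w => U w 0 k) @^-1` `]-oo, a 0 k])).
  apply: fin_bigcap_measurable => // k _.
  rewrite -[X in measurable X]setTI; exact: mU.
by apply/seteqP; split => [x h k _|x h k]; [rewrite /= in_itv/=; exact: h|move: (h k I); rewrite /= in_itv].
Qed.

(** Row-vector counterpart of [t :: s], through which the recursion of [iRint] becomes a product
    structure on R^(k+1). *)
Definition consv k (z : R * 'rV[R]_k) : 'rV[R]_k.+1 :=
  \row_j (if unlift ord0 j is Some i then z.2 0 i else z.1).

Lemma row_cons k t (s : seq R) :
  \row_(j < k.+1) nth 0 (t :: s) j = consv (t, \row_(j < k) nth 0 s j).
Proof.
apply/rowP => j; rewrite !mxE; case: unliftP => [i ->|->]//=.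
by rewrite mxE.
Qed.

Lemma measurable_consv k : @measurable_fun _ _ (mR * RpM R k)%type (RpM R k.+1) setT (@consv k).
Proof.
apply: measurable_RpM => j; rewrite /consv.
have [i ->|->] := unliftP ord0 j.
  rewrite (_ : (fun w => _) = (fun x : RpM R k => x 0 i : mR) \o (@snd mR (RpM R k))).
    by apply: measurableT_comp; [exact: measurable_coord|exact: measurable_snd].
  by apply/funext => w; rewrite mxE liftK.
rewrite (_ : (fun w => _) = @fst mR (RpM R k)); first exact: measurable_fst.
by apply/funext => w; rewrite mxE unlift_none.
Qed.

(** The parameter space is arbitrary so that the induction can move the outermost integration
    variable into the parameter. *)
Lemma measurable_iRint k d (T : measurableType d) (G : T * RpM R k -> R) :
  measurable_fun setT G ->
  measurable_fun setT (fun x => iRint k (fun s => G (x, \row_j nth 0 s j))).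
Proof.
elim: k d T G => [|k IH] d T G mG /=.
  by apply: (measurableT_comp mG); exact: measurable_fun_pair.
pose G' (z : (T * mR) * RpM R k) : R := G (z.1.1, consv (z.1.2, z.2)).
have mG' : measurable_fun setT G'.
  apply: (measurableT_comp mG); apply: measurable_fun_pair.
    by apply: measurableT_comp => //; exact: measurable_fst.
  apply: (measurableT_comp (@measurable_consv k)); apply: measurable_fun_pair => //.
  by apply: (measurableT_comp measurable_snd measurable_fst).
have := @measurable_Rint_param _ _ T mR R (@lebesgue_measure R) _ (IH _ _ G' mG').
apply: eq_measurable_fun => x _; rewrite /lebRint; apply: eq_Rint => t.
by congr (iRint k _); apply/funext => s; rewrite /G'/= row_cons.
Qed.

(** [lam] is Lebesgue measure on R^k, built as the image under [consv] of one-dimensional Lebesgue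
    measure times the previous [lam]; later arguments use only this formula and sigma-finiteness.
    Integrability of [G] is what lets Fubini identify the iterated real integral. *)
Lemma iRint_lebesgue k : exists lam : {sigma_finite_measure set (RpM R k) -> \bar R},
  forall G : RpM R k -> R, L1 lam G ->
    iRint k (fun s => G (\row_j nth 0 s j)) = Rintg lam G.
Proof.
elim: k => [|k [lam IH]].
  exists (dirac (0 : RpM R 0)) => G LG /=.
  rewrite /Rintegral integral_dirac//; last exact: measurable_int LG.
  by rewrite diracT mul1e/=; congr G; apply/rowP => -[].
pose cons' : {mfun (mR * RpM R k)%type >-> RpM R k.+1} :=
  HB.pack (@consv k) (isMeasurableFun.Build _ _ _ _ _ (@measurable_consv k)).
pose nu := pushforward (@lebesgue_measure R \x lam)%E cons'.
have nusf : sigma_finite setT nu.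
  have [F UF Foo] := sigma_finite_product (@lebesgue_measure R) lam.
  (* A left inverse of [consv]: pulling the exhausting sets back along it keeps their measures
     finite. *)
  pose unc (v : RpM R k.+1) : mR * RpM R k := (v 0 ord0, \row_j v 0 (lift ord0 j)).
  have munc : measurable_fun setT unc.
    apply: measurable_fun_pair; first exact: measurable_coord.
    apply: measurable_RpM => j; apply: eq_measurable_fun (measurable_coord (lift ord0 j)) => v _.
    by rewrite mxE.
  have uncK z : unc (consv z) = z.
    rewrite /unc/consv mxE unlift_none; case: z => t v /=; congr pair.
    by apply/rowP => j; rewrite !mxE liftK.
  exists (fun n => unc @^-1` F n).
    by rewrite -preimage_bigcup -UF preimage_setT.
  move=> n; split; first by rewrite -[X in measurable X]setTI; apply: munc => //; have [] := Foo n.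
  rewrite /nu/pushforward/= (_ : _ @^-1` _ = F n); first by have [] := Foo n.
  by apply/seteqP; split => z /=; rewrite uncK.
pose nu' : {sigma_finite_measure set (RpM R k.+1) -> \bar R} :=
  HB.pack nu (Measure.on nu) (Measure_isSigmaFinite.Build _ _ _ nu nusf).
have mc := @measurable_consv k.
exists (nu' mc mc mc) => G LG.
have mG := L1_meas LG.
pose H z := G (consv z).
have mH : @measurable_fun _ _ (mR * RpM R k)%type _ setT H.
  exact: (measurableT_comp mG (@measurable_consv k)).
have mHE : @measurable_fun _ _ (mR * RpM R k)%type _ setT (EFin \o H) by exact/measurable_EFinP.
have LH : (@lebesgue_measure R \x lam)%E.-integrable setT (EFin \o H).
  apply/integrableP; split => //.
  move/integrableP : LG => [_]; rewrite /= (@integral_pushforwardT _ _ _ _ _ (@lebesgue_measure R \x lam)%E cons' (fun v => `|(G v)%:E|)%E mc)//.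
  by apply: measurableT_comp => //; exact/measurable_EFinP.
rewrite /Rintegral (_ : integral (nu' mc mc mc) _ _ = \int[@lebesgue_measure R \x lam]_z (H z)%:E)%E; last first.
  by rewrite (@integral_pushforwardT _ _ _ _ _ _ cons' (EFin \o G) (@measurable_consv k))//; exact/measurable_EFinP.
rewrite -(integral12_prod_meas1 LH) /= /lebRint /Rintegral; congr fine.
(* The induction hypothesis applies to integrable slices, that is for almost every [t]. *)
apply: ae_eq_integral => //.
- apply/measurable_EFinP.
  have := @measurable_iRint k _ mR H mH; apply: eq_measurable_fun => t _.
  by congr (iRint k _); apply/funext => s; rewrite row_cons.
- exact: (measurable_fubini_F LH).
apply: filterS (ae_integrable1 LH) => t Lt _.
transitivity (Rintg lam (fun v => H (t, v)))%:E; last exact: (esym (L1_EFin Lt)).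
rewrite -IH//; congr EFin.
by congr (iRint k _); apply/funext => s; rewrite row_cons.
Qed.

End row_measurable.

(** * Gaussian characteristic functions *)

Section trig_bounds.
Variable R : realType.
Implicit Types x : R.

(** By the mean value theorem a bound of degree n on the derivative becomes one of degree n+1 on the
    function, with the same constant. Four rounds from |cos| <= 1 give the Taylor bounds below, with
    1 in place of the inverse factorials. *)
Lemma mvt_bound (F f : R -> R) (c : R) (n : nat) x :
  (forall t : R, is_derive t 1 F (f t)) -> F 0 = 0 ->
  (forall t, `|f t| <= c * `|t| ^+ n) -> `|F x| <= c * `|x| ^+ n.+1.
Proof.
move=> dF F0 fb.
have cF : continuous F.
  by move=> t; apply/differentiable_continuous/derivable1_diffP; apply: ex_derive; exact: dF.
have c0 : 0 <= c.
  by have := fb 1; rewrite normr1 expr1n mulr1; apply: le_trans.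
have [x0|x0] := leP 0 x.
  have [t /itvP tx] := MVT_segment x0 (fun t _ => dF t) (continuous_subspaceT cF).
  rewrite F0 !subr0 => ->; rewrite normrM exprSr mulrA ler_wpM2r//.
  apply: le_trans (fb t) _; rewrite ler_wpM2l// lerXn2r ?nnegrE//.
  by rewrite !ger0_norm ?tx.
have [t /itvP tx] := MVT_segment (ltW x0) (fun t _ => dF t) (continuous_subspaceT cF).
rewrite F0 !sub0r => /eqP; rewrite eqr_oppLR => /eqP ->; rewrite mulrN opprK normrM exprSr mulrA ler_wpM2r//.
apply: le_trans (fb t) _; rewrite ler_wpM2l// lerXn2r ?nnegrE//.
by rewrite !ler0_norm ?tx ?(ltW x0)// lerN2 tx.
Qed.

Lemma sin_le_norm x : `|sin x| <= `|x|.
Proof.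
rewrite -[leRHS]mul1r -[X in _ * X]expr1.
apply: (@mvt_bound sin cos); [exact: sin0|].
by move=> t; rewrite expr0 mulr1; exact: cos_max.
Qed.

Lemma cos_1_bound x : `|cos x - 1| <= x ^+ 2.
Proof.
rewrite -real_normK ?num_real// -[leRHS]mul1r.
apply: (mvt_bound (F := fun x => cos x - 1) (f := fun x => - sin x)) => [t||t].
- by apply: is_derive_eq; rewrite subr0.
- by rewrite cos0 subrr.
- by rewrite normrN expr1 mul1r sin_le_norm.
Qed.

Lemma sin_x_bound x : `|sin x - x| <= `|x| ^+ 3.
Proof.
rewrite -[leRHS]mul1r.
apply: (mvt_bound (F := fun x => sin x - x) (f := fun x => cos x - 1)) => [|t].
- by rewrite sin0 subrr.
- by rewrite mul1r real_normK ?num_real// cos_1_bound.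
Qed.

Lemma cos_x_bound x : `|cos x - 1 + x ^+ 2 / 2| <= x ^+ 4.
Proof.
have -> : x ^+ 4 = 1 * `|x| ^+ 4.
  by rewrite mul1r (exprM `|x| 2 2) real_normK ?num_real// -exprM.
apply: (mvt_bound (F := fun x => cos x - 1 + x ^+ 2 / 2) (f := fun x => - (sin x - x))) => [t||t].
- apply: is_derive_eq; rewrite /GRing.scale/= ?expr1 ?subr0 ?mulr1 ?scaler0 ?addr0.
  by field.
- by rewrite cos0; ring.
- by rewrite normrN mul1r sin_x_bound.
Qed.

(** Valid for every x, from the cubic bound when |x| <= 1 and the triangle inequality beyond; it
    asks only for a second moment. *)
Lemma sin_x_bound2 x : `|sin x - x| <= 2 * x ^+ 2.
Proof.
have [x1|x1] := leP `|x| 1.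
  apply: le_trans (sin_x_bound x) _; rewrite exprSr real_normK ?num_real//.
  rewrite mulrC; apply: ler_wpM2r; first exact: sqr_ge0.
  by apply: le_trans x1 _; lra.
apply: le_trans (ler_normB _ _) _.
have := sin_le_norm x; rewrite -(real_normK (num_real x)); nra.
Qed.

End trig_bounds.

(** Fundamental theorem of calculus on growing symmetric intervals, then dominated convergence under
    |f|. *)
Lemma Rint_derive_eq0 (R : realType) (F f : R -> R) :
  (forall x : R, is_derive x 1 F (f x)) -> continuous f -> L1 (@lebesgue_measure R) f ->
  (fun n : nat => F n%:R) @ \oo --> (0 : R) -> (fun n : nat => F (- n%:R)) @ \oo --> (0 : R) ->
  Rintg (@lebesgue_measure R) f = 0.
Proof.
move=> dF cf Lf F1 F2.
have cF : continuous F.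
  by move=> t; apply/differentiable_continuous/derivable1_diffP; apply: ex_derive; exact: dF.
(* [n.+1] rather than [n], so that the interval never reduces to a point. *)
pose I_ (n : nat) : set R := `[- n.+1%:R, n.+1%:R]%classic.
pose f_ n x := (f x * \1_(I_ n) x)%:E.
have mI n : measurable (I_ n : set (measurableTypeR R)) by exact: measurable_itv.
have FTC n : (\int[@lebesgue_measure R]_x f_ n x = (F n.+1%:R - F (- n.+1%:R))%:E)%E.
  rewrite EFinB -(@continuous_FTC2 _ f F)//.
  - rewrite [RHS]integral_mkcond; apply: eq_integral => x _.
    by rewrite /f_ epatch_indic EFinM.
  - by have := ltr0Sn R n; lra.
  - exact: continuous_subspaceT.
  - split; first by move=> x _; apply: ex_derive; exact: dF.
    + by apply: cvg_at_right_filter; exact: cF.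
    + by apply: cvg_at_left_filter; exact: cF.
  - by move=> x _; rewrite derive1E; apply: derive_val; exact: dF.
have [||||//|_ _ h] := @dominated_convergence _ _ _ (@lebesgue_measure R) setT measurableT f_
    (EFin \o f) (fun x => `|f x|%:E).
- move=> n; apply/measurable_EFinP; apply: measurable_funM; first exact: L1_meas Lf.
  exact: measurable_indic.
- exact: measurable_int Lf.
- apply: aeW => x _; apply: cvg_near_cst.
  near=> n; rewrite /f_ /= indicE mem_set ?mulr1//.
  rewrite /I_/= in_itv/= -ler_norml.
  have : `|x| <= n%:R by near: n; exact: nbhs_infty_ger.
  by move=> /le_trans; apply; rewrite ler_nat.
- exact: integrable_norm.
- apply: aeW => x n _; rewrite /f_ lee_fin normrM ler_piMr// indicE.
  by case: (_ \in _); rewrite ?normr1 ?normr0.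
have h2 : (fun n => \int[@lebesgue_measure R]_x f_ n x)%E @ \oo --> (0%:E : \bar R).
  under eq_fun do rewrite FTC.
  apply: cvg_EFin; first exact: nearW.
  rewrite -[X in _ --> X]subr0; apply: cvgB.
    by rewrite -(cvg_shiftS (fun n => F n%:R)) in F1; exact: F1.
  by rewrite -(cvg_shiftS (fun n => F (- n%:R))) in F2; exact: F2.
by rewrite /Rintegral -(cvg_lim _ h)// (cvg_lim _ h2).
Unshelve. all: end_near. Qed.

Lemma measurable_cos d (T : measurableType d) (R : realType) (f : T -> R) :
  measurable_fun setT f -> measurable_fun setT (fun x => cos (f x)).
Proof.
by move=> mf; apply: (measurableT_comp _ mf); apply: continuous_measurable_fun; exact: continuous_cos.
Qed.

Lemma measurable_sin d (T : measurableType d) (R : realType) (f : T -> R) :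
  measurable_fun setT f -> measurable_fun setT (fun x => sin (f x)).
Proof.
by move=> mf; apply: (measurableT_comp _ mf); apply: continuous_measurable_fun; exact: continuous_sin.
Qed.

Section gauss_chf.
Variable R : realType.
Local Notation mR := (measurableTypeR R).
Local Notation phi := (@normal_pdf R 0 1).
Local Notation N01 := (@normal_prob R 0 1).
Local Notation leb := (@lebesgue_measure R).

Lemma phiE x : phi x = normal_peak 1 * expR (- (x ^+ 2 / 2)).
Proof.
rewrite normal_pdfE ?oner_neq0// /normal_fun subr0 expr1n.
by congr (_ * expR _); rewrite -mulr_natl mulr1 mulNr.
Qed.

Lemma measurable_phi : measurable_fun setT (phi : mR -> mR).
Proof. exact: measurable_normal_pdf. Qed.

Lemma L1_N01 (g : mR -> R) : measurable_fun setT g ->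
  L1 N01 g <-> L1 leb (fun x => g x * phi x).
Proof. by apply: L1_density => // [|x]; [exact: measurable_phi|exact: normal_pdf_ge0]. Qed.

Lemma Rint_N01 (g : mR -> R) : measurable_fun setT g ->
  Rintg N01 g = Rintg leb (fun x => g x * phi x).
Proof. by apply: Rint_density => // [|x]; [exact: measurable_phi|exact: normal_pdf_ge0]. Qed.

Lemma L1_N01_sqr : L1 N01 (fun x : mR => x ^+ 2).
Proof.
apply/L1_N01; first exact: (@measurable_funX _ mR R).
(* With u = 3 x^2 / 8, the inequality u <= e^u gives x^2 e^(-x^2/2) <= (8/3) e^(-x^2/8), a multiple
   of the Gaussian density of standard deviation 2. *)
pose C := (8 / 3) * normal_peak 1 / normal_peak (2 : R).
have p2 : 0 < normal_peak (2 : R) by rewrite normal_peak_gt0.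
have p1 := normal_peak_ge0 (1 : R).
apply: (@L1_le _ _ _ _ _ (fun x : mR => C * normal_pdf 0 2 x : R)).
- apply: measurable_funM; [exact: (@measurable_funX _ mR R)|exact: measurable_phi].
- move=> x; rewrite ger0_norm; last by apply: mulr_ge0; [exact: sqr_ge0|exact: normal_pdf_ge0].
  rewrite phiE normal_pdfE// /C /normal_fun subr0.
  rewrite (_ : _ / normal_peak 2 * _ = (8 / 3) * normal_peak 1 * expR (- x ^+ 2 / (2 ^+ 2 *+ 2))); last first.
    by field; rewrite gt_eqF.
  suff h : x ^+ 2 * expR (- (x ^+ 2 / 2)) <= 8 / 3 * expR (- x ^+ 2 / (2 ^+ 2 *+ 2)).
    by have := ler_wpM2l p1 h; lra.
  have -> : - x ^+ 2 / (2 ^+ 2 *+ 2) = 3 * x ^+ 2 / 8 + - (x ^+ 2 / 2) by field.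
  rewrite expRD mulrA ler_wpM2r ?expR_ge0//.
  have := expR_ge1Dx (3 * x ^+ 2 / 8); lra.
- have h : L1 leb (normal_pdf 0 2) := integrable_normal_pdf 0 2. exact: (L1Z C h).
Qed.

Lemma measurable_mulr (a : R) : measurable_fun setT (fun x : mR => a * x : R).
Proof. exact: (@measurable_funM _ R R). Qed.

Lemma L1_N01_xsin a : L1 N01 (fun x : mR => x * sin (a * x)).
Proof.
apply: (@L1_le _ _ _ _ _ (fun x : mR => 1 + x ^+ 2)).
- apply: (@measurable_funM _ mR R) => //.
  by apply: measurable_sin; exact: measurable_mulr.
- move=> x; rewrite normrM; have := sin_max (a * x).
  rewrite -(real_normK (num_real x)); have := normr_ge0 x.
  have := normr_ge0 (sin (a * x)); nra.
- by apply: L1D; [exact: L1_cst|exact: L1_N01_sqr].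
Qed.

Lemma L1_N01_cos a : L1 N01 (fun x : mR => cos (a * x)).
Proof.
apply: (@L1_bdd _ _ _ _ _ 1); last by move=> x; exact: cos_max.
by apply: measurable_cos; exact: measurable_mulr.
Qed.

Lemma cvg_expN_sqr : (fun n : nat => expR (- (n%:R ^+ 2 / 2)) : R) @ \oo --> (0 : R).
Proof.
apply/cvgrPdist_le => e e0; near=> n.
rewrite sub0r normrN ger0_norm ?expR_ge0//.
rewrite expRN -[leRHS]invrK lef_pV2 ?posrE ?expR_gt0 ?invr_gt0//.
apply: le_trans (expR_ge1Dx _).
have : e^-1 + 1 <= n%:R by near: n; exact: nbhs_infty_ger.
have : 0 < e^-1 by rewrite invr_gt0.
nra.
Unshelve. all: end_near. Qed.

(** Stein's identity for the sine: the derivative of sin(a x) phi(x) is (a cos(a x) - x sin(a x))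
    phi(x), and its integral vanishes. *)
Lemma gauss_stein a :
  Rintg N01 (fun x : mR => x * sin (a * x)) = a * Rintg N01 (fun x : mR => cos (a * x)).
Proof.
have ms : measurable_fun setT (fun x : mR => x * sin (a * x)).
  by apply: (@measurable_funM _ mR R) => //; apply: measurable_sin; exact: measurable_mulr.
have mc : measurable_fun setT (fun x : mR => cos (a * x)).
  by apply: measurable_cos; exact: measurable_mulr.
have Ls := (L1_N01 ms).1 (L1_N01_xsin a).
have Lc := (L1_N01 mc).1 (L1_N01_cos a).
rewrite !Rint_N01//; apply/esym/subr0_eq.
rewrite -RintegralZl// -RintegralB//; last exact: L1Z.
have dphi (x : R) : is_derive x 1 phi (- x * phi x).
  rewrite (_ : phi = fun x => normal_peak 1 * expR (- (x ^+ 2 / 2))); last by apply/funext => y; rewrite phiE.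
  apply: is_derive_eq; rewrite /GRing.scale/= ?expr1 ?mulr0 ?addr0.
  by field.
have dF (x : R) : is_derive x 1 (fun x => sin (a * x) * phi x)
   (a * (cos (a * x) * phi x) - x * sin (a * x) * phi x).
  apply: is_derive_eq; rewrite /GRing.scale/= ?mulr1 ?scaler0 ?add0r ?addr0.
  by ring.
apply: (Rint_derive_eq0 dF).
- move=> x; apply/differentiable_continuous/derivable1_diffP; apply: ex_derive.
- apply: (@L1B _ _ _ leb); [exact: (L1Z a Lc)|exact: Ls].
- apply/cvgrPdist_le => e e0.
  have /cvgrPdist_le /(_ (e / (normal_peak 1 + 1))) := cvg_expN_sqr.
  have p1 := normal_peak_ge0 (1 : R).
  case=> [|n _ h]; first by rewrite divr_gt0//; lra.
  exists n => // m /= nm; have := h m nm; rewrite !sub0r !normrN normrM phiE.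
  rewrite ler_pdivlMr; last lra.
  have E0 := expR_ge0 (- (m%:R ^+ 2 / 2) : R).
  rewrite (ger0_norm E0) (ger0_norm (mulr_ge0 p1 E0)) => h1.
  have := sin_max (a * m%:R); have := mulr_ge0 p1 E0; nra.
- apply/cvgrPdist_le => e e0.
  have /cvgrPdist_le /(_ (e / (normal_peak 1 + 1))) := cvg_expN_sqr.
  have p1 := normal_peak_ge0 (1 : R).
  case=> [|n _ h]; first by rewrite divr_gt0//; lra.
  exists n => // m /= nm; have := h m nm; rewrite !sub0r !normrN normrM phiE sqrrN.
  rewrite ler_pdivlMr; last lra.
  have E0 := expR_ge0 (- (m%:R ^+ 2 / 2) : R).
  rewrite (ger0_norm E0) (ger0_norm (mulr_ge0 p1 E0)) => h1.
  have := sin_max (a * - m%:R); have := mulr_ge0 p1 E0; nra.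
Qed.

End gauss_chf.

Section gauss_chf2.
Variable R : realType.
Local Notation mR := (measurableTypeR R).
Local Notation phi := (@normal_pdf R 0 1).
Local Notation N01 := (@normal_prob R 0 1).
Local Notation leb := (@lebesgue_measure R).

(** Stein's identity gives C'(a) = - a C(a), so C(a) e^(a^2/2) is constant, equal to C(0) = 1. *)
Lemma gauss_cos a : Rintg N01 (fun x : mR => cos (a * x)) = expR (- (a ^+ 2 / 2)).
Proof.
pose C a := Rintg N01 (fun x : mR => cos (a * x)).
pose K := 3 * Rintg N01 (fun x : mR => x ^+ 2).
have K0 : 0 <= K by rewrite mulr_ge0//; apply: Rintegral_ge0 => x _; exact: sqr_ge0.
(* A quadratic bound on the increment of [C] replaces differentiation under the integral. In [K], 1
   comes from the cosine remainder and 2 from the sine remainder. *)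
have bound b h : `|C (b + h) - C b + h * (b * C b)| <= K * h ^+ 2.
  rewrite /C -gauss_stein -RintegralZl//; last exact: L1_N01_xsin.
  rewrite -RintegralB//; [|exact: L1_N01_cos|exact: L1_N01_cos].
  have LB := L1B (L1_N01_cos (b + h)) (L1_N01_cos b).
  have LS := L1Z h (L1_N01_xsin b).
  rewrite -RintegralD// /K mulrAC -RintegralZl//; last exact: L1_N01_sqr.
  apply: Rint_le_abs; [exact: L1D|exact: L1Z (L1_N01_sqr _)|].
  move=> x; rewrite /= mulrDl cosD.
  rewrite [X in `|X|](_ : _ = cos (b * x) * (cos (h * x) - 1) - sin (b * x) * (sin (h * x) - h * x)); last by ring.
  apply: le_trans (ler_normB _ _) _; rewrite !normrM.
  have c1 := cos_max (b * x); have s1 := sin_max (b * x).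
  have := cos_1_bound (h * x); have := sin_x_bound2 (h * x).
  rewrite exprMn.
  have := normr_ge0 (cos (h * x) - 1); have := normr_ge0 (sin (h * x) - h * x); nra.
have dC (b : R) : is_derive b 1 C (- (b * C b)).
  have cv : (fun h : R => h^-1 *: (C (h *: 1 + b) - C b)) @ 0^' --> - (b * C b).
    apply/cvgrPdist_le => e e0; near=> h.
    have h0 : h != 0 by near: h; exact: nbhs_dnbhs_neq.
    have := bound b h; rewrite /GRing.scale/= mulr1 [h + b]addrC.
    rewrite (_ : - _ - _ = - (h^-1 * (C (b + h) - C b + h * (b * C b)))); last by field.
    rewrite normrN normrM normfV => bb.
    rewrite ler_pdivrMl ?normr_gt0//; apply: le_trans bb _.
    have : `|h| <= e / (K + 1).
      near: h; apply: dnbhs0_le; rewrite divr_gt0//; lra.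
    rewrite ler_pdivlMr; last lra.
    rewrite -(real_normK (num_real h)); have := normr_ge0 h; nra.
  apply: DeriveDef; first by apply/cvg_ex; eexists; exact: cv.
  exact: cvg_lim cv.
have dD (b : R) : is_derive b 1 (fun b => C b * expR (b ^+ 2 / 2)) 0.
  apply: is_derive_eq; rewrite /GRing.scale/= ?expr1 ?mulr0 ?addr0 ?mulr1.
  by field.
have := @is_derive_0_is_cst R (fun b => C b * expR (b ^+ 2 / 2)) a 0 dD.
rewrite {2}/C (_ : Rintg _ _ = 1); last first.
  rewrite -[RHS](Rint_cst N01); apply: eq_Rint => x; by rewrite mul0r cos0.
rewrite expr0n/= mul0r expR0 mulr1 => /(congr1 ( *%R^~ (expR (- (a ^+ 2 / 2))))).
by rewrite mul1r -mulrA -expRD subrr expR0 mulr1.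
Unshelve. all: end_near. Qed.

Lemma gauss_sin a : Rintg N01 (fun x : mR => sin (a * x)) = 0.
Proof.
have ms : measurable_fun setT (fun x : mR => sin (a * x)).
  by apply: measurable_sin; exact: measurable_mulr.
have Ls : L1 N01 (fun x : mR => sin (a * x)).
  by apply: (@L1_bdd _ _ _ _ _ 1) => // x; exact: sin_max.
have Lp := (L1_N01 ms).1 Ls.
rewrite Rint_N01//.
set I := Rintg _ _; suff : I = - I by lra.
rewrite -[LHS](Rint_lebesgue_reflect 0 (L1_meas Lp)) -RintN//; apply: eq_Rint => y.
by rewrite sub0r mulrN sinN mulNr !phiE sqrrN.
Qed.

(** The phase [c] holds the cosine and sine transforms together; in several dimensions it also
    absorbs the coordinate that is still held fixed. *)
Lemma gauss_cos_shift a c :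
  Rintg N01 (fun x : mR => cos (c + a * x)) = expR (- (a ^+ 2 / 2)) * cos c.
Proof.
have Ls : L1 N01 (fun x : mR => sin (a * x)).
  apply: (@L1_bdd _ _ _ _ _ 1) => [|x]; last exact: sin_max.
  by apply: measurable_sin; exact: measurable_mulr.
have Lc := @L1_N01_cos R a.
transitivity (Rintg N01 (fun x : mR => cos c * cos (a * x) - sin c * sin (a * x))).
  by apply: eq_Rint => x; rewrite cosD.
rewrite RintegralB//; [|exact: L1Z|exact: L1Z].
by rewrite !RintegralZl// gauss_cos gauss_sin mulr0 subr0 mulrC.
Qed.

(** The probability behind iterated integrals against [std_gauss_pdf]: the image under [consv] of
    N(0,1) times the previous one. Bounded test functions make every slice integrable. *)
Lemma iRint_gauss k : exists gam : probability (RpM R k) R,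
  (forall (G : RpM R k -> R) M, measurable_fun setT G -> (forall x, `|G x| <= M) ->
    iRint k (fun s => G (\row_j nth 0 s j) * std_gauss_pdf (\row_(j < k) nth 0 s j)) = Rintg gam G)
  /\ (forall (a : 'I_k -> R) c, Rintg gam (fun v => cos (c + \sum_j a j * v 0 j)) =
        expR (- (\sum_j a j ^+ 2 / 2)) * cos c).
Proof.
elim: k => [|k [gam [IH1 IH2]]].
  have dm (G : RpM R 0 -> R) : measurable_fun setT G -> Rintg (dirac (0 : RpM R 0)) G = G 0.
    move=> mG; rewrite /Rintegral integral_dirac//; last exact/measurable_EFinP.
    by rewrite diracT mul1e.
  exists (dirac (0 : RpM R 0)); split => [G M mG _|a c] /=.
    rewrite dm// /std_gauss_pdf big_ord0 mulr1; congr G; apply/rowP => -[]//.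
  rewrite dm ?big_ord0 ?oppr0 ?expR0 ?mul1r ?addr0//.
  rewrite (_ : (fun v => _) = cst (cos c))//.
  by apply/funext => v; rewrite big_ord0 addr0.
pose cons' : {mfun (mR * RpM R k)%type >-> RpM R k.+1} :=
  HB.pack (@consv R k) (isMeasurableFun.Build _ _ _ _ _ (@measurable_consv R k)).
have Fub (G : RpM R k.+1 -> R) M : measurable_fun setT G -> (forall x, `|G x| <= M) ->
    [/\ measurable_fun setT (fun t : mR => Rintg gam (fun v => G (consv (t, v)))),
        (forall t, L1 gam (fun v => G (consv (t, v)))) &
    Rintg (distribution (N01 \x gam)%E cons') G =
    Rintg N01 (fun t : mR => Rintg gam (fun v => G (consv (t, v))))].
  move=> mG GM.
  have mH : @measurable_fun _ _ (mR * RpM R k)%type _ setT (G \o @consv R k).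
    exact: (measurableT_comp mG (@measurable_consv R k)).
  have LH : L1 (N01 \x gam)%E (G \o @consv R k) by apply: (@L1_bdd _ _ _ _ _ M) => [|x]; [exact: mH|exact: GM].
  have Lt t : L1 gam (fun v => G (consv (t, v))).
    apply: (@L1_bdd _ _ _ _ _ M) => //.
    exact: (measurable_fun_pair2 t mH).
  split=> //; first exact: (@measurable_Rint_param _ _ mR (RpM R k) R gam _ mH).
  rewrite {1}/Rintegral (@integral_pushforwardT _ _ _ _ _ (N01 \x gam)%E cons' (EFin \o G) (@measurable_consv R k)); last exact/measurable_EFinP.
  rewrite -(integral12_prod_meas1 LH) /Rintegral; congr fine; apply: eq_integral => t _.
  by rewrite -/(Rintegral _ _ _) -(L1_EFin (Lt t)).
exists (distribution (N01 \x gam)%E cons'); split => [G M mG GM|a c].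
  have [mI Lt ->] := Fub G M mG GM.
  rewrite Rint_N01// /=; apply: eq_Rint => t.
  (* The density of the first coordinate is moved into the test function, which stays bounded, so
     the induction hypothesis applies. *)
  have pk : forall v, `|phi t * G (consv (t, v))| <= normal_peak 1 * M.
    move=> v; rewrite normrM ger0_norm ?normal_pdf_ge0//.
    by apply: ler_pM => //; [exact: normal_pdf_ge0|rewrite normal_pdf_ub// oner_neq0].
  rewrite mulrC -RintegralZl// -(IH1 _ _ _ pk); last first.
    by apply: measurable_funM => //; exact: L1_meas (Lt t).
  congr (iRint k _); apply/funext => s; rewrite row_cons.
  rewrite {1}/std_gauss_pdf big_ord_recl mxE unlift_none/=.
  rewrite [X in _ * (_ * X)](_ : _ = std_gauss_pdf (\row_(j < k) s`_j)); first by ring.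
  by apply: eq_bigr => i _; rewrite mxE liftK.
have [||_ _ ->] := Fub (fun v => cos (c + \sum_j a j * v 0 j)) 1.
- apply: measurable_cos; apply: measurable_funD => //; apply: measurable_sum => j.
  by apply: measurable_funM => //; exact: measurable_coord.
- by move=> x; exact: cos_max.
transitivity (Rintg N01 (fun t : mR => expR (- (\sum_j a (lift ord0 j) ^+ 2 / 2)) * cos (c + a ord0 * t))).
  apply: eq_Rint => t; rewrite -(IH2 (fun j => a (lift ord0 j))).
  apply: eq_Rint => v; congr cos.
  rewrite big_ord_recl !mxE unlift_none/= addrA; congr (_ + _).
  by apply: eq_bigr => j _; rewrite mxE liftK.
rewrite RintegralZl//.
  by rewrite gauss_cos_shift mulrA -expRD big_ord_recl opprD [in RHS]addrC.
apply: (@L1_bdd _ _ _ _ _ 1) => [|x]; last exact: cos_max.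
by apply: measurable_cos; apply: measurable_funD => //; exact: measurable_mulr.
Qed.

End gauss_chf2.

(** [fX] is not known beforehand to be integrable against Lebesgue measure, while iterated integrals
    are identified only for integrable functions. Cutting down to sets of finite measure on which
    [fX] is at most n gives integrable functions; letting n grow shows that [mu] has density
    [fX]. *)
Lemma intRp_law (R : realType) p (fX : 'rV[R]_p -> R)
    (mu : {measure set (RpM R p) -> \bar R}) (phi : RpM R p -> R) :
  @measurable_fun _ _ (RpM R p) R setT fX -> (forall x, 0 <= fX x) ->
  (forall A : set (RpM R p), measurable A -> mu A = (intRp (fun x => \1_A x * fX x))%:E) ->
  measurable_fun setT phi -> L1 mu phi ->
  intRp (fun x => phi x * fX x) = Rintg mu phi.
Proof.
move=> mf f0 muE mphi Lphi.
have [lam lamE] := iRint_lebesgue R p.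
have /sigma_finiteP[F [UF ndF Foo]] := sigma_finiteT lam.
pose A_ n := F n `&` [set x : RpM R p | fX x <= n%:R].
have mA n : measurable (A_ n).
  apply: measurableI; first by have [] := Foo n.
  rewrite -[X in measurable X]setTI -preimage_itvNyc; exact: mf.
have ndA : nondecreasing_seq A_.
  move=> m n mn; apply/subsetPset => x [Fx /= fx]; split.
    by move: x Fx {fx}; exact/subsetPset/ndF.
  by apply: le_trans fx _; rewrite ler_nat.
have UA : \bigcup_n A_ n = setT.
  rewrite -subTset => x _.
  have [n _ Fx] : (\bigcup_n F n) x by rewrite -UF.
  exists (maxn n (truncn (fX x)).+1) => //; split.
    move: Fx; set m := maxn _ _; have : F n `<=` F m by apply/subsetPset/ndF; exact: leq_maxl.
    exact.
  rewrite /=; apply: le_trans (ltW (truncnS_gt _)) _.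
  by rewrite ler_nat leq_maxr.
have dens A : measurable A -> mu A = (\int[lam]_(x in A) (fX x)%:E)%E.
  move=> mAA; rewrite integral_mkcond.
  have L n : L1 lam (fun x => \1_(A_ n `&` A) x * fX x).
    have mI : measurable (A_ n `&` A) by exact: measurableI.
    apply: (@L1_le _ _ _ _ _ (fun x => n%:R * \1_(A_ n `&` A) x)).
    - by apply: measurable_funM => //; exact: measurable_indic.
    - move=> x; rewrite indicE; case: (boolP (x \in _)) => [/set_mem[[_ fn] _]|_] /=.
        by rewrite mul1r mulr1 ger0_norm.
      by rewrite mul0r mulr0 normr0.
    - apply: L1Z; apply: L1_indic => //.
      apply: (@le_lt_trans _ _ (lam (F n))); last by have [] := Foo n.
      apply: le_measure; rewrite ?inE//; first by have [] := Foo n.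
      by move=> x [[]].
  have E n : mu (A_ n `&` A) = (\int[lam]_x (\1_(A_ n `&` A) x * fX x)%:E)%E.
    rewrite muE; last exact: measurableI.
    by rewrite L1_EFin// -lamE.
  have c1 : mu (A_ n `&` A) @[n --> \oo] --> mu A.
    rewrite -[X in _ --> mu X]setTI -UA setI_bigcupl.
    apply: nondecreasing_cvg_mu.
    - by move=> n; exact: measurableI.
    - by apply: bigcup_measurable => n _; exact: measurableI.
    - by move=> m n mn; apply/subsetPset; apply: setSI; exact/subsetPset/ndA.
  have c2 : (\int[lam]_x (\1_(A_ n `&` A) x * fX x)%:E)%E @[n --> \oo] -->
      (\int[lam]_x (((fun x => (fX x)%:E) \_ A) x))%E.
    rewrite (_ : (\int[lam]_x _)%E =
      (\int[lam]_x (limn (fun n => (\1_(A_ n `&` A) x * fX x)%:E)))%E).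
      apply: cvg_monotone_convergence => //.
      - by move=> n; apply/measurable_EFinP; exact: L1_meas (L n).
      - by move=> n x _; rewrite lee_fin mulr_ge0.
      - move=> x _ m n mn; rewrite lee_fin ler_wpM2r// !indicE.
        case: (boolP (x \in A_ m `&` A)) => [/set_mem[h1 h2]|_]; last by rewrite mulr0n ler0n.
        rewrite mem_set//; split => //.
        by have /subsetPset := ndA _ _ mn; exact.
    apply: eq_integral => x _; apply/esym/cvg_lim => //; apply: cvg_near_cst.
    have [n _ Ax] : (\bigcup_n A_ n) x by rewrite UA.
    near=> m.
    have Am : A_ m x.
      have nm : (n <= m)%N by near: m; exact: nbhs_infty_ge.
      by have /subsetPset := ndA _ _ nm; exact.
    rewrite /patch indicE; case: (boolP (x \in A)) => xA.
      by rewrite mem_set ?mul1r//; split => //; exact: set_mem.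
    by rewrite memNset ?mul0r// => -[_ /mem_set]; rewrite (negbTE xA).
  have EE : (fun n => mu (A_ n `&` A)) =
      (fun n => \int[lam]_x (\1_(A_ n `&` A) x * fX x)%:E)%E by apply/funext => n; exact: E.
  rewrite EE in c1; exact: (cvg_unique _ c1 c2).
rewrite (Rint_density mf f0 dens mphi).
by rewrite /intRp (lamE (fun x => phi x * fX x))//; apply/(L1_density mf f0 dens mphi).
Unshelve. all: end_near. Qed.

(** * Central limit theorem for cosines *)

Lemma indep_Rint_mul d0 d1 d2 (Om : measurableType d0) (T1 : measurableType d1)
    (T2 : measurableType d2) (R : realType) (P : probability Om R)
    (U : Om -> T1) (W : Om -> T2) (f : T1 -> R) (g : T2 -> R) :
  measurable_fun setT U -> measurable_fun setT W -> indep P U W ->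
  measurable_fun setT f -> measurable_fun setT g ->
  L1 P (fun w => f (U w)) -> L1 P (fun w => f (U w) * g (W w)) -> L1 P (fun w => g (W w)) ->
  Rintg P (fun w => f (U w) * g (W w)) = Rintg P (fun w => f (U w)) * Rintg P (fun w => g (W w)).
Proof.
move=> mU mW UW mf mg Lf Lfg Lg.
have mF : measurable_fun setT (fun z : T1 * T2 => f z.1 * g z.2).
  by apply: measurable_funM; [apply: (measurableT_comp mf)|apply: (measurableT_comp mg)].
rewrite (@indep_Fubini _ _ _ _ _ _ _ P U W mU mW _ UW mF Lfg) /=.
rewrite -RintegralZl//; apply: eq_Rint => w.
by rewrite RintegralZr.
Qed.

Section clt_chf.
Context d (Om : measurableType d) (R : realType) (P : probability Om R).
Variables (eta : nat -> Om -> R) (n : nat) (v M : R).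
Let W k w := \sum_(j < k) eta j w.
Hypothesis meta : forall j, measurable_fun setT (eta j).
Hypothesis ind : forall k, (k < n)%N -> indep P (eta k) (W k).
Hypothesis L4 : forall j, L1 P (fun w => eta j w ^+ 4).
Hypothesis E1 : forall j, Rintg P (eta j) = 0.
Hypothesis E2 : forall j, Rintg P (fun w => eta j w ^+ 2) = v.
Hypothesis E4 : forall j, Rintg P (fun w => eta j w ^+ 4) <= M.

Let mW k : measurable_fun setT (W k).
Proof. exact: measurable_sum. Qed.

Let L2 j : L1 P (fun w => eta j w ^+ 2).
Proof.
apply: (@L1_le _ _ _ _ _ (fun w => 1 + eta j w ^+ 4)).
- exact: measurable_funX.
- move=> w; rewrite ger0_norm ?sqr_ge0// -[4%N]/(2 * 2)%N exprM.
  have := sqr_ge0 (eta j w); nra.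
- by apply: L1D => //; exact: L1_cst.
Qed.

Let L11 j : L1 P (eta j).
Proof.
apply: (@L1_le _ _ _ _ _ (fun w => 1 + eta j w ^+ 2)) => //.
- by move=> w; rewrite -(real_normK (num_real (eta j w))); have := normr_ge0 (eta j w); nra.
- by apply: L1D => //; exact: L1_cst.
Qed.

(** Each new term is centred and independent of the partial sum, so no cross term survives. *)
Lemma sum_sqr k : (k <= n)%N ->
  L1 P (fun w => W k w ^+ 2) /\ Rintg P (fun w => W k w ^+ 2) = k%:R * v.
Proof.
elim: k => [_|k IH kn].
  have E : (fun w => W 0 w ^+ 2) = fun=> 0 by apply/funext => w; rewrite /W big_ord0 expr0n.
  by rewrite E mul0r Rintg0; split => //; exact: L1_0.
have [LW EW] := IH (ltnW kn).
have LWk : L1 P (W k) by apply: L1_sum.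
have Lm : L1 P (fun w => eta k w * W k w).
  apply: (@L1_le _ _ _ _ _ (fun w => eta k w ^+ 2 + W k w ^+ 2)) => //.
  - exact: measurable_funM.
  - move=> w; rewrite ler_norml; nra.
  - exact: L1D.
have E : (fun w => W k.+1 w ^+ 2) = (fun w => (W k w ^+ 2 + 2 * (eta k w * W k w)) + eta k w ^+ 2).
  by apply/funext => w; rewrite /W big_ord_recr/=; ring.
have LD : L1 P (fun w => W k w ^+ 2 + 2 * (eta k w * W k w)) by apply: L1D => //; exact: L1Z.
rewrite E; split; first exact: L1D.
rewrite RintegralD// RintegralD//; last exact: L1Z.
rewrite RintegralZl// EW E2.
have := @indep_Rint_mul _ _ _ _ _ _ _ P (eta k) (W k) id id (meta k) (mW k) (ind kn).
rewrite /= => -> //; rewrite E1 mul0r mulr0 addr0 -natr1; ring.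
Qed.

(** From e^(-x) <= 1/(1 + x), the difference is at most x^2/(1 + x). *)
Lemma expRN_bound (x : R) : 0 <= x -> `|expR (- x) - (1 - x)| <= x ^+ 2.
Proof.
move=> x0; have h1 := expR_ge1Dx (- x); have h2 := expR_ge1Dx x.
rewrite ger0_norm; last by lra.
have : expR (- x) <= (1 + x)^-1 by rewrite expRN lef_pV2 ?posrE ?expR_gt0//; lra.
have : (1 + x) * (1 + x)^-1 = 1 by rewrite divff//; lra.
have : 0 <= (1 + x)^-1 by rewrite invr_ge0; lra.
nra.
Qed.

(** The addition formula and independence give a X - b Y with a = E cos(r eta), b = E sin(r eta).
    The moments yield a = e^(-r^2 v/2) + O(r^3) and b = O(r^3); in the constant, M + v^2 accounts
    for a and 1 + M for b. *)
Lemma clt_chf_step r k c : 0 <= r <= 1 -> (k < n)%N ->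
  `|Rintg P (fun w => cos (c + r * W k.+1 w))
     - expR (- (r ^+ 2 * v / 2)) * Rintg P (fun w => cos (c + r * W k w))|
  <= r ^+ 3 * (1 + 2 * M + v ^+ 2).
Proof.
move=> /andP[r0 r1] kn.
have v0 : 0 <= v by rewrite -(E2 0); apply: Rintegral_ge0 => w _; exact: sqr_ge0.
have mrW (f : Om -> R) : measurable_fun setT f -> measurable_fun setT (fun w => c + r * f w) .
  by move=> mf; apply: measurable_funD => //; exact: measurable_funM.
have mre : measurable_fun setT (fun w => r * eta k w) by exact: measurable_funM.
have Lc : L1 P (fun w => cos (r * eta k w)).
  by apply: (@L1_bdd _ _ _ _ _ 1) => [|w]; [exact: measurable_cos|exact: cos_max].
have Ls : L1 P (fun w => sin (r * eta k w)).
  by apply: (@L1_bdd _ _ _ _ _ 1) => [|w]; [exact: measurable_sin|exact: sin_max].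
have LCW : L1 P (fun w => cos (c + r * W k w)).
  by apply: (@L1_bdd _ _ _ _ _ 1) => [|w]; [apply: measurable_cos; exact: mrW|exact: cos_max].
have LSW : L1 P (fun w => sin (c + r * W k w)).
  by apply: (@L1_bdd _ _ _ _ _ 1) => [|w]; [apply: measurable_sin; exact: mrW|exact: sin_max].
have Lcc : L1 P (fun w => cos (r * eta k w) * cos (c + r * W k w)).
  apply: (@L1_bdd _ _ _ _ _ 1) => [|w].
    by apply: measurable_funM; [exact: L1_meas Lc|exact: L1_meas LCW].
  by rewrite normrM mulr_ile1 ?cos_max.
have Lss : L1 P (fun w => sin (r * eta k w) * sin (c + r * W k w)).
  apply: (@L1_bdd _ _ _ _ _ 1) => [|w].
    by apply: measurable_funM; [exact: L1_meas Ls|exact: L1_meas LSW].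
  by rewrite normrM mulr_ile1 ?sin_max.
have mR1 : measurable_fun setT (fun x : R => r * x) by exact: measurable_funM.
have mR2 : measurable_fun setT (fun x : R => c + r * x) by apply: measurable_funD.
have -> : Rintg P (fun w => cos (c + r * W k.+1 w)) =
    Rintg P (fun w => cos (r * eta k w)) * Rintg P (fun w => cos (c + r * W k w)) -
    Rintg P (fun w => sin (r * eta k w)) * Rintg P (fun w => sin (c + r * W k w)).
  rewrite -(@indep_Rint_mul _ _ _ _ _ _ _ P (eta k) (W k) (fun x => cos (r * x)) (fun x => cos (c + r * x)))//; last 3 first.
  - exact: ind.
  - exact: measurable_cos.
  - exact: measurable_cos.
  rewrite -(@indep_Rint_mul _ _ _ _ _ _ _ P (eta k) (W k) (fun x => sin (r * x)) (fun x => sin (c + r * x)))//; last 3 first.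
  - exact: ind.
  - exact: measurable_sin.
  - exact: measurable_sin.
  rewrite -RintegralB//; apply: eq_Rint => w.
  by rewrite /W big_ord_recr/= mulrDr addrA cosD; ring.
set a := Rintg P (fun w => cos (r * eta k w)); set b := Rintg P (fun w => sin (r * eta k w)).
set X := Rintg P _; set Y := Rintg P _.
have X1 : `|X| <= 1.
  rewrite -(Rint_cst P 1); apply: Rint_le_abs => //; first exact: L1_cst.
  by move=> w; exact: cos_max.
have Y1 : `|Y| <= 1.
  rewrite -(Rint_cst P 1); apply: Rint_le_abs => //; first exact: L1_cst.
  by move=> w; exact: sin_max.
have a1 : `|a - 1 + r ^+ 2 * v / 2| <= r ^+ 4 * M.
  have -> : a - 1 + r ^+ 2 * v / 2 =
     Rintg P (fun w => (cos (r * eta k w) - 1) + r ^+ 2 / 2 * eta k w ^+ 2).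
    rewrite RintegralD//; last 2 first.
    - by apply: L1B => //; exact: L1_cst.
    - exact: L1Z.
    rewrite RintegralB//; last exact: L1_cst.
    rewrite RintegralZl// E2 Rint_cst /a; ring.
  apply: (@le_trans _ _ (Rintg P (fun w => r ^+ 4 * eta k w ^+ 4))).
    apply: Rint_le_abs; last 1 first.
    - move=> w; have := cos_x_bound (r * eta k w); rewrite !exprMn.
      by rewrite (_ : r ^+ 2 / 2 * eta k w ^+ 2 = r ^+ 2 * eta k w ^+ 2 / 2)//; ring.
    - by apply: L1D; [apply: L1B => //; exact: L1_cst|exact: L1Z].
    - exact: L1Z.
  by rewrite RintegralZl// ler_wpM2l// exprn_ge0.
(* The bound |eta|^3 <= 1 + eta^4 charges the cubic remainder to the fourth moment. *)
have b1 : `|b| <= r ^+ 3 * (1 + M).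
  have -> : b = Rintg P (fun w => sin (r * eta k w) - r * eta k w).
    by rewrite RintegralB//; [rewrite RintegralZl// E1 mulr0 subr0|exact: L1Z].
  apply: (@le_trans _ _ (Rintg P (fun w => r ^+ 3 * (1 + eta k w ^+ 4)))).
    apply: Rint_le_abs.
    - by apply: L1B => //; exact: L1Z.
    - by apply: L1Z; apply: L1D => //; exact: L1_cst.
    move=> w; apply: le_trans (sin_x_bound _) _.
    rewrite normrM exprMn (ger0_norm r0) ler_wpM2l ?exprn_ge0//.
    have -> : eta k w ^+ 4 = `|eta k w| ^+ 4 by rewrite -normrX ger0_norm// (exprM _ 2 2) sqr_ge0.
    have e0 := normr_ge0 (eta k w); move: (`|eta k w|) e0 => e e0.
    have [e1|e1] := leP e 1.
      have := exprn_ile1 3 e0 e1; have := exprn_ge0 4 e0; lra.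
    have : e ^+ 3 <= e ^+ 4 by rewrite ler_eXn2l.
    lra.
  rewrite RintegralZl//; last by apply: L1D => //; exact: L1_cst.
  rewrite RintegralD//; last exact: L1_cst.
  by rewrite Rint_cst ler_wpM2l ?exprn_ge0// lerD2l.
have q1 := @expRN_bound (r ^+ 2 * v / 2) _.
have {q1} := q1 ltac:(by rewrite !mulr_ge0 ?exprn_ge0// invr_ge0).
set q := expR _ => q1.
have r4 : r ^+ 4 <= r ^+ 3 by rewrite ler_wiXn2l.
have M0 : 0 <= M by apply: le_trans (E4 0); apply: Rintegral_ge0 => w _; rewrite (exprM _ 2 2) sqr_ge0.
have r30 : 0 <= r ^+ 3 by rewrite exprn_ge0.
have aq : `|a - q| <= r ^+ 3 * (M + v ^+ 2).
  rewrite (_ : a - q = (a - 1 + r ^+ 2 * v / 2) - (q - (1 - r ^+ 2 * v / 2))); last by ring.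
  apply: le_trans (ler_normB _ _) _; rewrite mulrDr lerD//.
    by apply: le_trans a1 _; rewrite ler_wpM2r.
  apply: le_trans q1 _; rewrite (_ : (r ^+ 2 * v / 2) ^+ 2 = r ^+ 4 * v ^+ 2 / 4); last by field.
  have := sqr_ge0 v; have := exprn_ge0 4 r0; nra.
rewrite (_ : _ - _ = (a - q) * X - b * Y); last by ring.
apply: le_trans (ler_normB _ _) _; rewrite !normrM.
have := normr_ge0 (a - q); have := normr_ge0 b; nra.
Qed.

(** The n steps cost r^3 each, and n r^2 = 1 leaves a total of order r = n^(-1/2). *)
Lemma clt_chf c : (0 < n)%N ->
  `|Rintg P (fun w => cos (c + (Num.sqrt n%:R)^-1 * W n w)) - expR (- (v / 2)) * cos c|
  <= (Num.sqrt n%:R)^-1 * (1 + 2 * M + v ^+ 2).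
Proof.
move=> n0; set r := (Num.sqrt n%:R)^-1; set K := 1 + 2 * M + v ^+ 2.
have sn : 0 < Num.sqrt n%:R :> R by rewrite sqrtr_gt0 ltr0n.
have r0 : 0 < r by rewrite invr_gt0.
have r2 : n%:R * r ^+ 2 = 1.
  by rewrite /r exprVn sqr_sqrtr ?ler0n// divff// pnatr_eq0 -lt0n.
have r1 : r <= 1.
  by rewrite invf_le1// -[leLHS]sqrtr1 ler_wsqrtr// ler1n.
have v0 : 0 <= v by rewrite -(E2 0); apply: Rintegral_ge0 => w _; exact: sqr_ge0.
set q := expR (- (r ^+ 2 * v / 2)).
have q0 : 0 <= q by exact: expR_ge0.
have q1 : q <= 1 by rewrite /q expR_le1 oppr_le0 !mulr_ge0 ?exprn_ge0// ?invr_ge0// ltW.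
(* The factor [q] is at most 1, so errors of earlier steps are not amplified. *)
have key k : (k <= n)%N -> `|Rintg P (fun w => cos (c + r * W k w)) - q ^+ k * cos c| <= k%:R * (r ^+ 3 * K).
  elim: k => [_|k IH kn].
    rewrite mul0r expr0 mul1r (_ : Rintg _ _ = cos c) ?subrr ?normr0//.
    rewrite -[RHS](Rint_cst P); apply: eq_Rint => w.
    by rewrite /W big_ord0 mulr0 addr0.
  have h := @clt_chf_step r k c _ kn; have {h} := h ltac:(by rewrite ltW).
  rewrite -/q -/K; move: (IH (ltnW kn)); set X := Rintg _ _; set X' := Rintg _ _ => h1 h2.
  rewrite (_ : X' - _ = (X' - q * X) + q * (X - q ^+ k * cos c)); last by rewrite exprS; ring.
  apply: le_trans (ler_normD _ _) _; rewrite -natr1 mulrDl mul1r addrC lerD//.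
  rewrite normrM (ger0_norm q0); apply: le_trans h1; rewrite ler_piMl//.
have := key n (leqnn n).
rewrite -expRM_natl (_ : n%:R * - (r ^+ 2 * v / 2) = - (v / 2)); last first.
  rewrite (_ : n%:R * - _ = - ((n%:R * r ^+ 2) * v / 2)); last by field.
  by rewrite r2 mul1r.
rewrite (_ : n%:R * (r ^+ 3 * K) = n%:R * r ^+ 2 * (r * K)); last by ring.
by rewrite r2 mul1r.
Qed.

End clt_chf.

(** * From cosines to bounded continuous functions *)

Section bernstein.
Variables (R : realType) (I : finType).
Implicit Types (y : I -> R) (st : seq I) (U : (I -> nat) -> R) (k : I -> nat) (i j : I).

Definition incr_at i k : I -> nat := fun j => (k j + (j == i))%N.

(* The value at [y] of the expectation of [U] after independent Bernoulli([y i])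
   increments of the coordinates listed in [st], started at [k]; with [N] copies
   of each coordinate this is the multivariate Bernstein polynomial. *)
Fixpoint bern y st U k : R :=
  if st is i :: st' then y i * bern y st' U (incr_at i k) + (1 - y i) * bern y st' U k
  else U k.

Lemma bernD y st U V k : bern y st (fun k => U k + V k) k = bern y st U k + bern y st V k.
Proof. by elim: st k => [|i st IH] k //=; rewrite !IH; ring. Qed.

Lemma bernZ y st c U k : bern y st (fun k => c * U k) k = c * bern y st U k.
Proof. by elim: st k => [|i st IH] k //=; rewrite !IH; ring. Qed.

Lemma bern_cst y st c k : bern y st (fun=> c) k = c.
Proof. by elim: st k => [|i st IH] k //=; rewrite !IH; ring. Qed.

Lemma bern_sum J (s : seq J) y st (F : J -> (I -> nat) -> R) k :
  bern y st (fun k => \sum_(j <- s) F j k) k = \sum_(j <- s) bern y st (F j) k.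
Proof.
elim: s => [|j s IH].
  rewrite big_nil -[RHS](bern_cst y st 0 k); congr (bern _ _ _ _).
  by apply/funext => ?; rewrite big_nil.
rewrite big_cons -IH -bernD; congr (bern _ _ _ _).
by apply/funext => ?; rewrite big_cons.
Qed.

Lemma bern_le y st U V k : (forall i, 0 <= y i <= 1) ->
  (forall k, U k <= V k) -> bern y st U k <= bern y st V k.
Proof.
move=> y01 UV; elim: st k => [|i st IH] k //=.
have /andP[y0 y1] := y01 i; apply: lerD; rewrite ler_wpM2l// subr_ge0//.
Qed.

(** Second moment of a shifted binomial variable about [z]: squared bias plus variance. *)
Lemma bern_sqr y st i z k :
  bern y st (fun k => ((k i)%:R - z) ^+ 2) k =
  ((k i)%:R + (count_mem i st)%:R * y i - z) ^+ 2 + (count_mem i st)%:R * y i * (1 - y i).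
Proof.
elim: st k => [|j st IH] k /=; first by rewrite !mul0r !addr0.
rewrite !IH /incr_at natrD; have [->|_] := eqVneq j i.
  by rewrite /= natrD; ring.
by rewrite /= ?addn0 ?add0n ?addr0; ring.
Qed.

Definition copies N : seq I := iter N (cat (enum I)) [::].

Lemma count_copies N i : count_mem i (copies N) = N.
Proof.
elim: N => //= N IH; rewrite count_cat IH.
by rewrite count_uniq_mem ?enum_uniq// mem_enum.
Qed.

(** Bernstein's argument: where the rescaled frequencies stay within [dl] of x the error is at most
    [e]; elsewhere it is at most 2M, charged by Chebyshev to a variance of at most N per coordinate.
    The affine map y -> sc y - sh carries [0,1] to the range of the actual argument. *)
Lemma bern_approx y (G : (I -> R) -> R) (M e dl sc sh : R) N :
  (forall i, 0 <= y i <= 1) -> (forall x, `|G x| <= M) -> 0 <= e -> 0 < dl -> (0 < N)%N ->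
  let x := fun i => sc * y i - sh in
  (forall x', (forall i, `|x i - x' i| <= dl) -> `|G x - G x'| <= e) ->
  `|bern y (copies N) (fun k => G (fun i => sc * ((k i)%:R / N%:R) - sh)) (fun=> 0%N) - G x| <=
    e + 2 * M / dl ^+ 2 * sc ^+ 2 * #|I|%:R / N%:R.
Proof.
move=> y01 GM e0 dl0 N0 x Gx.
have Nn : N%:R != 0 :> R by rewrite pnatr_eq0 -lt0n.
have Np : 0 < N%:R :> R by rewrite ltr0n.
have M0 : 0 <= M by apply: le_trans (GM x).
set xk := fun (k : I -> nat) i => sc * ((k i)%:R / N%:R) - sh.
pose Q (k : I -> nat) := \sum_i ((k i)%:R - N%:R * y i) ^+ 2.
pose c := 2 * M / dl ^+ 2 * (sc ^+ 2 / N%:R ^+ 2).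
have c0 : 0 <= c by rewrite /c mulr_ge0// divr_ge0 ?sqr_ge0// mulr_ge0.
have Q0 k : 0 <= Q k by apply: sumr_ge0 => i _; exact: sqr_ge0.
have main k : `|G (xk k) - G x| <= e + c * Q k.
  have [/forallP h|] := boolP [forall i, `|x i - xk k i| <= dl].
    by rewrite distrC; apply: le_trans (Gx _ h) _; rewrite lerDl mulr_ge0.
  rewrite negb_forall => /existsP[i]; rewrite -ltNge => hi.
  apply: (@le_trans _ _ (2 * M)).
    by apply: le_trans (ler_normB _ _) _; have := GM (xk k); have := GM x; lra.
  apply: (@le_trans _ _ (c * Q k)); last by rewrite lerDr.
  have s1 : dl ^+ 2 <= (x i - xk k i) ^+ 2.
    by rewrite -[leRHS]real_normK ?num_real// lerXn2r ?nnegrE ?(ltW dl0)// ltW.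
  have s2 : (x i - xk k i) ^+ 2 = sc ^+ 2 / N%:R ^+ 2 * ((k i)%:R - N%:R * y i) ^+ 2.
    by rewrite /x /xk; field.
  have s3 : ((k i)%:R - N%:R * y i) ^+ 2 <= Q k.
    by rewrite /Q (bigD1 i)//= lerDl; apply: sumr_ge0 => j _; exact: sqr_ge0.
  have s4 : dl ^+ 2 <= sc ^+ 2 / N%:R ^+ 2 * Q k.
    apply: le_trans s1 _; rewrite s2 ler_wpM2l// divr_ge0 ?sqr_ge0//.
  have s5 : 0 <= 2 * M / dl ^+ 2 by rewrite divr_ge0 ?sqr_ge0// mulr_ge0.
  rewrite /c -mulrA; apply: le_trans (ler_wpM2l s5 s4).
  by rewrite divfK// expf_neq0// gt_eqF.
have bQ : bern y (copies N) Q (fun=> 0%N) <= #|I|%:R * N%:R.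
  rewrite bern_sum.
  rewrite [leRHS](_ : _ = \sum_(i : I) N%:R); last by rewrite sumr_const cardT -cardE mulr_natl.
  apply: ler_sum => i _; rewrite bern_sqr count_copies add0r subrr expr0n add0r.
  have /andP[h1 h2] := y01 i; rewrite -mulrA ler_piMr//.
  nra.
have fin : e + c * (#|I|%:R * N%:R) = e + 2 * M / dl ^+ 2 * sc ^+ 2 * #|I|%:R / N%:R.
  rewrite /c; field; rewrite Nn gt_eqF//.
rewrite -fin -[X in _ - X](bern_cst y (copies N) _ (fun=> 0%N)).
have -> : forall a b : R, a - b = a + (-1) * b by move=> a b; ring.
rewrite -bernZ -bernD.
have up : bern y (copies N) (fun k => e + c * Q k) (fun=> 0%N) <= e + c * (#|I|%:R * N%:R).
  by rewrite bernD bernZ bern_cst lerD2l ler_wpM2l.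
have GE k : G (xk k) + -1 * G x = G (xk k) - G x by rewrite mulN1r.
rewrite ler_norml; apply/andP; split; last first.
  by apply: le_trans up; apply: bern_le => // k; rewrite GE; apply: le_trans (ler_norm _) (main k).
rewrite lerNl; apply: le_trans up.
rewrite (_ : - bern _ _ _ _ =
  bern y (copies N) (fun k => -1 * (G (xk k) + -1 * G x)) (fun=> 0%N)); last by rewrite [RHS]bernZ [RHS]mulN1r.
apply: bern_le => // k; rewrite GE mulN1r.
by apply: le_trans (main k); rewrite -normrN; exact: ler_norm.
Qed.

End bernstein.

Section weak_convergence.
Variables (R : realType) (I : finType).
Variables (d1 d2 : measure_display) (Om : measurableType d1) (T : measurableType d2).
Variables (P : probability Om R) (Q : probability T R).
Variables (S : nat -> Om -> I -> R) (Z : T -> I -> R).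

(** Functions along which convergence in law is known. Measurability is asked of the compositions,
    as [I -> R] is given no sigma-algebra here; it is inherited by linear combinations and
    limits. *)
Definition test_fun (F : (I -> R) -> R) :=
  [/\ forall n, measurable_fun setT (F \o S n), measurable_fun setT (F \o Z),
      exists K, forall x, `|F x| <= K &
      (fun n => Rintg P (F \o S n)) @ \oo --> Rintg Q (F \o Z)].

Lemma test_fun_L1 F : test_fun F -> (forall n, L1 P (F \o S n)) /\ L1 Q (F \o Z).
Proof.
move=> [m1 m2 [K FK] _]; split=> [n|]; apply: (@L1_bdd _ _ _ _ _ K) => // w; exact: FK.
Qed.

Lemma test_funD F G : test_fun F -> test_fun G -> test_fun (fun x => F x + G x).
Proof.
move=> tF tG; have [LF1 LF2] := test_fun_L1 tF; have [LG1 LG2] := test_fun_L1 tG.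
move: tF tG => [m1 m2 [K FK] c] [m1' m2' [K' GK] c']; split.
- by move=> n; apply: (measurable_funD (m1 n) (m1' n)).
- by apply: (measurable_funD m2 m2').
- exists (K + K') => x; apply: le_trans (ler_normD _ _) _; exact: lerD.
- have -> : Rintg Q ((fun x => F x + G x) \o Z) = Rintg Q (F \o Z) + Rintg Q (G \o Z).
    exact: (RintegralD measurableT LF2 LG2).
  have -> : (fun n => Rintg P ((fun x => F x + G x) \o S n)) =
      (fun n => Rintg P (F \o S n) + Rintg P (G \o S n)).
    by apply/funext => n; exact: (RintegralD measurableT (LF1 n) (LG1 n)).
  exact: cvgD.
Qed.

Lemma test_funZ c F : test_fun F -> test_fun (fun x => c * F x).
Proof.
move=> tF; have [LF1 LF2] := test_fun_L1 tF.
move: tF => [m1 m2 [K FK] cv]; split.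
- by move=> n; apply: (measurable_funM _ (m1 n)).
- by apply: (measurable_funM _ m2).
- by exists (`|c| * K) => x; rewrite normrM ler_wpM2l.
- have -> : Rintg Q ((fun x => c * F x) \o Z) = c * Rintg Q (F \o Z).
    by rewrite -RintegralZl.
  have -> : (fun n => Rintg P ((fun x => c * F x) \o S n)) = (fun n => c * Rintg P (F \o S n)).
    by apply/funext => n; rewrite -RintegralZl//; exact: LF1.
  by apply: cvgM => //; exact: cvg_cst.
Qed.

(** A three-epsilon argument for the integrals; measurability passes through a pointwise limit of
    approximants of precision 1/(n+1). *)
Lemma test_fun_unif F : (forall e, 0 < e -> exists2 G, test_fun G & forall x, `|F x - G x| <= e) ->
  test_fun F.
Proof.
move=> app.
have /choice[G GP] : forall n : nat, exists G, test_fun G /\ forall x, `|F x - G x| <= n.+1%:R^-1.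
  move=> n; have [|G tG h] := app n.+1%:R^-1; first by rewrite invr_gt0.
  by exists G.
have cvgG x : (fun n => G n x) @ \oo --> F x.
  apply/cvgrPdist_le => e e0.
  near=> n; have [_ h] := GP n; apply: le_trans (h x) _.
  rewrite -[leRHS]invrK lef_pV2 ?posrE ?invr_gt0//.
  apply: le_trans (_ : n%:R <= _); last by rewrite ler_nat.
  near: n; exact: nbhs_infty_ger.
have m1 n : measurable_fun setT (F \o S n).
  apply: (@measurable_fun_cvg _ _ _ setT (fun m => G m \o S n)) => //.
  - by move=> m; have [[h _ _ _] _] := GP m; exact: h.
  - by move=> w _; exact: cvgG.
have m2 : measurable_fun setT (F \o Z).
  apply: (@measurable_fun_cvg _ _ _ setT (fun m => G m \o Z)) => //.
  - by move=> m; have [[_ h _ _] _] := GP m; exact: h.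
  - by move=> w _; exact: cvgG.
have [K FK] : exists K, forall x, `|F x| <= K.
  have [[_ _ [K GK] _] h] := GP 0; exists (K + 1) => x.
  have := h x; have := GK x; rewrite invr1 => h1 h2.
  by rewrite -(subrK (G 0 x) (F x)); apply: le_trans (ler_normD _ _) _; lra.
split=> //; first by exists K.
have LF1 n : L1 P (F \o S n) by apply: (@L1_bdd _ _ _ _ _ K) => // w; exact: FK.
have LF2 : L1 Q (F \o Z) by apply: (@L1_bdd _ _ _ _ _ K) => // w; exact: FK.
apply/cvgrPdist_le => e e0.
have [|H tH FH] := app (e / 3); first by rewrite divr_gt0.
have [LH1 LH2] := test_fun_L1 tH; have [_ _ _ cH] := tH.
have dd1 n : `|Rintg P (F \o S n) - Rintg P (H \o S n)| <= e / 3.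
  rewrite -(RintegralB measurableT (LF1 n) (LH1 n)) -[leRHS](Rint_cst P).
  by apply: Rint_le_abs => [||w]; [exact: L1B|exact: L1_cst|exact: FH].
have dd2 : `|Rintg Q (F \o Z) - Rintg Q (H \o Z)| <= e / 3.
  rewrite -(RintegralB measurableT LF2 LH2) -[leRHS](Rint_cst Q).
  by apply: Rint_le_abs => [||w]; [exact: L1B|exact: L1_cst|exact: FH].
near=> n.
have d3 : `|Rintg Q (H \o Z) - Rintg P (H \o S n)| <= e / 3.
  near: n; move/cvgrPdist_le : cH; apply; exact: divr_gt0.
rewrite (_ : _ - _ = (Rintg Q (F \o Z) - Rintg Q (H \o Z)) +
  ((Rintg Q (H \o Z) - Rintg P (H \o S n)) - (Rintg P (F \o S n) - Rintg P (H \o S n)))); last by ring.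
apply: le_trans (ler_normD _ _) _; have := ler_normB (Rintg Q (H \o Z) - Rintg P (H \o S n))
  (Rintg P (F \o S n) - Rintg P (H \o S n)).
have := dd1 n; lra.
Unshelve. all: end_near. Qed.

Hypothesis chf : forall (t : I -> R) c, test_fun (fun x => cos (c + \sum_i t i * x i)).

(** The product sin(u) cos(v) is half of sin(v + u) - sin(v - u), and the sine is a cosine shifted
    by pi/2: each Bernstein factor yields cosines with a new frequency and phase, which is why [t]
    and [c] vary in the induction. *)
Lemma test_fun_bern (th : R) st (U : (I -> nat) -> R) k t c :
  test_fun (fun x => cos (c + \sum_i t i * x i) *
                     bern (fun i => (1 + sin (th * x i)) / 2) st U k).
Proof.
elim: st k t c => [|i st IH] k t c /=.
  have -> : (fun x => cos (c + \sum_i t i * x i) * U k) =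
    (fun x => U k * cos (c + \sum_i t i * x i)) by apply/funext => x; rewrite mulrC.
  exact: test_funZ.
pose B k x := bern (fun i => (1 + sin (th * x i)) / 2) st U k.
pose tp s j := t j + s * th * (j == i)%:R.
have tpE s x : \sum_j tp s j * x j = \sum_j t j * x j + s * (th * x i).
  rewrite /tp; under eq_bigr do rewrite mulrDl.
  rewrite big_split/=; congr (_ + _).
  rewrite (bigD1 i)//= eqxx mulr1 big1 ?addr0 ?mulrA// => j ji.
  by rewrite (negbTE ji) mulr0 mul0r.
pose A s c x := cos (c + \sum_j tp s j * x j).
have incrE k' x : sin (th * x i) * cos (c + \sum_i t i * x i) * k' =
   (1 / 2) * (A 1 (c - pi / 2) x * k') + (- 1 / 2) * (A (-1) (c - pi / 2) x * k').
  rewrite /A !tpE mul1r mulN1r.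
  rewrite (_ : c - pi / 2 + _ = c + \sum_j t j * x j + th * x i - pi / 2); last by ring.
  rewrite (_ : c - pi / 2 + _ = c + \sum_j t j * x j - th * x i - pi / 2); last by ring.
  by rewrite !cosBpihalf sinD sinB; field.
rewrite [X in test_fun X](_ : _ =
  (fun x => ((1 / 2 * (cos (c + \sum_i t i * x i) * B (incr_at i k) x) +
     1 / 2 * (cos (c + \sum_i t i * x i) * B k x)) +
     (1 / 4 * (A 1 (c - pi / 2) x * B (incr_at i k) x) + - 1 / 4 * (A (-1) (c - pi / 2) x * B (incr_at i k) x))) +
     (- 1 / 4 * (A 1 (c - pi / 2) x * B k x) + 1 / 4 * (A (-1) (c - pi / 2) x * B k x)))); last first.
  apply/funext => x; rewrite -/(B (incr_at i k) x) -/(B k x); have := incrE (B (incr_at i k) x) x; have := incrE (B k x) x.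
  set s := sin _; set C := cos _; lra.
by repeat apply: test_funD; apply: test_funZ; exact: IH.
Qed.

Variables (H : (I -> R) -> R) (M V : R).
Hypothesis HM : forall x, `|H x| <= M.
Hypothesis Huc : forall L e : R, 0 < e -> exists2 dl : R, 0 < dl &
  forall x y, (forall i, `|x i| <= L) -> (forall i, `|x i - y i| <= dl) -> `|H x - H y| <= e.

(** [H] read through the bounded substitute sin(th x)/th, which tends to x as [th] goes to 0. It
    depends on x through sines only, within reach of Bernstein polynomials. *)
Let Hth (th : R) x := H (fun i => sin (th * x i) / th).

Lemma test_fun_Hth th : 0 < th -> test_fun (Hth th).
Proof.
move=> th0; apply: test_fun_unif => e e0.
have e20 : 0 < e / 2 by rewrite divr_gt0.
have [dl dl0 uc] := Huc (th^-1) e20.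
pose C := 2 * M / dl ^+ 2 * (2 / th) ^+ 2 * #|I|%:R.
have M0 : 0 <= M by apply: le_trans (HM (fun=> 0)).
have C0 : 0 <= C by rewrite /C mulr_ge0// mulr_ge0 ?sqr_ge0// divr_ge0 ?sqr_ge0// mulr_ge0.
(* Makes the variance term [C / N] at most e/2. *)
pose N := (truncn (C / (e / 2))).+1.
pose U k := H (fun i => 2 / th * ((k i)%:R / N%:R) - th^-1).
exists (fun x => bern (fun i => (1 + sin (th * x i)) / 2) (copies I N) U (fun=> 0%N)).
  have := test_fun_bern th (copies I N) U (fun=> 0%N) (fun=> 0) 0.
  congr test_fun; apply/funext => x.
  by rewrite big1 ?addr0 ?cos0 ?mul1r// => i _; rewrite mul0r.
move=> x; pose y i := (1 + sin (th * x i)) / 2.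
have y01 i : 0 <= y i <= 1.
  by have := sin_max (th * x i); rewrite ler_norml /y => /andP[h1 h2]; apply/andP; split; lra.
have xE : (fun i => sin (th * x i) / th) = (fun i => 2 / th * y i - th^-1).
  by apply/funext => i; rewrite /y; field; rewrite gt_eqF.
rewrite distrC /Hth xE.
apply: le_trans (@bern_approx R I y H M (e / 2) dl (2 / th) th^-1 N y01 HM _ dl0 _ _) _ => //.
- exact: ltW.
- move=> x' h; apply: uc => // i.
  have := congr1 (@^~ i) xE => /= <-.
  by rewrite normrM normfV (ger0_norm (ltW th0)) ler_pdivrMr// mulVf ?gt_eqF// sin_max.
- rewrite -/C; suff : C / N%:R <= e / 2 by lra.
  rewrite ler_pdivrMr ?ltr0n// mulrC -ler_pdivrMr//.
  exact: (ltW (truncnS_gt _)).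
Qed.

Let sin_close (th x : R) : 0 < th -> `|x - sin (th * x) / th| <= th ^+ 2 * `|x| ^+ 3.
Proof.
move=> th0; have := sin_x_bound (th * x).
rewrite (_ : x - _ = - ((sin (th * x) - th * x) / th)); last by field; rewrite gt_eqF.
rewrite normrN !normrM normfV (ger0_norm (ltW th0)) exprMn => h.
by rewrite ler_pdivrMr//; apply: le_trans h _; rewrite le_eqVlt; apply/orP; left; apply/eqP; ring.
Qed.

Hypothesis V0 : 0 <= V.
Hypothesis LS : forall n i, L1 P (fun w => S n w i ^+ 2).
Hypothesis SV : forall n i, Rintg P (fun w => S n w i ^+ 2) <= V.

(** [H] is compared with [Hth]. Under [P] the second moments confine all the S_n to one box, up to a
    cost controlled by Chebyshev; under [Q] the law is fixed and dominated convergence suffices. *)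
Theorem weak_convergence : test_fun H.
Proof.
have M0 : 0 <= M by apply: le_trans (HM (fun=> 0)).
pose th (m : nat) : R := m.+1%:R^-1.
have th0 m : 0 < th m by rewrite invr_gt0.
have tH m := test_fun_Hth (th0 m).
have th1 m : th m <= 1 by rewrite invf_le1// ler1n.
have close dl L : 0 < dl -> 0 <= L -> \forall m \near \oo, forall x : R, `|x| <= L ->
    `|x - sin (th m * x) / th m| <= dl.
  move=> dl0 L0; near=> m => x xL.
  apply: le_trans (sin_close x (th0 m)) _.
  apply: (@le_trans _ _ (th m * L ^+ 3)).
    apply: ler_pM; rewrite ?exprn_ge0 ?(ltW (th0 m))//; last by rewrite lerXn2r ?nnegrE.
    by rewrite expr2 ler_piMl// ltW.
  rewrite mulrC /th ler_pdivrMr// mulrC -ler_pdivrMr//.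
  apply: (@le_trans _ _ m%:R); last by rewrite ler_nat.
  near: m; exact: nbhs_infty_ger.
have cvgH x : (fun m => Hth (th m) x) @ \oo --> H x.
  apply/cvgrPdist_le => e e0.
  have xL i : `|x i| <= \sum_i `|x i| by rewrite (bigD1 i)//= lerDl; exact: sumr_ge0.
  have [dl dl0 uc] := Huc (\sum_i `|x i|) e0.
  have L0 : 0 <= \sum_i `|x i| by exact: sumr_ge0.
  have := close _ _ dl0 L0; apply: filterS => m h.
  by apply: uc => // i; exact: h.
have m1 n : measurable_fun setT (H \o S n).
  apply: (@measurable_fun_cvg _ _ _ setT (fun m => Hth (th m) \o S n)) => //.
  - by move=> m; have [h _ _ _] := tH m; exact: h.
  - by move=> w _; exact: cvgH.
have m2 : measurable_fun setT (H \o Z).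
  apply: (@measurable_fun_cvg _ _ _ setT (fun m => Hth (th m) \o Z)) => //.
  - by move=> m; have [_ h _ _] := tH m; exact: h.
  - by move=> w _; exact: cvgH.
have LH1 n : L1 P (H \o S n) by apply: (@L1_bdd _ _ _ _ _ M) => // w; exact: HM.
have LH2 : L1 Q (H \o Z) by apply: (@L1_bdd _ _ _ _ _ M) => // w; exact: HM.
split=> //; first by exists M.
have cQ : (fun m => Rintg Q (Hth (th m) \o Z)) @ \oo --> Rintg Q (H \o Z).
  have [||||//|_ _ h] := @dominated_convergence _ _ _ Q setT measurableT
     (fun m => EFin \o (Hth (th m) \o Z)) (EFin \o (H \o Z)) (fun=> M%:E).
  - by move=> m; apply/measurable_EFinP; have [_ h _ _] := tH m; exact: h.
  - exact/measurable_EFinP.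
  - by apply: aeW => z _; apply: cvg_EFin; [exact: nearW|exact: cvgH].
  - exact: L1_cst.
  - by apply: aeW => z n _; rewrite /= lee_fin; exact: HM.
  have h2 : (fun m => (Rintg Q (Hth (th m) \o Z))%:E) @ \oo --> (Rintg Q (H \o Z))%:E.
    rewrite -(L1_EFin LH2) (_ : (fun m => _) =
      (fun m => \int[Q]_z (EFin \o (Hth (th m) \o Z)) z)%E); first exact: h.
    by apply/funext => m; have [_ LQ] := test_fun_L1 (tH m); rewrite -(L1_EFin LQ).
  exact: (fine_cvg h2).
apply/cvgrPdist_le => e e0.
have e40 : 0 < e / 4 by rewrite divr_gt0.
have I0 : 0 <= #|I|%:R :> R by exact: ler0n.
pose K := 2 * M * (#|I|%:R * V).
have K0 : 0 <= K by rewrite mulr_ge0 ?mulr_ge0.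
(* As L >= 1, K/L^2 <= K/L <= e/4: what happens outside the box of radius [L] costs at most a
   quarter of [e]. *)
pose L := 1 + K / (e / 4).
have L1' : 1 <= L by rewrite /L lerDl divr_ge0// ltW.
have L0 : 0 < L by exact: lt_le_trans L1'.
have KL : K / L ^+ 2 <= e / 4.
  rewrite ler_pdivrMr ?exprn_gt0// mulrC -ler_pdivrMr//.
  apply: (@le_trans _ _ L); first by rewrite /L lerDr.
  by rewrite expr2 ler_peMl// ltW.
have [dl dl0 uc] := Huc L e40.
have [m mclose mQ] : exists2 m, (forall x : R, `|x| <= L -> `|x - sin (th m * x) / th m| <= dl) &
    `|Rintg Q (H \o Z) - Rintg Q (Hth (th m) \o Z)| <= e / 4.
  have h1 := close _ _ dl0 (ltW L0).
  have h2 : \forall m \near \oo, `|Rintg Q (H \o Z) - Rintg Q (Hth (th m) \o Z)| <= e / 4.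
    by move/cvgrPdist_le : cQ; apply.
  have [m _ hm] := filterI h1 h2; exists m; have [] := hm m (leqnn m); exact.
have [LF1 LF2] := test_fun_L1 (tH m).
have dS n : `|Rintg P (H \o S n) - Rintg P (Hth (th m) \o S n)| <= e / 2.
  have LQ : L1 P (fun w => \sum_i S n w i ^+ 2) by exact: L1_sum.
  apply: (@le_trans _ _ (Rintg P (fun w => e / 4 + 2 * M / L ^+ 2 * \sum_i S n w i ^+ 2))).
    rewrite -(RintegralB measurableT (LH1 n) (LF1 n)); apply: Rint_le_abs.
    - exact: (L1B (LH1 n) (LF1 n)).
    - by apply: L1D; [exact: L1_cst|exact: L1Z].
    move=> w; set x := S n w.
    have Q0 : 0 <= \sum_i x i ^+ 2 by apply: sumr_ge0 => i _; exact: sqr_ge0.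
    have c0 : 0 <= 2 * M / L ^+ 2 by rewrite divr_ge0 ?sqr_ge0// mulr_ge0.
    have [/forallP h|] := boolP [forall i, `|x i| <= L].
      apply: (@le_trans _ _ (e / 4)); last by rewrite lerDl mulr_ge0.
      by apply: uc => // i; exact: mclose.
    rewrite negb_forall => /existsP[i]; rewrite -ltNge => hi.
    apply: (@le_trans _ _ (2 * M)).
      by apply: le_trans (ler_normB _ _) _; rewrite mulr_natl mulr2n lerD//; exact: HM.
    have s1 : L ^+ 2 <= \sum_i x i ^+ 2.
      apply: (@le_trans _ _ (x i ^+ 2)).
        by rewrite -[leRHS]real_normK ?num_real// lerXn2r ?nnegrE ?(ltW L0)// ltW.
      by rewrite (bigD1 i)//= lerDl; apply: sumr_ge0 => j _; exact: sqr_ge0.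
    have := ler_wpM2l c0 s1; rewrite divfK ?expf_neq0 ?gt_eqF// => s2.
    by apply: le_trans s2 _; rewrite lerDr ltW.
  rewrite RintegralD//; [|exact: L1_cst|exact: L1Z].
  rewrite Rint_cst RintegralZl// Rint_sum//.
  have s3 : \sum_i Rintg P (fun w => S n w i ^+ 2) <= #|I|%:R * V.
    rewrite -[leRHS](_ : \sum_(i : I) V = _); last by rewrite sumr_const cardT -cardE mulr_natl.
    by apply: ler_sum => i _; exact: SV.
  have c0 : 0 <= 2 * M / L ^+ 2 by rewrite divr_ge0 ?sqr_ge0// mulr_ge0.
  have := ler_wpM2l c0 s3.
  rewrite (_ : 2 * M / L ^+ 2 * (#|I|%:R * V) = K / L ^+ 2); last by rewrite /K mulrAC.
  lra.
near=> n.
have d3 : `|Rintg Q (Hth (th m) \o Z) - Rintg P (Hth (th m) \o S n)| <= e / 4.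
  by near: n; have [_ _ _ /cvgrPdist_le] := tH m; apply.
rewrite (_ : _ - _ = (Rintg Q (H \o Z) - Rintg Q (Hth (th m) \o Z)) +
  ((Rintg Q (Hth (th m) \o Z) - Rintg P (Hth (th m) \o S n)) -
   (Rintg P (H \o S n) - Rintg P (Hth (th m) \o S n)))); last by ring.
apply: le_trans (ler_normD _ _) _.
have := ler_normB (Rintg Q (Hth (th m) \o Z) - Rintg P (Hth (th m) \o S n))
  (Rintg P (H \o S n) - Rintg P (Hth (th m) \o S n)).
have := dS n; lra.
Unshelve. all: end_near. Qed.

End weak_convergence.

(** Block Cholesky factorisation: pivot on the corner entry [a] and recurse on the Schur complement
    N - v^T v / a. If a = 0, positivity forces v = 0. *)
Lemma psd_factor (R : rcfType) p (M : 'M[R]_p) : M^T = M ->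
  (forall t : 'rV[R]_p, 0 <= (t *m M *m t^T) 0 0) -> exists A : 'M[R]_p, A *m A^T = M.
Proof.
elim: p M => [|p IH] M sM pM; first by exists 0; apply/matrixP => -[].
have symM i j : M i j = M j i by rewrite -[in LHS]sM mxE.
pose M' : 'M[R]_(1 + p) := M.
pose a := M' 0 0; pose v : 'rV[R]_p := ursubmx M'; pose N : 'M[R]_p := drsubmx M'.
have aE : ulsubmx M' = a%:M.
  by apply/matrixP => i j; rewrite !ord1 !mxE eqxx mulr1n; congr (M' _ _); apply/val_inj.
have wE : dlsubmx M' = v^T.
  by apply/matrixP => i j; rewrite !ord1 !mxE symM.
have ME : M' = block_mx a%:M v v^T N by rewrite -[LHS]submxK aE wE.
have sN : N^T = N by apply/matrixP => i j; rewrite !mxE symM.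
clearbody a v N.
have quad (x : R) (s : 'rV[R]_p) :
    0 <= x ^+ 2 * a + 2 * x * (s *m v^T) 0 0 + (s *m N *m s^T) 0 0.
  have pM' (t : 'rV[R]_(1 + p)) : 0 <= (t *m M' *m t^T) 0 0 := pM t.
  have := pM' (row_mx x%:M s); rewrite ME mul_row_block tr_row_mx mul_row_col.
  have vs : v *m s^T = s *m v^T.
    by apply/matrixP => i j; rewrite !ord1 !mxE; apply: eq_bigr => k _; rewrite !mxE mulrC.
  rewrite tr_scalar_mx !mul_scalar_mx !mul_mx_scalar mulmxDl -scalemxAl vs.
  move: (s *m v^T) (s *m N *m s^T) => u q; rewrite !mxE mulr1n => h.
  apply: le_trans h _; rewrite le_eqVlt; apply/orP; left; apply/eqP; ring.
have a0 : 0 <= a by have := quad 1 0; rewrite !mul0mx !mxE; lra.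
suff [A' A'E] : exists A' : 'M[R]_(1 + p), A' *m A'^T = M' by exists A'.
have [az|an] := eqVneq a 0.
  have v0 : v = 0.
    apply/eqP; apply: contraT => vn0.
    have vv : 0 < (v *m v^T) 0 0.
      rewrite mxE lt_neqAle; apply/andP; split; last first.
        by apply: sumr_ge0 => i _; rewrite mxE -expr2 sqr_ge0.
      apply: contra vn0; rewrite eq_sym psumr_eq0; last by move=> i _; rewrite mxE -expr2 sqr_ge0.
      move=> /allP h; apply/eqP/rowP => i; rewrite mxE.
      by have := h i (mem_index_enum i); rewrite mxE mulf_eq0 orbb => /eqP.
    (* With a = 0 and v nonzero, this choice would give the quadratic form the value -1. *)
    have := quad (- ((v *m N *m v^T) 0 0 + 1) / (2 * (v *m v^T) 0 0)) v.
    rewrite az mulr0 add0r (_ : 2 * _ * _ = - ((v *m N *m v^T) 0 0 + 1)); last by field; rewrite gt_eqF.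
    lra.
  have [|A AN] := IH N sN.
    by move=> s; have := quad 0 s; rewrite az; lra.
  exists (block_mx 0 0 0 A : 'M[R]_(1 + p)).
  rewrite ME az v0 tr_block_mx mulmx_block !trmx0 !mul0mx !mulmx0 !addr0 !add0r AN.
  by congr block_mx; apply/matrixP => i j; rewrite !mxE mul0rn.
have a_gt0 : 0 < a by rewrite lt_neqAle eq_sym an.
have [||A AN] := IH (N - a^-1 *: (v^T *m v)).
- by rewrite linearB/= linearZ/= trmx_mul trmxK sN.
(* The minimiser in x of the quadratic form; the minimum is the form of the Schur complement at
   [s]. *)
- move=> s; have := quad (- (s *m v^T) 0 0 / a) s.
  have vs : v *m s^T = s *m v^T.
    by apply/matrixP => i j; rewrite !ord1 !mxE; apply: eq_bigr => k _; rewrite !mxE mulrC.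
  rewrite mulmxBr mulmxBl -scalemxAr -scalemxAl (_ : s *m (v^T *m v) *m s^T = (s *m v^T) *m (v *m s^T)); last by rewrite !mulmxA.
  rewrite vs.
  move: (s *m v^T) (s *m N *m s^T) => u q; rewrite !mxE big_ord1 => h.
  apply: le_trans h _; rewrite le_eqVlt; apply/orP; left; apply/eqP; field.
  by [].
pose r := Num.sqrt a.
have r0 : r != 0 by rewrite sqrtr_eq0 -ltNge.
have r2 : r ^+ 2 = a by rewrite sqr_sqrtr// ltW.
exists (block_mx r%:M 0 (r^-1 *: v^T) A : 'M[R]_(1 + p)).
rewrite ME tr_block_mx mulmx_block !trmx0 !mul0mx !mulmx0 !addr0 AN.
rewrite tr_scalar_mx linearZ/= trmxK -scalar_mxM -expr2 r2.
rewrite mul_scalar_mx mul_mx_scalar !scalerA divff// ?scale1r//.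
rewrite -scalemxAl -scalemxAr scalerA -expr2 exprVn r2.
by rewrite addrC subrK.
Qed.

(** * Uniform continuity on boxes *)

Section box_continuity.
Variables (R : realType) (p : nat) (h : 'rV[R]_p * 'rV[R]_p -> R).
Hypothesis ch : continuous h.

(** Presents a function of two vectors as a function of one family over a finite index type, the
    shape handled by [weak_convergence]. *)
Definition pair_fun (x : 'I_p + 'I_p -> R) : R :=
  h (\row_k x (inl k), \row_k x (inr k)).

(** Heine's theorem in near-covering form: only the first point is confined to the compact box, the
    second may lie slightly outside. *)
Lemma pair_fun_uc (L e : R) : 0 < e -> exists2 dl : R, 0 < dl &
  forall x y, (forall i, `|x i| <= L) -> (forall i, `|x i - y i| <= dl) ->
    `|pair_fun x - pair_fun y| <= e.
Proof.
move=> e0.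
pose A := [set v : 'rV[R]_p | forall i, `[-L, L]%classic (v 0 i)].
have cA : compact A by apply: (@rV_compact R p (fun=> `[-L, L]%classic)) => i; exact: segment_compact.
have cK : compact (A `*` A) by exact: compact_setX.
pose Pr (dl : R) (z : 'rV[R]_p * 'rV[R]_p) := forall z' : 'rV[R]_p * 'rV[R]_p,
  (forall i, `|z.1 0 i - z'.1 0 i| <= dl) -> (forall i, `|z.2 0 i - z'.2 0 i| <= dl) ->
  `|h z - h z'| <= e.
have := (compact_near_coveringP _).1 cK R (0 : R)^'+ Pr _.
case=> [z Kz|dl /= dl0 hdl].
  have e20 : 0 < e / 2 by rewrite divr_gt0.
  have /cvgrPdist_lt /(_ _ e20) /nbhs_ballP[r /= r0 hr] := @ch z.
  have r20 : 0 < r / 2 by rewrite divr_gt0.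
  exists (ball z (r / 2), [set dl : R | 0 < dl < r / 2]).
    split=> /=; first exact: nbhsx_ballx.
    near=> x; apply/andP; split; near: x; [exact: nbhs_right_gt|exact: nbhs_right_lt].
  move=> [z1 dl] /= [bz /andP[dl0 dlr]] z' h1 h2.
  have b1 : ball z r z1 by apply: le_ball bz; lra.
  have b2 : ball z r z'.
    apply: (@ball_split _ _ z1) => //; split; split=> //= i j; rewrite ord1.
    + by apply: le_lt_trans dlr; exact: h1.
    + by apply: le_lt_trans dlr; exact: h2.
  have := hr _ b1; have := hr _ b2; rewrite /= => q1 q2.
  rewrite (_ : h z1 - h z' = (h z - h z') - (h z - h z1)); last by ring.
  apply: le_trans (ler_normB _ _) _; lra.
exists (dl / 2); first by rewrite divr_gt0.
move=> x y xL xy.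
have bd : ball_ normr 0 dl (dl / 2) by rewrite /ball_/= sub0r normrN ger0_norm; lra.
have dl20 : 0 < dl / 2 by rewrite divr_gt0.
apply: (hdl _ bd dl20) => /=.
- by split=> i; rewrite /= mxE in_itv/= -ler_norml.
- by move=> i; rewrite !mxE.
- by move=> i; rewrite !mxE.
Unshelve. all: end_near. Qed.

End box_continuity.

(** * The noise density and its envelopes *)

Section noise.
Variables (R : realType) (alpha : nat) (c delta : R).
Hypotheses (alpha1 : (1 <= alpha)%N) (delta0 : 0 < delta).
Local Notation mR := (measurableTypeR R).
Local Notation leb := (@lebesgue_measure R).

Definition enoise (t : R) := c * expR (- (delta * `|t| ^+ alpha)).
Local Notation f := enoise.
Local Notation f' := (derive1 enoise).

Lemma enoiseN t : f (- t) = f t.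
Proof. by rewrite /enoise normrN. Qed.

Lemma lim_odd0 (q : R -> R) : (forall h, q (- h) = - q h) ->
  lim (q h @[h --> (0 : R)^']) = 0 :> R.
Proof.
move=> qN.
have [cq|ncq] := pselect (cvg (q h @[h --> (0 : R)^'])); last by rewrite dvgP.
have [l c1] : exists l : R, q h @[h --> (0 : R)^'] --> l by exact/cvg_ex.
rewrite (cvg_lim _ c1)//.
have c2 : q h @[h --> (0 : R)^'] --> - l.
  apply/cvgrPdist_le => e e0.
  move/cvgrPdist_le : c1 => /(_ _ e0) /nbhs_ballP[r /= r0 hr].
  apply/nbhs_ballP; exists r => //= h bh hn.
  have bh' : ball_ normr 0 r (- h).
    by rewrite /ball_/= sub0r opprK; move: bh; rewrite -ball_normE /ball_/= sub0r normrN.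
  have hn' : - h != 0 by rewrite oppr_eq0.
  by have := hr _ bh' hn'; rewrite qN opprK -opprD normrN.
have E : l = - l by apply: (cvg_unique _ c1 c2).
lra.
Qed.

(* If [g] is not derivable at 0, [derive1 g 0] is the default limit, also 0. *)
Lemma derive1_even0 (g : R -> R) : (forall t, g (- t) = g t) -> derive1 g 0 = 0.
Proof.
move=> gE; apply: (lim_odd0 (q := fun h => h^-1 * (g (h + 0) - g 0))) => h.
by rewrite !addr0 gE invrN mulNr.
Qed.

(** Near t <> 0 the modulus is the linear map x -> sg(t) x. At 0 the left side vanishes by evenness
    and the right side through [Num.sg], also when alpha = 1. *)
Lemma derive1_enoise t : f' t = - (alpha%:R * delta) * Num.sg t * `|t| ^+ alpha.-1 * f t.
Proof.
have [->|t0] := eqVneq t 0.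
  by rewrite sgr0 mulr0 !mul0r derive1_even0//; exact: enoiseN.
pose g x : R := c * expR (- (delta * (Num.sg t * x) ^+ alpha)).
have gt : g t = f t by rewrite /g /enoise -normrEsg.
have fg : \forall x \near t, f x = g x.
  have [tp|tn] := ltP 0 t.
    have h : \forall x \near t, 0 < x by exact: lt_nbhsr.
    by apply: filterS h => x x0; rewrite /g /enoise gtr0_sg// mul1r ger0_norm// ltW.
  have t_lt0 : t < 0 by rewrite lt_neqAle t0.
  have h : \forall x \near t, x < 0 by exact: lt_nbhsl.
  by apply: filterS h => x x0; rewrite /g /enoise ltr0_sg// mulN1r ltr0_norm.
rewrite derive1E (near_eq_derive _ fg).
have dg : is_derive t 1 g (- (alpha%:R * delta) * Num.sg t * (Num.sg t * t) ^+ alpha.-1 * g t).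
  rewrite /g; move: (Num.sg t) => s.
  have d1 : is_derive t 1 (fun x : R => s * x) s.
    by apply: is_derive_eq; rewrite /GRing.scale/= ?mulr1 ?addr0 ?mulr0.
  have d2 : is_derive t 1 (fun x : R => (s * x) ^+ alpha) (alpha%:R * (s * t) ^+ alpha.-1 * s).
    have := is_deriveX alpha d1.
    by rewrite (_ : _ ^+ alpha = fun x : R => (s * x) ^+ alpha)//; apply/funext => x; rewrite exprfctE.
  have d3 : is_derive t 1 (fun x : R => - (delta * (s * x) ^+ alpha))
      (- (delta * (alpha%:R * (s * t) ^+ alpha.-1 * s))).
    exact: (is_deriveN (is_deriveZ delta d2)).
  have d4 := @is_derive1_comp _ expR _ t _ _ (is_derive_expR _) d3.
  have d5 := is_deriveZ c d4.
  by apply: is_derive_eq d5 _; rewrite /GRing.scale/=; ring.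
by have [_ ->] := dg; rewrite gt -normrEsg.
Unshelve. all: end_near. Qed.

Hypothesis c0 : 0 < c.

Lemma enoise_gt0 t : 0 < f t.
Proof. by rewrite mulr_gt0// expR_gt0. Qed.

Lemma enoise_le t : f t <= c.
Proof.
rewrite /enoise ler_piMr ?(ltW c0)// expR_le1 oppr_le0 mulr_ge0 ?exprn_ge0//.
exact: ltW.
Qed.

Lemma measurable_enoise : measurable_fun setT (f : R -> R).
Proof.
apply: measurable_funM => //; apply: measurableT_comp => //; apply: measurable_funN.
by apply: measurable_funM => //; apply: measurable_funX; exact: normr_measurable.
Qed.

Lemma measurable_derive1_enoise : measurable_fun setT (f' : R -> R).
Proof.
rewrite (_ : f' = fun t => - (alpha%:R * delta) * Num.sg t * `|t| ^+ alpha.-1 * f t); last first.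
  by apply/funext => t; exact: derive1_enoise.
apply: measurable_funM; last exact: measurable_enoise.
apply: measurable_funM; last by apply: measurable_funX; exact: normr_measurable.
apply: measurable_funM => //.
apply: (@nondecreasing_measurable R setT Num.sg) => // x y xy.
rewrite !sgr_def; case: (ltgtP x 0) => x0; case: (ltgtP y 0) => y0; rewrite ?mulr0n ?mulr1n//=; lra.
Qed.

Lemma subrX_bound (r a b : R) n : 0 <= a <= r -> 0 <= b <= r ->
  `|a ^+ n - b ^+ n| <= n%:R * `|a - b| * r ^+ n.-1.
Proof.
move=> /andP[a0 ar] /andP[b0 br]; have r0 : 0 <= r by apply: le_trans ar.
elim: n => [|n IH]; first by rewrite !expr0 subrr normr0 !mul0r.
rewrite /= (_ : _ - _ = a * (a ^+ n - b ^+ n) + (a - b) * b ^+ n); last by rewrite !exprS; ring.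
apply: le_trans (ler_normD _ _) _; rewrite !normrM (ger0_norm a0) (ger0_norm (exprn_ge0 n b0)).
have h1 : a * `|a ^+ n - b ^+ n| <= n%:R * `|a - b| * r ^+ n.
  apply: (@le_trans _ _ (r * (n%:R * `|a - b| * r ^+ n.-1))); first exact: ler_pM.
  case: n {IH} => [|n]; first by rewrite !mul0r mulr0.
  by rewrite exprS /= le_eqVlt; apply/orP; left; apply/eqP; ring.
have h2 : `|a - b| * b ^+ n <= `|a - b| * r ^+ n by rewrite ler_wpM2l// lerXn2r ?nnegrE.
rewrite -natr1; lra.
Qed.

Variable M0 : R.
Hypothesis M00 : 0 <= M0.

(** Growth of the derivative of |y - u|^alpha for |u| <= M0; the summand 1 keeps it at least 1. *)
Definition grow (y : R) := (1 + M0 + `|y|) ^+ alpha.-1.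

Lemma grow_ge1 y : 1 <= grow y.
Proof. by apply: exprn_ege1; rewrite -addrA lerDl addr_ge0. Qed.

Lemma measurable_grow : measurable_fun setT grow.
Proof. by apply: measurable_funX; apply: measurable_funD => //; exact: normr_measurable. Qed.

(** Exponentials of [grow] are stable under products, which add the constants, and absorb both
    constants and [grow] itself; every kernel bound is then a single [env C]. *)
Definition env (C y : R) := expR (C * grow y).

Lemma env_gt0 C y : 0 < env C y. Proof. exact: expR_gt0. Qed.

Lemma env_ge0 C y : 0 <= env C y. Proof. exact: expR_ge0. Qed.

Lemma env_cst C y : 0 <= C -> C <= env C y.
Proof.
move=> C0; apply: (@le_trans _ _ (C * grow y)); first by rewrite ler_peMr// grow_ge1.
by have := expR_ge1Dx (C * grow y); rewrite /env; lra.
Qed.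

Lemma env_grow C y : 0 <= C -> C * grow y <= env C y.
Proof. by move=> C0; have := expR_ge1Dx (C * grow y); rewrite /env; lra. Qed.

Lemma envM C D y : env C y * env D y = env (C + D) y.
Proof. by rewrite /env -expRD mulrDl. Qed.

Lemma env_ge1 C y : 0 <= C -> 1 <= env C y.
Proof. by move=> C0; rewrite -[leLHS]expR0 ler_expR mulr_ge0// (le_trans _ (grow_ge1 y)). Qed.

Lemma measurable_env C : measurable_fun setT (env C).
Proof. by apply: measurableT_comp => //; apply: measurable_funM => //; exact: measurable_grow. Qed.

(** [alpha * (2 * M0) * grow y] bounds the increment of |y - u|^alpha between two shifts of size at
    most M0, and [delta] multiplies it in the exponent. *)
Definition Crat := delta * (alpha%:R * (2 * M0)).

Lemma Crat_ge0 : 0 <= Crat.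
Proof. by rewrite /Crat !mulr_ge0// ltW. Qed.

Lemma enoise_ratio y u u' : `|u| <= M0 -> `|u'| <= M0 ->
  f (y - u) <= env Crat y * f (y - u').
Proof.
move=> uM uM'; rewrite /enoise mulrCA ler_wpM2l ?(ltW c0)// -expRD ler_expR.
have b1 v : `|v| <= M0 -> 0 <= `|y - v| <= 1 + M0 + `|y|.
  by move=> vM; rewrite normr_ge0/=; have := ler_normB y v; lra.
have h := subrX_bound alpha (b1 _ uM') (b1 _ uM).
have h2 : `| `|y - u'| - `|y - u| | <= 2 * M0.
  apply: le_trans (ler_dist_dist _ _) _.
  rewrite (_ : y - u' - (y - u) = u - u'); last by ring.
  by apply: le_trans (ler_normB _ _) _; lra.
have g0 : 0 <= grow y by apply: le_trans (grow_ge1 y).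
have h3 : `|y - u'| ^+ alpha - `|y - u| ^+ alpha <= alpha%:R * (2 * M0) * grow y.
  apply: le_trans (ler_norm _) _; apply: le_trans h _; rewrite -/(grow y).
  by rewrite ler_wpM2r// ler_wpM2l.
have := ler_wpM2l (ltW delta0) h3; rewrite -/delta /Crat; lra.
Qed.

Lemma derive1_enoise_bound y u : `|u| <= M0 ->
  `|f' (y - u)| <= env (alpha%:R * delta) y * f (y - u).
Proof.
move=> uM; rewrite derive1_enoise normrM (ger0_norm (ltW (enoise_gt0 _))).
rewrite ler_wpM2r ?(ltW (enoise_gt0 _))//.
have ad0 : 0 <= alpha%:R * delta by rewrite mulr_ge0// ltW.
apply: le_trans (env_grow y ad0).
rewrite !normrM normrN (ger0_norm ad0) normrX normr_id.
have s1 : `|Num.sg (y - u)| <= 1 by rewrite normr_sg; case: (_ != _).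
have s2 : `|y - u| ^+ alpha.-1 <= grow y.
  by rewrite lerXn2r ?nnegrE ?addr_ge0//; have := ler_normB y u; lra.
apply: (ler_pM _ _ _ s2); first exact: (mulr_ge0 ad0).
  by rewrite exprn_ge0.
by rewrite ler_piMr.
Qed.

Lemma L1_exp_tail (eta : R) : 0 < eta -> L1 leb (fun y : mR => expR (- (eta * `|y|))).
Proof.
move=> eta0.
have L := integrable_exponential_pdf eta0.
have L' : L1 leb (fun y : mR => exponential_pdf eta (0 - y)) by exact: (L1_lebesgue_reflect 0 L).
apply: (@L1_le _ _ _ _ _ (fun y : mR => eta^-1 * (exponential_pdf eta y + exponential_pdf eta (0 - y)))).
- have h : measurable_fun setT (fun y : R => expR (- (eta * `|y|))).
    apply: measurableT_comp => //; apply: measurable_funN.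
    by apply: measurable_funM => //; exact: normr_measurable.
  exact: h.
- move=> y; rewrite ger0_norm ?expR_ge0//.
  have p1 := exponential_pdf_ge0 (ltW eta0) y.
  have p2 := exponential_pdf_ge0 (ltW eta0) (0 - y).
  rewrite [leRHS]mulrC ler_pdivlMr// mulrC.
  have [y0|y0] := leP 0 y.
    by rewrite [X in _ <= X + _]exponential_pdfE// ger0_norm// mulNr lerDl.
  rewrite [X in _ <= _ + X]exponential_pdfE; last by rewrite sub0r oppr_ge0 ltW.
  by rewrite ltr0_norm// sub0r mulrNN mulrN opprK lerDr.
- exact: (L1Z _ (L1D L L')).
Qed.

(** The exponent C grow(y) has degree alpha - 1 and is beaten by delta |y|^alpha, leaving the
    integrable tail e^(-eta |y|). *)
Lemma L1_env_enoise C : 0 <= C -> L1 leb (fun y : mR => env C y * f y).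
Proof.
move=> C0; have M0_ge0 := M00.
pose eta := delta / 2; have eta0 : 0 < eta by rewrite divr_gt0.
pose C' := C * 2 ^+ alpha.-1.
have C'0 : 0 <= C' by rewrite mulr_ge0// exprn_ge0.
(* Beyond [y0] both 1 + M0 <= |y| and C' <= eta |y| hold; the constant [K] covers the range
   below. *)
pose y0 := 1 + M0 + 2 * C' / delta.
have cd0 : 0 <= 2 * C' / delta by rewrite divr_ge0 ?(ltW delta0)// mulr_ge0.
have y0a : 1 + M0 <= y0 by rewrite /y0; lra.
have y0b : 2 * C' / delta <= y0 by rewrite /y0; lra.
clearbody y0; have y00 : 0 <= y0 by lra.
pose K := C * (1 + M0 + y0) ^+ alpha.-1 + eta * y0.
have K0 : 0 <= K.
  by apply: addr_ge0; apply: mulr_ge0 => //; [apply: exprn_ge0; lra|exact: ltW].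
have main y : C * grow y - delta * `|y| ^+ alpha <= K - eta * `|y|.
  have n0 := normr_ge0 y; rewrite /grow; move: (`|y|) n0 => r r0.
  have [ry|ry] := leP r y0.
    have h1 : (1 + M0 + r) ^+ alpha.-1 <= (1 + M0 + y0) ^+ alpha.-1.
      by rewrite lerXn2r ?nnegrE//; lra.
    have h2 := ler_wpM2l C0 h1; have h3 := ler_wpM2l (ltW eta0) ry.
    have h4 : 0 <= delta * r ^+ alpha by rewrite mulr_ge0 ?exprn_ge0// ltW.
    by rewrite /K; lra.
  apply: (@le_trans _ _ (- (eta * r))); last by lra.
  have r1 : 1 <= r by lra.
  have h1 : (1 + M0 + r) ^+ alpha.-1 <= (2 * r) ^+ alpha.-1.
    by rewrite lerXn2r ?nnegrE//; lra.
  have h2 := ler_wpM2l C0 h1; rewrite exprMn mulrA -/C' in h2.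
  have h3 : C' <= eta * r.
    have : 2 * C' / delta <= r by lra.
    by rewrite ler_pdivrMr// /eta; lra.
  have e1 : 1 <= r ^+ alpha.-1 by rewrite exprn_ege1.
  have h4 : r ^+ alpha = r * r ^+ alpha.-1 by rewrite -exprS prednK.
  rewrite h4; move: (r ^+ alpha.-1) e1 h2 => x e1 h2.
  have : delta = 2 * eta by rewrite /eta; field.
  move=> ->; have : eta * r * 1 <= eta * r * x by rewrite ler_wpM2l// mulr_ge0// ltW.
  have : C' * x <= eta * r * x by rewrite ler_wpM2r//; lra.
  lra.
apply: (@L1_le _ _ _ _ _ (fun y : mR => c * expR K * expR (- (eta * `|y|)))).
- by apply: (@measurable_funM _ mR R); [exact: measurable_env|exact: measurable_enoise].
- move=> y; rewrite ger0_norm; last by rewrite mulr_ge0// ltW ?env_gt0 ?enoise_gt0.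
  rewrite /env /enoise mulrCA -mulrA ler_wpM2l ?(ltW c0)// -!expRD ler_expR.
  exact: main.
- apply: L1Z; exact: L1_exp_tail.
Qed.

End noise.

(** * Two-sample kernel sums *)

Section two_samples.
Context d0 d1 d2 (Om : measurableType d0) (T1 : measurableType d1) (T2 : measurableType d2).
Variables (R : realType) (P : probability Om R).
Variables (X : nat -> Om -> T1) (Y : nat -> Om -> T2).
Variables (pX : set T1 -> R) (pY : set T2 -> R).
Hypothesis mX : forall i, measurable_fun setT (X i).
Hypothesis mY : forall j, measurable_fun setT (Y j).

Definition rect n (A : nat -> set T1) (C : nat -> set T2) : set Om :=
  (\bigcap_(i in [set i | (i < n)%N]) (X i @^-1` A i)) `&`
  (\bigcap_(j in [set j | (j < n)%N]) (Y j @^-1` C j)).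

Hypothesis joint : forall n (A : nat -> set T1) (C : nat -> set T2),
  (forall i, measurable (A i)) -> (forall j, measurable (C j)) ->
  P (rect n A C) = ((\prod_(i < n) pX (A i)) * (\prod_(j < n) pY (C j)))%:E.
Hypotheses (pXT : pX setT = 1) (pYT : pY setT = 1).

Lemma law_X i A : measurable A -> P (X i @^-1` A) = (pX A)%:E.
Proof.
move=> mA; pose A' k := if k == i then A else setT.
have := @joint i.+1 A' (fun=> setT) _ (fun=> measurableT).
rewrite big_ord_recr/= (_ : A' i = A); last by rewrite /A' eqxx.
rewrite [X in X * pX A]big1; last first.
  by move=> k _; rewrite /A' ltn_eqF.
rewrite big1// mulr1 mul1r => <-; last by move=> k; rewrite /A'; case: ifP.
congr (P _); apply/seteqP; split=> [w Aw|w [/(_ i (ltnSn i))]]; last by rewrite /A' eqxx.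
by split=> k _ //=; rewrite /A'; case: eqP => [->|].
Qed.

Lemma law_Y j C : measurable C -> P (Y j @^-1` C) = (pY C)%:E.
Proof.
move=> mC; pose C' k := if k == j then C else setT.
have := @joint j.+1 (fun=> setT) C' (fun=> measurableT) _.
rewrite [X in _ * X]big_ord_recr/= (_ : C' j = C); last by rewrite /C' eqxx.
rewrite [X in X * pY C]big1; last first.
  by move=> k _; rewrite /C' ltn_eqF.
rewrite big1// !mul1r => <-; last by move=> k; rewrite /C'; case: ifP.
congr (P _); apply/seteqP; split=> [w Cw|w [_ /(_ j (ltnSn j))]]; last by rewrite /C' eqxx.
by split=> k _ //=; rewrite /C'; case: eqP => [->|].
Qed.

Variable n : nat.

(** Cylinders constraining X at indices in [I] and Y at indices in [J], below [n]: a pi-system for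
    the sigma-algebra of that subsample. The product formula makes cylinders over disjoint index
    sets independent. *)
Definition rects (I J : pred nat) : set (set Om) :=
  [set E | exists A C, [/\ forall i, measurable (A i), forall j, measurable (C j),
    forall i, ~~ I i -> A i = setT, forall j, ~~ J j -> C j = setT & E = rect n A C]].

Lemma rects_measurable I J : rects I J `<=` measurable.
Proof.
move=> _ [A [C [mA mC _ _ ->]]]; apply: measurableI.
  apply: fin_bigcap_measurable => [|i _]; first exact: finite_II.
  by rewrite -[X in measurable X]setTI; exact: mX.
apply: fin_bigcap_measurable => [|j _]; first exact: finite_II.
by rewrite -[X in measurable X]setTI; exact: mY.
Qed.

Lemma rectI A A' C C' :
  rect n A C `&` rect n A' C' = rect n (fun i => A i `&` A' i) (fun j => C j `&` C' j).
Proof.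
by rewrite /rect setIACA -!bigcapI.
Qed.

Lemma rects_setI I J : setI_closed (rects I J).
Proof.
move=> _ _ [A [C [mA mC IA JC ->]]] [A' [C' [mA' mC' IA' JC' ->]]].
rewrite rectI; exists (fun i => A i `&` A' i), (fun j => C j `&` C' j); split=> //.
- by move=> i; exact: measurableI.
- by move=> i; exact: measurableI.
- by move=> i Ii; rewrite IA// IA'// setIT.
- by move=> i Ii; rewrite JC// JC'// setIT.
Qed.

Lemma rects_indep I J I' J' : (forall i, ~~ (I i && I' i)) -> (forall j, ~~ (J j && J' j)) ->
  indep_sets P (rects I J) (rects I' J').
Proof.
move=> II' JJ' _ _ [A [C [mA mC IA JC ->]]] [A' [C' [mA' mC' IA' JC' ->]]].
rewrite rectI !joint//; try by move=> i; exact: measurableI.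
have -> : \prod_(i < n) pX (A i `&` A' i) = (\prod_(i < n) pX (A i)) * \prod_(i < n) pX (A' i).
  rewrite -big_split/=; apply: eq_bigr => i _.
  by have := II' i; rewrite negb_and => /orP[/IA ->|/IA' ->]; rewrite ?setTI ?setIT ?pXT ?mul1r ?mulr1.
have -> : \prod_(j < n) pY (C j `&` C' j) = (\prod_(j < n) pY (C j)) * \prod_(j < n) pY (C' j).
  rewrite -big_split/=; apply: eq_bigr => i _.
  by have := JJ' i; rewrite negb_and => /orP[/JC ->|/JC' ->]; rewrite ?setTI ?setIT ?pYT ?mul1r ?mulr1.
by rewrite -EFinM mulrACA.
Qed.

Lemma measurable_X_rects (I J : pred nat) i : I i -> (i < n)%N ->
  @measurable_fun _ _ (g_sigma_algebraType (rects I J)) T1 setT (X i).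
Proof.
move=> Ii ni _ A mA; rewrite setTI; apply: sub_sigma_algebra.
exists (fun k => if k == i then A else setT), (fun=> setT); split=> //.
- by move=> k; case: ifP.
- by move=> k; case: eqP => [->|//]; rewrite Ii.
apply/seteqP; split=> [w Aw|w [/(_ i ni)]]; last by rewrite eqxx.
by split=> k _ //=; case: eqP => [->|].
Qed.

Lemma measurable_Y_rects (I J : pred nat) j : J j -> (j < n)%N ->
  @measurable_fun _ _ (g_sigma_algebraType (rects I J)) T2 setT (Y j).
Proof.
move=> Jj nj _ C mC; rewrite setTI; apply: sub_sigma_algebra.
exists (fun=> setT), (fun k => if k == j then C else setT); split=> //.
- by move=> k; case: ifP.
- by move=> k; case: eqP => [->|//]; rewrite Jj.
apply/seteqP; split=> [w Cw|w [_ /(_ j nj)]]; last by rewrite eqxx.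
by split=> k _ //=; case: eqP => [->|].
Qed.

Lemma indep_rects (I J I' J' : pred nat) d3 d4 (S1 : measurableType d3) (S2 : measurableType d4)
    (U : Om -> S1) (W : Om -> S2) :
  (forall i, ~~ (I i && I' i)) -> (forall j, ~~ (J j && J' j)) ->
  @measurable_fun _ _ (g_sigma_algebraType (rects I J)) S1 setT U ->
  @measurable_fun _ _ (g_sigma_algebraType (rects I' J')) S2 setT W ->
  indep P U W.
Proof.
move=> II' JJ'; apply: indep_of_sigma; try exact: rects_measurable; try exact: rects_setI.
exact: rects_indep.
Qed.

Lemma indep_X_rest i : (i < n)%N -> forall d4 (S2 : measurableType d4) (W : Om -> S2),
  @measurable_fun _ _ (g_sigma_algebraType (rects [pred k | k != i] predT)) S2 setT W ->
  indep P (X i) W.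
Proof.
move=> ni d4 S2 W mW; apply: (@indep_rects (pred1 i) pred0 _ _ _ _ _ _ _ _ _ _ _ mW) => //.
- by move=> k /=; case: eqP.
- by apply: measurable_X_rects => //=; rewrite eqxx.
Qed.

Lemma indep_Y_rest j : (j < n)%N -> forall d4 (S2 : measurableType d4) (W : Om -> S2),
  @measurable_fun _ _ (g_sigma_algebraType (rects predT [pred k | k != j])) S2 setT W ->
  indep P (Y j) W.
Proof.
move=> nj d4 S2 W mW; apply: (@indep_rects pred0 (pred1 j) _ _ _ _ _ _ _ _ _ _ _ mW) => //.
- by move=> k /=; case: eqP.
- by apply: measurable_Y_rects => //=; rewrite eqxx.
Qed.

Lemma rects_sigma_measurable (I J : pred nat) d3 (S1 : measurableType d3) (U : Om -> S1) :
  @measurable_fun _ _ (g_sigma_algebraType (rects I J)) S1 setT U -> measurable_fun setT U.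
Proof.
move=> mU _ A mA; have := mU measurableT A mA.
exact: (smallest_sub (@sigma_algebra_measurable _ Om) (@rects_measurable I J)).
Qed.

Section kernel_sums.
Variables (q : T1 * T2 -> R) (kap : T2 -> R) (V : R).
Hypothesis mq : measurable_fun setT q.
Hypothesis mkap : measurable_fun setT kap.
Hypothesis qk : forall i w y, `|q (X i w, y)| <= kap y.
Hypothesis Lk : forall j, L1 P (fun w => kap (Y j w) ^+ 2).
Hypothesis kV : forall j, Rintg P (fun w => kap (Y j w) ^+ 2) <= V.
Hypothesis qX : forall i y, Rintg P (fun w => q (X i w, y)) = 0.

Let kap0 w (i j : nat) : 0 <= kap (Y j w). Proof. exact: le_trans (normr_ge0 _) (qk i w (Y j w)). Qed.

Let LkY j : L1 P (fun w => kap (Y j w)).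
Proof.
apply: (@L1_le _ _ _ _ _ (fun w => 1 + kap (Y j w) ^+ 2)).
- exact: measurableT_comp.
- by move=> w; rewrite (ger0_norm (kap0 w 0%N j)); have := kap0 w 0%N j; nra.
- by apply: L1D => //; exact: L1_cst.
Qed.

Let mQ i j : measurable_fun setT (fun w => q (X i w, Y j w)).
Proof. by apply: (measurableT_comp mq); exact: measurable_fun_pair. Qed.

Let LQQ i j i' j' : L1 P (fun w => q (X i w, Y j w) * q (X i' w, Y j' w)).
Proof.
apply: (@L1_le _ _ _ _ _ (fun w => kap (Y j w) ^+ 2 + kap (Y j' w) ^+ 2)).
- exact: measurable_funM.
- move=> w; rewrite normrM; apply: (@le_trans _ _ (kap (Y j w) * kap (Y j' w))).
    exact: ler_pM.
  have := sqr_ge0 (kap (Y j w) - kap (Y j' w)).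
  have := sqr_ge0 (kap (Y j w)); have := sqr_ge0 (kap (Y j' w)); lra.
- exact: L1D.
Qed.

(** With everything but X_i frozen, the second factor is constant and the first averages to zero; j
    = j' is allowed. *)
Lemma kernel_orthX i j i' j' : (i < n)%N -> (j < n)%N -> (i' < n)%N -> (j' < n)%N -> i != i' ->
  Rintg P (fun w => q (X i w, Y j w) * q (X i' w, Y j' w)) = 0.
Proof.
move=> ni nj ni' nj' ii'.
pose W w := (X i' w, (Y j w, Y j' w)).
pose F (z : T1 * (T1 * (T2 * T2))) : R := q (z.1, z.2.2.1) * q (z.2.1, z.2.2.2).
have mW : @measurable_fun _ _ (g_sigma_algebraType (rects [pred k | k != i] predT)) _ setT W.
  apply: measurable_fun_pair; first by apply: measurable_X_rects; rewrite //= eq_sym.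
  by apply: measurable_fun_pair; exact: measurable_Y_rects.
have mW' := rects_sigma_measurable mW.
have mF : measurable_fun setT F.
  apply: measurable_funM; apply: (measurableT_comp mq); apply: measurable_fun_pair => //.
  - by apply: (measurableT_comp measurable_fst); apply: (measurableT_comp measurable_snd).
  - by apply: (measurableT_comp measurable_fst).
  - by apply: (measurableT_comp measurable_snd); apply: (measurableT_comp measurable_snd).
rewrite (indep_Fubini (mX i) mW' (indep_X_rest ni mW) mF (LQQ i j i' j')).
rewrite -[RHS](Rintg0 P); apply: eq_Rint => w; rewrite /F /=.
rewrite RintegralZr ?qX ?mul0r//.
apply: (@L1_bdd _ _ _ _ _ (kap (Y j w))) => [|w']; last exact: qk.
by apply: (measurableT_comp mq); exact: measurable_fun_pair.
Qed.

Lemma orth_sum_sqr (K : finType) (Q : K -> Om -> R) :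
  (forall a b, L1 P (fun w => Q a w * Q b w)) ->
  (forall a b, a != b -> Rintg P (fun w => Q a w * Q b w) = 0) ->
  (forall a, Rintg P (fun w => Q a w ^+ 2) <= V) ->
  L1 P (fun w => (\sum_a Q a w) ^+ 2) /\
  Rintg P (fun w => (\sum_a Q a w) ^+ 2) <= #|K|%:R * V.
Proof.
move=> LQ oQ QV.
have E : (fun w => (\sum_a Q a w) ^+ 2) = (fun w => \sum_a \sum_b Q a w * Q b w).
  by apply/funext => w; rewrite expr2 mulr_suml; apply: eq_bigr => a _; rewrite mulr_sumr.
have LS a : L1 P (fun w => \sum_b Q a w * Q b w) by exact: L1_sum.
rewrite E; split; first exact: L1_sum.
rewrite Rint_sum// [leRHS](_ : _ = \sum_(a : K) V); last by rewrite sumr_const cardT -cardE mulr_natl.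
apply: ler_sum => a _; rewrite Rint_sum// (bigD1 a)//= big1 ?addr0; last first.
  by move=> b ba; apply: oQ; rewrite eq_sym.
by apply: le_trans (QV a); rewrite le_eqVlt; apply/orP; left; apply/eqP/eq_Rint => w; rewrite expr2.
Qed.

Let QV i j : Rintg P (fun w => q (X i w, Y j w) ^+ 2) <= V.
Proof.
apply: le_trans (kV j); apply: le_Rintegral => //.
- by apply: eq_L1 (LQQ i j i j) => w; rewrite expr2.
- by move=> w _; rewrite -real_normK ?num_real// lerXn2r ?nnegrE// (kap0 w i j).
Qed.

(** Centring in X alone is enough: the terms of a row share Y_j but differ in X_i. *)
Lemma row_sum_sqr j : (j < n)%N ->
  L1 P (fun w => (\sum_(i < n) q (X i w, Y j w)) ^+ 2) /\
  Rintg P (fun w => (\sum_(i < n) q (X i w, Y j w)) ^+ 2) <= n%:R * V.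
Proof.
move=> nj; have := @orth_sum_sqr 'I_n (fun i w => q (X i w, Y j w)).
rewrite card_ord; apply=> //.
by move=> a b ab; exact: kernel_orthX.
Qed.

Hypothesis qY : forall i j w, Rintg P (fun w' => q (X i w, Y j w')) = 0.

Lemma kernel_orthY i j i' j' : (i < n)%N -> (j < n)%N -> (i' < n)%N -> (j' < n)%N -> j != j' ->
  Rintg P (fun w => q (X i w, Y j w) * q (X i' w, Y j' w)) = 0.
Proof.
move=> ni nj ni' nj' jj'.
pose W w := (X i w, (X i' w, Y j' w)).
pose F (z : T2 * (T1 * (T1 * T2))) : R := q (z.2.1, z.1) * q (z.2.2.1, z.2.2.2).
have mW : @measurable_fun _ _ (g_sigma_algebraType (rects predT [pred k | k != j])) _ setT W.
  apply: measurable_fun_pair; first exact: measurable_X_rects.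
  by apply: measurable_fun_pair; [exact: measurable_X_rects|apply: measurable_Y_rects; rewrite //= eq_sym].
have mW' := rects_sigma_measurable mW.
have mF : measurable_fun setT F.
  apply: measurable_funM; apply: (measurableT_comp mq); apply: measurable_fun_pair => //.
  - by apply: (measurableT_comp measurable_fst).
  - by apply: (measurableT_comp measurable_fst); apply: (measurableT_comp measurable_snd).
  - by apply: (measurableT_comp measurable_snd); apply: (measurableT_comp measurable_snd).
rewrite (indep_Fubini (mY j) mW' (indep_Y_rest nj mW) mF (LQQ i j i' j')).
rewrite -[RHS](Rintg0 P); apply: eq_Rint => w; rewrite /F /=.
rewrite RintegralZr ?qY ?mul0r//.
apply: (@L1_le _ _ _ _ _ (fun w' => kap (Y j w'))) => [|w'|]; [|exact: qk|exact: LkY].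
by apply: (measurableT_comp mq); exact: measurable_fun_pair.
Qed.

(** Two distinct pairs differ in at least one coordinate and the kernel is centred in each, so only
    the n^2 diagonal terms remain. *)
Lemma double_sum_sqr :
  L1 P (fun w => (\sum_(i < n) \sum_(j < n) q (X i w, Y j w)) ^+ 2) /\
  Rintg P (fun w => (\sum_(i < n) \sum_(j < n) q (X i w, Y j w)) ^+ 2) <= (n * n)%:R * V.
Proof.
have := @orth_sum_sqr ('I_n * 'I_n)%type (fun a w => q (X a.1 w, Y a.2 w)).
rewrite card_prod card_ord.
rewrite (_ : (fun w => (\sum_a _) ^+ 2) = (fun w => (\sum_(i < n) \sum_(j < n) q (X i w, Y j w)) ^+ 2)); last first.
  by apply/funext => w; rewrite pair_bigA.
apply=> //.
move=> [i j] [i' j']; rewrite xpair_eqE negb_and => /orP[h|h]; first exact: kernel_orthX.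
exact: kernel_orthY.
Qed.

End kernel_sums.

End two_samples.

Lemma Rint_prod d1 d2 (T1 : measurableType d1) (T2 : measurableType d2) (R : realType)
    (m1 : probability T1 R) (m2 : probability T2 R) (F : T1 * T2 -> R) M :
  measurable_fun setT F -> (forall z, `|F z| <= M) ->
  Rintg (m1 \x m2)%E F = Rintg m1 (fun x => Rintg m2 (fun y => F (x, y))).
Proof.
move=> mF FM.
have LF : L1 (m1 \x m2)%E F by exact: (@L1_bdd _ _ _ _ _ M).
have Lx x : L1 m2 (fun y => F (x, y)).
  by apply: (@L1_bdd _ _ _ _ _ M) => //; exact: (measurable_fun_pair2 x mF).
rewrite {1}/Rintegral -(integral12_prod_meas1 LF) /Rintegral; congr fine.
by apply: eq_integral => x _; rewrite -/(Rintegral _ _ _) -(L1_EFin (Lx x)).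
Qed.

(** * The Gaussian limit law *)

Section gaussian_pair.
Variables (R : realType) (p : nat) (A1 A2 : 'M[R]_p).

Lemma measurable_mulmx_coord (A : 'M[R]_p) k :
  measurable_fun setT (fun z : RpM R p => (z *m A) 0 k).
Proof.
rewrite (_ : (fun z => _) = fun z : 'rV[R]_p => \sum_j z 0 j * A j k); last first.
  by apply/funext => z; rewrite mxE.
by apply: measurable_sum => j; apply: measurable_funM => //; exact: measurable_coord.
Qed.

(** Vectors are rows, so a matrix acts by z A^T, which has covariance A A^T for a standard Gaussian
    z. *)
Definition pair_coord (z : RpM R p * RpM R p) (i : 'I_p + 'I_p) : R :=
  match i with inl k => (z.1 *m A1^T) 0 k | inr k => (z.2 *m A2^T) 0 k end.

Lemma measurable_pair_coord i : measurable_fun setT (pair_coord ^~ i).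
Proof.
case: i => k /=; apply: (measurableT_comp (measurable_mulmx_coord _ _)).
  exact: measurable_fst.
exact: measurable_snd.
Qed.

Definition quad (t : 'rV[R]_p) (M : 'M[R]_p) : R := (t *m M *m t^T) 0 0.

Lemma sum_mulmx_tr (t z : 'rV[R]_p) (A : 'M[R]_p) :
  \sum_k t 0 k * (z *m A^T) 0 k = \sum_j (t *m A) 0 j * z 0 j.
Proof.
under eq_bigr => k _ do rewrite mxE mulr_sumr.
rewrite exchange_big; apply: eq_bigr => j _ /=; rewrite mxE mulr_suml.
by apply: eq_bigr => k _; rewrite mxE; ring.
Qed.

Lemma quad_sqr (t : 'rV[R]_p) (A : 'M[R]_p) :
  \sum_j (t *m A) 0 j ^+ 2 = quad t (A *m A^T).
Proof.
rewrite /quad mulmxA -mulmxA -trmx_mul mxE; apply: eq_bigr => j _.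
by rewrite expr2 [_^T j 0]mxE.
Qed.

(** Realises the iterated Gaussian integral of the statement as an expectation under a product of
    two standard Gaussian laws, together with the cosine transform that the sample sums must
    approach. *)
Lemma gaussian_pair : exists Q : probability (RpM R p * RpM R p)%type R,
  (forall (t1 t2 : 'rV[R]_p) c,
    Rintg Q (fun z => cos (c + (\sum_k t1 0 k * (z.1 *m A1^T) 0 k + \sum_k t2 0 k * (z.2 *m A2^T) 0 k))) =
    expR (- ((quad t1 (A1 *m A1^T) + quad t2 (A2 *m A2^T)) / 2)) * cos c) /\
  (forall (h : 'rV[R]_p * 'rV[R]_p -> R) M,
    measurable_fun setT (fun z : RpM R p * RpM R p => h (z.1 *m A1^T, z.2 *m A2^T)) ->
    (forall z, `|h z| <= M) ->
    intRp (fun z1 => intRp (fun z2 =>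
          h (z1 *m A1^T, z2 *m A2^T) * std_gauss_pdf z1 * std_gauss_pdf z2)) =
    Rintg Q (fun z => h (z.1 *m A1^T, z.2 *m A2^T))).
Proof.
have [gam [gamI gamC]] := iRint_gauss R p.
have M1 (A : 'M[R]_p) (t : 'rV[R]_p) c : Rintg gam (fun v => cos (c + \sum_k t 0 k * (v *m A^T) 0 k)) =
    expR (- (quad t (A *m A^T) / 2)) * cos c.
  by rewrite -quad_sqr mulr_suml -gamC; apply: eq_Rint => v; rewrite sum_mulmx_tr.
have mlin (A : 'M[R]_p) (t : 'rV[R]_p) :
    measurable_fun setT (fun v : RpM R p => \sum_k t 0 k * (v *m A^T) 0 k).
  apply: measurable_sum => k; apply: measurable_funM => //; exact: measurable_mulmx_coord.
exists (gam \x gam)%E; split=> [t1 t2 c|h M mh hM].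
  rewrite (@Rint_prod _ _ _ _ _ _ _ _ 1); last first.
  - by move=> z; exact: cos_max.
  - apply: measurable_cos; apply: measurable_funD => //; apply: measurable_funD.
      by apply: (measurableT_comp (mlin _ _)); exact: measurable_fst.
    by apply: (measurableT_comp (mlin _ _)); exact: measurable_snd.
  transitivity (Rintg gam (fun z1 => expR (- (quad t2 (A2 *m A2^T) / 2)) *
      cos (c + \sum_k t1 0 k * (z1 *m A1^T) 0 k))).
    apply: eq_Rint => z1; rewrite -M1; apply: eq_Rint => z2; by rewrite addrA.
  rewrite RintegralZl//.
    by rewrite M1 mulrA -expRD; congr (expR _ * _); lra.
  apply: (@L1_bdd _ _ _ _ _ 1) => [|z]; last exact: cos_max.
  by apply: measurable_cos; apply: measurable_funD.
rewrite (Rint_prod _ _ mh (fun z => hM _)).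
rewrite -(gamI _ M); first last.
- move=> x; rewrite -[leRHS](Rint_cst gam); apply: Rint_le_abs => //; last exact: L1_cst.
  by apply: (@L1_bdd _ _ _ _ _ M) => //; exact: (measurable_fun_pair2 x mh).
- exact: (measurable_Rint_param _ mh).
rewrite /intRp; congr (iRint p _); apply/funext => s; set z1 := \row_k _.
have mz : measurable_fun setT (fun z2 : RpM R p => h (z1 *m A1^T, z2 *m A2^T)).
  exact: (measurable_fun_pair2 (z1 : RpM R p) mh).
have pk z2 : `|std_gauss_pdf z1 * h (z1 *m A1^T, z2 *m A2^T)| <= `|std_gauss_pdf z1| * M.
  by rewrite normrM ler_wpM2l.
rewrite mulrC -RintegralZl//; last by apply: (@L1_bdd _ _ _ _ _ M).
rewrite -(gamI _ _ _ pk); last exact: measurable_funM.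
by congr (iRint p _); apply/funext => s'; rewrite (mulrC (std_gauss_pdf z1)).
Qed.
End gaussian_pair.

(** * Laws with a density, and bounds for the plug-in remainder *)

Section pushforward_real.
Context d1 d2 (T1 : measurableType d1) (T2 : measurableType d2) (R : realType).
Variables (m : {measure set T1 -> \bar R}) (U : T1 -> T2) (g : T2 -> R).
Hypotheses (mU : measurable_fun setT U) (mg : measurable_fun setT g).

Lemma L1_pushforward : L1 m (fun x => g (U x)) <-> (pushforward m U).-integrable setT (EFin \o g).
Proof.
have E : (\int[pushforward m U]_y `|(g y)%:E| = \int[m]_x `|(g (U x))%:E|)%E.
  apply: (@integral_pushforwardT _ _ _ _ _ m U (fun y => `|(g y)%:E|%E)) => //.
  by apply: measurableT_comp => //; exact/measurable_EFinP.
split=> /integrableP[_ h]; apply/integrableP; split.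
- exact/measurable_EFinP.
- by rewrite E.
- by apply/measurable_EFinP; exact: measurableT_comp.
- by rewrite -E.
Qed.

Lemma Rint_pushforward : fine (\int[pushforward m U]_y (g y)%:E)%E = Rintg m (fun x => g (U x)).
Proof.
rewrite /Rintegral; congr fine.
by apply: (@integral_pushforwardT _ _ _ _ _ m U (EFin \o g)) => //; exact/measurable_EFinP.
Qed.
End pushforward_real.

Lemma law_density d (Om : measurableType d) d2 (T : measurableType d2) (R : realType)
    (P : probability Om R) (m : {measure set T -> \bar R}) (U : Om -> T) (F g : T -> R) :
  measurable_fun setT U -> measurable_fun setT F -> (forall y, 0 <= F y) ->
  (forall A, measurable A -> P (U @^-1` A) = (\int[m]_(y in A) (F y)%:E)%E) ->
  measurable_fun setT g -> L1 m (fun y => g y * F y) ->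
  L1 P (fun w => g (U w)) /\ Rintg P (fun w => g (U w)) = Rintg m (fun y => g y * F y).
Proof.
move=> mU mF F0 PU mg Lg.
pose U' : {mfun Om >-> T} := HB.pack U (isMeasurableFun.Build _ _ _ _ U mU).
have dE A : measurable A -> distribution P U' A = (\int[m]_(y in A) (F y)%:E)%E by exact: PU.
split.
  apply/(L1_pushforward P mU mg); exact: (L1_density mF F0 dE mg).2.
by rewrite -(Rint_pushforward P mU mg) -(Rint_density mF F0 dE mg).
Qed.

(** The reflection y -> 2u - y about the centre u changes the sign of the integrand. *)
Lemma Rint_odd0 (R : realType) (h : R -> R) u : (forall t, h (- t) = - h t) ->
  L1 (@lebesgue_measure R) (fun y : measurableTypeR R => h (y - u)) ->
  Rintg (@lebesgue_measure R) (fun y : measurableTypeR R => h (y - u)) = 0.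
Proof.
move=> hN Lh; have := Rint_lebesgue_reflect (2 * u) (L1_meas Lh).
have E : (fun y : measurableTypeR R => h (2 * u - y - u)) = (fun y => - h (y - u)).
  by apply/funext => y; rewrite -hN; congr h; ring.
rewrite E (RintN Lh); set I := Rintg _ _; clearbody I => h'; lra.
Qed.

(** An algebraic estimate for fixed samples. The error splits into [R1], the mean of K_j (1 -
    W_j)/W_j, and [R2], the double mean of s - g w - infl. The assumption on [rho] gives 1/W_j <=
    rho_j, and the arithmetic-geometric inequality turns products and |R2| into squares, whose
    expectations are accessible. *)
Lemma plug_in_bound (R : realFieldType) n (w s : 'I_n -> 'I_n -> R) (g infl rho : 'I_n -> R) (r := n%:R^-1 : R) :
  (0 < n)%N -> (forall j, 0 < rho j) -> (forall i j, 1 <= rho j * w i j) ->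
  `|r * \sum_j ((r * \sum_i w i j)^-1 * (r * \sum_i s i j)) - r * \sum_j g j - r * \sum_i infl i| <=
  r * \sum_j (2^-1 * ((r * \sum_i (rho j * (s i j - g j * w i j))) ^+ 2 + (r * \sum_i (1 - w i j)) ^+ 2)) +
  2^-1 * (n%:R * (r ^+ 2 * \sum_i \sum_j (s i j - g j * w i j - infl i)) ^+ 2 + r).
Proof.
move=> n0 rho0 wlb; have r0 : 0 < r by rewrite invr_gt0 ltr0n.
have nr : n%:R * r = 1 by rewrite divff// pnatr_eq0 -lt0n.
have rE : r = n%:R^-1 by [].
clearbody r; pose W j := r * \sum_i w i j.
pose K j := r * \sum_i (s i j - g j * w i j).
pose R1 := r * \sum_j (K j * (1 - W j) / W j).
pose R2 := r ^+ 2 * \sum_i \sum_j (s i j - g j * w i j - infl i).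
have Wlb j : 1 <= rho j * W j.
  rewrite mulrCA mulr_sumr -[leLHS]nr mulrC ler_wpM2l ?(ltW r0)//.
  rewrite -[leLHS](_ : \sum_(i < n) 1 = _); first by apply: ler_sum => i _.
  by rewrite sumr_const card_ord.
have W0 j : 0 < W j.
  by have := Wlb j; have := rho0 j; move=> h1 h2; rewrite -(pmulr_rgt0 _ h1); apply: lt_le_trans h2.
have KE j : K j = r * \sum_i s i j - g j * W j.
  by rewrite /K /W mulrCA -mulrBr sumrB -mulr_sumr.
have WE j : 1 - W j = r * \sum_i (1 - w i j).
  by rewrite sumrB sumr_const card_ord mulrBr mulrC nr.
have R2E : R2 = r * \sum_j K j - r * \sum_i infl i.
  rewrite /R2 expr2 -mulrA -mulrBr; congr (r * _).
  under eq_bigr do rewrite sumrB sumr_const card_ord -mulr_natl.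
  rewrite sumrB -!mulr_sumr mulrBr; congr (_ - _); first by rewrite exchange_big.
  by rewrite mulrA (mulrC r) nr mul1r.
have -> : r * \sum_j ((r * \sum_i w i j)^-1 * (r * \sum_i s i j)) - r * \sum_j g j - r * \sum_i infl i = R1 + R2.
  rewrite R2E addrA; congr (_ - _); rewrite -!mulrBr -mulrDr; congr (r * _).
  rewrite -sumrB -big_split/=; apply: eq_bigr => j _; rewrite -/(W j).
  by rewrite KE; field; rewrite gt_eqF.
apply: le_trans (ler_normD _ _) _; apply: lerD.
  rewrite normrM (ger0_norm (ltW r0)) ler_wpM2l ?(ltW r0)//.
  apply: le_trans (ler_norm_sum _ _ _) _; apply: ler_sum => j _.
  rewrite -mulr_sumr -WE mulrCA -/(K j) (normrM (K j * _)) (normrM (K j)) normfV (ger0_norm (ltW (W0 j))).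
  apply: (@le_trans _ _ (rho j * `|K j| * `|1 - W j|)).
    rewrite ler_pdivrMr// (_ : _ * W j = rho j * W j * (`|K j| * `|1 - W j|)); last by ring.
    by rewrite ler_peMl.
  have -> : (rho j * K j) ^+ 2 = (rho j * `|K j|) ^+ 2
    by rewrite -[LHS](real_normK (num_real _)) (normrM (rho j)) (ger0_norm (ltW (rho0 j))).
  rewrite -[in leRHS](real_normK (num_real (1 - W j))).
  have := sqr_ge0 (rho j * `|K j| - `|1 - W j|); nra.
rewrite -/R2 -(real_normK (num_real R2)).
(* Completing the square: (n R2^2 + 1/n)/2 - |R2| = (n |R2| - 1)^2 / (2n). *)
rewrite (_ : _ * _ = `|R2| + 2^-1 * r * (n%:R * `|R2| - 1) ^+ 2).
  by rewrite lerDl mulr_ge0 ?sqr_ge0// mulr_ge0// ltW.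
by rewrite rE; field; rewrite pnatr_eq0 -lt0n.
Qed.

Lemma measurable_pos_inv d (T : measurableType d) (R : realType) (h : T -> R) :
  (forall x, 0 <= h x) -> measurable_fun setT h -> measurable_fun setT (fun x => (h x)^-1).
Proof.
move=> h0 mh; rewrite (_ : (fun x => _) = fun x => h x `^ (-1)).
  exact: (measurableT_comp (measurable_powR _)).
by apply/funext => x; rewrite powR_inv1.
Qed.

Lemma quad_mean d (Om : measurableType d) (R : realType) (P : probability Om R) p
    (u : 'I_p -> Om -> R) (t : 'rV[R]_p) (M : 'M[R]_p) :
  (forall k l, L1 P (fun w => u k w * u l w)) ->
  (forall k l, Rintg P (fun w => u k w * u l w) = M k l) ->
  L1 P (fun w => (\sum_k t 0 k * u k w) ^+ 2) /\
  Rintg P (fun w => (\sum_k t 0 k * u k w) ^+ 2) =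
  quad t M.
Proof.
move=> Lu uM; have E : (fun w => (\sum_k t 0 k * u k w) ^+ 2) =
    fun w => \sum_l \sum_k (t 0 k * t 0 l) * (u k w * u l w).
  apply/funext => w; rewrite expr2 exchange_big/= mulr_suml; apply: eq_bigr => k _.
  by rewrite mulr_sumr; apply: eq_bigr => l _; ring.
have L2 k l : L1 P (fun w => (t 0 k * t 0 l) * (u k w * u l w)) by exact: L1Z.
have L3 l : L1 P (fun w => \sum_k (t 0 k * t 0 l) * (u k w * u l w)) by apply: L1_sum => k.
rewrite E; split; first exact: L1_sum.
rewrite Rint_sum// /quad mxE; apply: eq_bigr => l _; rewrite Rint_sum// !mxE mulr_suml.
by apply: eq_bigr => k _; rewrite RintegralZl// uM; ring.
Qed.

Lemma near_invsqrt (R : realType) (K e : R) : 0 < e ->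
  \forall n \near \oo, (0 < n)%N /\ (Num.sqrt n%:R)^-1 * K <= e.
Proof.
move=> e0; near=> n; have n0 : (0 < n)%N by near: n; exact: nbhs_infty_gt.
split=> //; have s0 : 0 < Num.sqrt n%:R :> R by rewrite sqrtr_gt0 ltr0n.
rewrite mulrC ler_pdivrMr// -ler_pdivrMl//.
apply: le_trans (ler_norm _) _; rewrite -sqrtr_sqr ler_wsqrtr//.
near: n; exact: nbhs_infty_ger.
Unshelve. all: by end_near. Qed.

Lemma sqrt_mulVn (R : realType) n : Num.sqrt n%:R * n%:R^-1 = (Num.sqrt n%:R)^-1 :> R.
Proof.
case: n => [|n]; first by rewrite sqrtr0 mul0r invr0.
have s0 : Num.sqrt n.+1%:R != 0 :> R by rewrite gt_eqF// sqrtr_gt0 ltr0n.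
by rewrite -[in _^-1](@sqr_sqrtr R n.+1%:R)// expr2 invfM mulrA divff// mul1r.
Qed.

Lemma normv_le_sum (R : realType) p (u : 'rV[R]_p) : normv u <= \sum_k `|u 0 k|.
Proof.
have S0 : 0 <= \sum_k `|u 0 k| by exact: sumr_ge0.
rewrite -[leRHS]ger0_norm// -sqrtr_sqr ler_wsqrtr// /dotv expr2 mulr_suml.
apply: ler_sum => k _; rewrite -expr2 -(real_normK (num_real _)) expr2 ler_wpM2l//.
by rewrite (bigD1 k)//= lerDl sumr_ge0.
Qed.

Lemma measurable_normv_gt d (Om : measurableType d) (R : realType) p (u : Om -> 'rV[R]_p) e :
  (forall k, measurable_fun setT (fun w => u w 0 k)) -> measurable [set w | e < normv (u w)].
Proof.
move=> mu; have md : measurable_fun setT (fun w => normv (u w)).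
  apply: (measurableT_comp (continuous_measurable_fun (@sqrt_continuous R))).
  by apply: measurable_sum => k; exact: measurable_funM.
have h := measurable_fun_ltr (measurable_cst e) md.
by have := h measurableT [set true] I; rewrite setTI.
Qed.

(** Markov's inequality, the Euclidean norm being dominated by the sum of the absolute
    coordinates. *)
Lemma markov_sum d (Om : measurableType d) (R : realType) (P : probability Om R) p
    (u : Om -> 'rV[R]_p) e V : 0 < e -> (forall k, measurable_fun setT (fun w => u w 0 k)) ->
  (forall k, L1 P (fun w => `|u w 0 k|)) -> (forall k, Rintg P (fun w => `|u w 0 k|) <= V) ->
  fine (P [set w | e < normv (u w)]) <= e^-1 * (p%:R * V).
Proof.
move=> e0 mu Lu uV; set A := [set w | _].
have mA : measurable A by exact: measurable_normv_gt.
have LA : L1 P (\1_A : Om -> R) by apply: L1_indic => //; rewrite ltey_eq fin_num_measure.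
have -> : fine (P A) = Rintg P (\1_A : Om -> R) by rewrite /Rintegral integral_indic// setIT.
rewrite ler_pdivlMl// -(RintegralZl _ measurableT LA).
apply: (@le_trans _ _ (Rintg P (fun w => \sum_k `|u w 0 k|))).
  apply: le_Rintegral => //; [exact: L1Z|exact: L1_sum|move=> w _].
  rewrite indicE; have [wA|_] := boolP (w \in A); last by rewrite mulr0 sumr_ge0.
  rewrite mulr1; apply: le_trans (normv_le_sum _); apply: ltW; by rewrite inE in wA.
rewrite Rint_sum// -[leRHS](_ : \sum_(k < p) V = _); first exact: ler_sum.
by rewrite sumr_const card_ord mulr_natl.
Qed.

(** * The plug-in statistic for bounded covariates *)

Section core.
Variables (R : realType) (p alpha : nat) (c delta : R) (b : 'rV[R]_p) (B : R).
Hypotheses (alpha1 : (1 <= alpha)%N) (delta0 : 0 < delta) (c0 : 0 < c) (B0 : 0 <= B).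
Local Notation mR := (measurableTypeR R).
Local Notation leb := (@lebesgue_measure R).
Local Notation f := (enoise alpha c delta).
Local Notation f' := (derive1 f).
Context d0 (Om : measurableType d0) (P : probability Om R).
Variables (X : nat -> Om -> RpM R p) (Y : nat -> Om -> mR).
Variables (pX : set (RpM R p) -> R) (pY : set mR -> R).
Hypothesis mX : forall i, measurable_fun setT (X i).
Hypothesis mY : forall j, measurable_fun setT (Y j).
Hypothesis joint : forall n (A : nat -> set (RpM R p)) (C : nat -> set mR),
  (forall i, measurable (A i)) -> (forall j, measurable (C j)) ->
  P (rect X Y n A C) = ((\prod_(i < n) pX (A i)) * (\prod_(j < n) pY (C j)))%:E.
Hypotheses (pXT : pX setT = 1) (pYT : pY setT = 1).

Definition box (x : 'rV[R]_p) := forall k, `|x 0 k| <= B.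
Hypothesis XB : forall i w, box (X i w).

(** The density of Y and the numerator enter as expectations over the sample rather than as iterated
    integrals; they are later instantiated by [fY] and [Gvec]. *)
Variables (F : R -> R) (Gv : R -> 'rV[R]_p).
Hypothesis FE : forall i y, F y = Rintg P (fun w => f (y - dotv b (X i w))).
Hypothesis GE : forall i y k, Gv y 0 k = Rintg P (fun w => X i w 0 k * f' (y - dotv b (X i w))).
Hypothesis YF : forall j C, measurable C -> P (Y j @^-1` C) = (\int[leb]_(y in C) (F y)%:E)%E.

Definition dot_max := B * \sum_k `|b 0 k|.

Lemma dot_max_ge0 : 0 <= dot_max.
Proof. by apply: mulr_ge0 => //; apply: sumr_ge0. Qed.

Local Notation env := (env alpha dot_max).
Local Notation Cr := (Crat alpha delta dot_max).
(** [B] accounts for a coordinate of x and [alpha%:R * delta] for the ratio |f'|/f. *)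
Definition Ccscore := B + alpha%:R * delta.

Lemma Crat_ge0' : 0 <= Cr. Proof. by apply: Crat_ge0 => //; exact: dot_max_ge0. Qed.

Lemma alphadelta_ge0 : 0 <= alpha%:R * delta. Proof. by rewrite mulr_ge0// ltW. Qed.

Lemma Ccscore_ge0 : 0 <= Ccscore. Proof. by rewrite addr_ge0// alphadelta_ge0. Qed.

Lemma dot_box x : box x -> `|dotv b x| <= dot_max.
Proof.
move=> bx; rewrite /dotv /dot_max mulr_sumr; apply: le_trans (ler_norm_sum _ _ _) _.
by apply: ler_sum => k _; rewrite normrM mulrC ler_wpM2r.
Qed.

Lemma measurable_dotv (a : 'rV[R]_p) : measurable_fun setT (fun x : RpM R p => dotv a x).
Proof.
apply: measurable_sum => k; apply: measurable_funM => //; exact: measurable_coord.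
Qed.

Lemma measurable_noise : measurable_fun setT (f : R -> R). Proof. exact: measurable_enoise. Qed.
Lemma measurable_noise' : measurable_fun setT (f' : R -> R). Proof. exact: measurable_derive1_enoise. Qed.

Lemma measurable_residual : measurable_fun setT (fun z : RpM R p * mR => z.2 - dotv b z.1).
Proof.
apply: measurable_funB; first exact: measurable_snd.
by apply: (measurableT_comp (measurable_dotv b)); exact: measurable_fst.
Qed.

Lemma measurable_residualX i y : measurable_fun setT (fun w => y - dotv b (X i w)).
Proof. by apply: measurable_funB => //; apply: (measurableT_comp (measurable_dotv b)). Qed.

Lemma measurable_Xcoord i k : measurable_fun setT (fun w => X i w 0 k).
Proof. exact: (measurableT_comp (measurable_coord k) (mX i)). Qed.

Lemma L1_noiseX i y : L1 P (fun w => f (y - dotv b (X i w))).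
Proof.
apply: (@L1_bdd _ _ _ _ _ c) => [|w]; first exact: (measurableT_comp measurable_noise (measurable_residualX i y)).
by rewrite ger0_norm ?enoise_le// ltW// enoise_gt0.
Qed.

(** The ratio bound averaged over X. With [density_lb] it makes F(y) and f(y - b.x) interchangeable
    up to an envelope, for any x of the box. *)
Lemma density_ub x y : box x -> F y <= env Cr y * f (y - dotv b x).
Proof.
move=> bx; rewrite (FE 0%N) -[leRHS](Rint_cst P); apply: le_Rintegral => //.
- exact: L1_noiseX.
- exact: L1_cst.
- by move=> w _; apply: enoise_ratio; rewrite ?dot_max_ge0//; apply: dot_box.
Qed.

Lemma density_lb x y : box x -> f (y - dotv b x) <= env Cr y * F y.
Proof.
move=> bx; rewrite (FE 0%N) -[leLHS](Rint_cst P) -RintegralZl//; last exact: L1_noiseX.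
apply: le_Rintegral => //.
- exact: L1_cst.
- by apply: L1Z; exact: L1_noiseX.
- by move=> w _; apply: enoise_ratio; rewrite ?dot_max_ge0//; apply: dot_box.
Qed.

Lemma box0 : box 0. Proof. by move=> k; rewrite mxE normr0. Qed.

Lemma density_gt0 y : 0 < F y.
Proof.
have := density_lb y box0; have := @enoise_gt0 _ alpha c delta c0 (y - dotv b 0).
have := @env_gt0 _ alpha dot_max Cr y.
move=> e0 f0 h; rewrite -(pmulr_rgt0 _ e0); exact: lt_le_trans h.
Qed.

Lemma measurable_density : measurable_fun setT (F : mR -> R).
Proof.
have := @measurable_Rint_param _ _ mR Om R P (fun z => f (z.1 - dotv b (X 0 z.2))) _.
move=> h; rewrite (_ : F = fun y => Rintg P (fun w => f (y - dotv b (X 0 w)))); last first.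
  by apply/funext => y; exact: FE.
apply: h; apply: (measurableT_comp measurable_noise); apply: measurable_funB; first exact: measurable_fst.
apply: (measurableT_comp (measurable_dotv b)); apply: (measurableT_comp (mX 0)); exact: measurable_snd.
Qed.

Lemma measurable_Gv k : measurable_fun setT (fun y : mR => Gv y 0 k).
Proof.
have := @measurable_Rint_param _ _ mR Om R P (fun z => X 0 z.2 0 k * f' (z.1 - dotv b (X 0 z.2))) _.
move=> h; rewrite (_ : (fun y => _) = fun y => Rintg P (fun w => X 0 w 0 k * f' (y - dotv b (X 0 w)))); last first.
  by apply/funext => y; exact: GE.
apply: h; apply: measurable_funM.
  by apply: (measurableT_comp (measurable_Xcoord 0 k)); exact: measurable_snd.
apply: (measurableT_comp measurable_noise'); apply: measurable_funB; first exact: measurable_fst.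
apply: (measurableT_comp (measurable_dotv b)); apply: (measurableT_comp (mX 0)); exact: measurable_snd.
Qed.

Lemma G_bound y k : `|Gv y 0 k| <= B * env (alpha%:R * delta) y * F y.
Proof.
rewrite (GE 0%N) (FE 0%N) -RintegralZl//; last exact: L1_noiseX.
have bd w : `|X 0 w 0 k * f' (y - dotv b (X 0 w))| <=
    B * env (alpha%:R * delta) y * f (y - dotv b (X 0 w)).
  rewrite normrM -mulrA; apply: ler_pM => //; first exact: XB.
  by apply: derive1_enoise_bound; rewrite ?dot_max_ge0//; exact: dot_box.
have LR : L1 P (fun w => B * env (alpha%:R * delta) y * f (y - dotv b (X 0 w))).
  by apply: L1Z; exact: L1_noiseX.
apply: Rint_le_abs => //; apply: L1_le LR => //.
by apply: measurable_funM; [exact: measurable_Xcoord|exact: (measurableT_comp measurable_noise' (measurable_residualX 0 y))].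
Qed.

(** In the notation of the overview, [cscore k] and [sratio k] are coordinates of g and s, [wratio]
    is w, and [ckernel k] is a coordinate of the kernel s - g w. *)
Definition cscore k y := Gv y 0 k / F y.

Lemma B_env y : B * env (alpha%:R * delta) y <= env Ccscore y.
Proof.
rewrite /Ccscore -envM ler_wpM2r ?env_ge0//; apply: env_cst => //; exact: dot_max_ge0.
Qed.

Lemma cscore_bound k y : `|cscore k y| <= env Ccscore y.
Proof.
rewrite normrM normfV (ger0_norm (ltW (density_gt0 y))) ler_pdivrMr ?density_gt0//.
apply: le_trans (G_bound y k) _; rewrite ler_wpM2r ?(ltW (density_gt0 y))//; exact: B_env.
Qed.

Lemma measurable_densityV : measurable_fun setT (fun y : mR => (F y)^-1).
Proof.
by apply: (@measurable_pos_inv _ mR R) => [y|]; [exact: ltW (density_gt0 y)|exact: measurable_density].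
Qed.

Lemma measurable_cscore k : measurable_fun setT (cscore k : mR -> R).
Proof. by apply: measurable_funM; [exact: measurable_Gv|exact: measurable_densityV]. Qed.

Definition wratio (z : RpM R p * mR) : R := f (z.2 - dotv b z.1) / F z.2.
Definition sratio k (z : RpM R p * mR) : R := z.1 0 k * f' (z.2 - dotv b z.1) / F z.2.
Definition ckernel k z := sratio k z - cscore k z.2 * wratio z.

Lemma measurable_wratio : measurable_fun setT wratio.
Proof.
apply: measurable_funM; first exact: (measurableT_comp measurable_noise measurable_residual).
by apply: (measurableT_comp measurable_densityV); exact: measurable_snd.
Qed.

Lemma measurable_sratio k : measurable_fun setT (sratio k).
Proof.
apply: measurable_funM; last by apply: (measurableT_comp measurable_densityV); exact: measurable_snd.
apply: measurable_funM; last exact: (measurableT_comp measurable_noise' measurable_residual).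
by apply: (measurableT_comp (measurable_coord k)); exact: measurable_fst.
Qed.

Lemma measurable_ckernel k : measurable_fun setT (ckernel k).
Proof.
apply: measurable_funB; first exact: measurable_sratio.
by apply: measurable_funM; [apply: (measurableT_comp (measurable_cscore k)); exact: measurable_snd|exact: measurable_wratio].
Qed.

Lemma wratio_gt0 x y : 0 < wratio (x, y).
Proof. by rewrite divr_gt0 ?density_gt0 ?enoise_gt0. Qed.

Lemma wratio_ub x y : box x -> wratio (x, y) <= env Cr y.
Proof. by move=> bx; rewrite /wratio/= ler_pdivrMr ?density_gt0//; exact: density_lb. Qed.

Lemma wratio_lb x y : box x -> 1 <= env Cr y * wratio (x, y).
Proof. by move=> bx; rewrite /wratio/= mulrA ler_pdivlMr ?density_gt0// mul1r; exact: density_ub. Qed.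

Lemma sratio_bound k x y : box x -> `|sratio k (x, y)| <= env (Ccscore + Cr) y.
Proof.
move=> bx; rewrite /sratio/= normrM normfV (ger0_norm (ltW (density_gt0 y))) ler_pdivrMr ?density_gt0//.
rewrite -envM -mulrA normrM.
apply: (@le_trans _ _ (B * (env (alpha%:R * delta) y * f (y - dotv b x)))).
  apply: ler_pM => //; apply: derive1_enoise_bound; rewrite ?dot_max_ge0//; exact: dot_box.
rewrite mulrA; apply: ler_pM; last exact: density_lb.
- by rewrite mulr_ge0// env_ge0.
- by rewrite ltW// enoise_gt0.
- exact: B_env.
Qed.

(** Both terms of the kernel have the envelope with constant [Ccscore + Cr]; the summand 2 absorbs
    their number. *)
Definition Cker := 2 + (Ccscore + Cr).

Lemma ckernel_bound k x y : box x -> `|ckernel k (x, y)| <= env Cker y.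
Proof.
move=> bx; rewrite /Cker -envM; apply: (@le_trans _ _ (2 * env (Ccscore + Cr) y)); last first.
  by rewrite ler_wpM2r ?env_ge0//; apply: env_cst => //; exact: dot_max_ge0.
apply: le_trans (ler_normB _ _) _; rewrite mulr_natl mulr2n; apply: lerD; first exact: sratio_bound.
rewrite normrM -envM; apply: ler_pM => //; first exact: cscore_bound.
by rewrite ger0_norm ?wratio_ub// ltW// wratio_gt0.
Qed.

Lemma density_ge0 y : 0 <= F y. Proof. exact: ltW (density_gt0 y). Qed.

Lemma L1_env_density C : 0 <= C -> L1 leb (fun y : mR => env C y * F y).
Proof.
move=> C0; have L := L1_env_enoise alpha1 delta0 c0 dot_max_ge0 (addr_ge0 C0 Crat_ge0').
apply: (L1_le _ _ L).
  by apply: (@measurable_funM _ mR R); [exact: measurable_env|exact: measurable_density].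
move=> y; rewrite ger0_norm; last by rewrite mulr_ge0 ?density_ge0// env_ge0.
rewrite -envM -mulrA ler_wpM2l ?env_ge0//.
by have := density_ub y box0; rewrite (_ : dotv b 0 = 0) ?subr0// /dotv big1// => k _; rewrite mxE mulr0.
Qed.

Lemma Rint_Y (phi : mR -> R) C j : 0 <= C -> measurable_fun setT phi -> (forall y, `|phi y| <= env C y) ->
  L1 P (fun w => phi (Y j w)) /\ Rintg P (fun w => phi (Y j w)) = Rintg leb (fun y => phi y * F y).
Proof.
move=> C0 mphi phiC; apply: (law_density (mY j) measurable_density density_ge0 (YF j) mphi).
apply: (L1_le _ _ (L1_env_density C0)); first exact: (@measurable_funM _ mR R _ _ _ mphi measurable_density).
by move=> y; rewrite normrM (ger0_norm (density_ge0 y)) ler_wpM2r ?density_ge0.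
Qed.

Lemma norm_env C y : `|env C y| <= env C y.
Proof. by rewrite ger0_norm// env_ge0. Qed.

Lemma L1_envY C j : 0 <= C -> L1 P (fun w => env C (Y j w)).
Proof. by move=> C0; apply: (Rint_Y j C0 _ (norm_env C)).1; exact: measurable_env. Qed.

Definition env_mean C := Rintg leb (fun y => env C y * F y).

Lemma env_meanE C j : 0 <= C -> Rintg P (fun w => env C (Y j w)) = env_mean C.
Proof. by move=> C0; apply: (Rint_Y j C0 _ (norm_env C)).2; exact: measurable_env. Qed.

Lemma env_mean_ge0 C : 0 <= env_mean C.
Proof. by apply: Rintegral_ge0 => y _; rewrite mulr_ge0 ?density_ge0// env_ge0. Qed.

Lemma L1_XkX i y (h : RpM R p * mR -> R) C : measurable_fun setT h ->
  (forall x, box x -> `|h (x, y)| <= C) -> L1 P (fun w => h (X i w, y)).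
Proof.
move=> mh hC; apply: (@L1_bdd _ _ _ _ _ C) => [|w]; last exact: hC.
by apply: (measurableT_comp mh); exact: measurable_fun_pair.
Qed.

Lemma wratio_bound x y : box x -> `|wratio (x, y)| <= env Cr y.
Proof. by move=> bx; rewrite ger0_norm ?wratio_ub// ltW// wratio_gt0. Qed.

Lemma L1_wratioX i y : L1 P (fun w => wratio (X i w, y)).
Proof. by apply: (L1_XkX i measurable_wratio) => x; exact: wratio_bound. Qed.

Lemma L1_sratioX i k y : L1 P (fun w => sratio k (X i w, y)).
Proof. by apply: (L1_XkX i (measurable_sratio k)) => x; exact: sratio_bound. Qed.

Lemma E_wratioX i y : Rintg P (fun w => wratio (X i w, y)) = 1.
Proof.
rewrite (@eq_Rint _ _ _ _ _ (fun w => (F y)^-1 * f (y - dotv b (X i w)))).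
  by rewrite RintegralZl// -?FE ?mulVf ?gt_eqF ?density_gt0//; exact: L1_noiseX.
by move=> w; rewrite mulrC.
Qed.

Lemma E_sratioX i k y : Rintg P (fun w => sratio k (X i w, y)) = cscore k y.
Proof.
rewrite /cscore (GE i) mulrC -RintegralZl//; first by apply: eq_Rint => w; rewrite /sratio/= mulrC.
apply: eq_L1 (L1Z (F y) (L1_sratioX i k y)) => w.
by rewrite /sratio/= mulrC divfK// gt_eqF// density_gt0.
Qed.

Lemma E_ckernelX i k y : Rintg P (fun w => ckernel k (X i w, y)) = 0.
Proof.
have Lw := L1Z (cscore k y) (L1_wratioX i y).
rewrite (RintegralB _ (L1_sratioX i k y) Lw)// (RintegralZl (cscore k y) measurableT (L1_wratioX i y)).
by rewrite E_sratioX E_wratioX mulr1 subrr.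
Qed.

Lemma derive1_enoiseN t : f' (- t) = - f' t.
Proof. by rewrite !derive1_enoise// sgrN normrN enoiseN mulrN !mulNr. Qed.

Lemma L1_derive1_enoise u : `|u| <= dot_max -> L1 leb (fun y : mR => f' (y - u)).
Proof.
move=> uM; have L := L1_env_enoise alpha1 delta0 c0 dot_max_ge0 (addr_ge0 alphadelta_ge0 Crat_ge0').
apply: (L1_le _ _ L).
  by apply: (measurableT_comp measurable_noise'); exact: (@measurable_funB _ R R).
move=> y; have h : `|f' (y - u)| <= env (alpha%:R * delta) y * f (y - u).
  by apply: derive1_enoise_bound; rewrite ?dot_max_ge0.
apply: (le_trans h).
have : f (y - u) <= env Cr y * f (y - 0).
  by apply: enoise_ratio; rewrite ?dot_max_ge0// normr0 dot_max_ge0.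
by rewrite subr0 -envM -mulrA => h2; rewrite ler_wpM2l// env_ge0.
Qed.

Lemma Rint_derive1_enoise u : `|u| <= dot_max -> Rintg leb (fun y : mR => f' (y - u)) = 0.
Proof. by move=> uM; apply: Rint_odd0; [exact: derive1_enoiseN|exact: L1_derive1_enoise]. Qed.

Lemma wratioF x y : wratio (x, y) * F y = f (y - dotv b x).
Proof. by rewrite /wratio/= divfK// gt_eqF// density_gt0. Qed.

Lemma measurable_slice (h : RpM R p * mR -> R) x : measurable_fun setT h ->
  measurable_fun setT (fun y => h (x, y)).
Proof. by move=> mh; apply: (measurableT_comp mh); exact: measurable_fun_pair. Qed.

(** The density of Y cancels the denominator of s, leaving the integral of a function odd about
    b.x. *)
Lemma E_sratioY j k x : box x -> Rintg P (fun w => sratio k (x, Y j w)) = 0.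
Proof.
move=> bx; have [_ ->] := Rint_Y j (addr_ge0 Ccscore_ge0 Crat_ge0') (measurable_slice x (measurable_sratio k)) (fun y => sratio_bound k y bx).
rewrite (@eq_Rint _ _ _ _ _ (fun y : mR => x 0 k * f' (y - dotv b x))).
  rewrite RintegralZl//; last by apply: L1_derive1_enoise; exact: dot_box.
  by rewrite Rint_derive1_enoise ?mulr0//; exact: dot_box.
by move=> y; rewrite /sratio/= divfK// gt_eqF// density_gt0.
Qed.

(** A coordinate of psi; by [E_ckernelY] it is the projection of the kernel on X. *)
Definition infl k (x : RpM R p) : R := - Rintg leb (fun y : mR => cscore k y * f (y - dotv b x)).

Lemma measurable_infl k : measurable_fun setT (infl k).
Proof.
apply: measurable_funN; apply: (@measurable_Rint_param _ _ _ mR R leb (fun z : RpM R p * mR => cscore k z.2 * f (z.2 - dotv b z.1))).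
apply: measurable_funM; last exact: (measurableT_comp measurable_noise measurable_residual).
by apply: (measurableT_comp (measurable_cscore k)); exact: measurable_snd.
Qed.

Lemma cscore_wratio_bound k x y : box x -> `|cscore k y * wratio (x, y)| <= env (Ccscore + Cr) y.
Proof.
by move=> bx; rewrite normrM -envM ler_pM//; [exact: cscore_bound|exact: wratio_bound].
Qed.

Lemma measurable_cscore_wratio k : measurable_fun setT (fun z => cscore k z.2 * wratio z).
Proof. by apply: measurable_funM; [apply: (measurableT_comp (measurable_cscore k)); exact: measurable_snd|exact: measurable_wratio]. Qed.

Lemma E_ckernelY j k x : box x -> Rintg P (fun w => ckernel k (x, Y j w)) = infl k x.
Proof.
move=> bx; have C0 := addr_ge0 Ccscore_ge0 Crat_ge0'.
have [L1s _] := Rint_Y j C0 (measurable_slice x (measurable_sratio k)) (fun y => sratio_bound k y bx).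
have [L1g E] := Rint_Y j C0 (measurable_slice x (measurable_cscore_wratio k)) (fun y => cscore_wratio_bound k y bx).
rewrite RintegralB// E_sratioY// sub0r E; congr (- _); apply: eq_Rint => y.
by rewrite -mulrA wratioF.
Qed.

Lemma Cker_ge0 : 0 <= Cker. Proof. by rewrite /Cker; have := Ccscore_ge0; have := Crat_ge0'; lra. Qed.

Definition Kinfl := env_mean Cker.

(** Integrating the kernel's envelope over Y leaves a bound uniform on the box. *)
Lemma infl_bound k x : box x -> `|infl k x| <= Kinfl.
Proof.
move=> bx; rewrite -(E_ckernelY 0 k bx) /Kinfl -(env_meanE 0 Cker_ge0).
have [Lk _] := Rint_Y 0 Cker_ge0 (measurable_slice x (measurable_ckernel k)) (fun y => ckernel_bound k y bx).
apply: Rint_le_abs => //; first exact: L1_envY Cker_ge0.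
by move=> w; exact: ckernel_bound.
Qed.

Lemma indepXY i j : indep P (X i) (Y j).
Proof.
have ni : (i < (i + j).+1)%N by rewrite ltnS leq_addr.
have nj : (j < (i + j).+1)%N by rewrite ltnS leq_addl.
by apply: (indep_X_rest mX mY joint pXT pYT ni); apply: measurable_Y_rects.
Qed.

Lemma indepYX i j : indep P (Y j) (X i).
Proof. by move=> A C mA mC; rewrite setIC indepXY// muleC. Qed.

Lemma L1_XY (h : RpM R p * mR -> R) C i j : 0 <= C -> measurable_fun setT h ->
  (forall x y, box x -> `|h (x, y)| <= env C y) -> L1 P (fun w => h (X i w, Y j w)).
Proof.
move=> C0 mh hC; apply: (L1_le _ _ (L1_envY j C0)); last by move=> w; exact: hC.
by apply: (measurableT_comp mh); exact: measurable_fun_pair.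
Qed.

Lemma Fubini_XY (h : RpM R p * mR -> R) C i j : 0 <= C -> measurable_fun setT h ->
  (forall x y, box x -> `|h (x, y)| <= env C y) ->
  Rintg P (fun w => Rintg P (fun w' => h (X i w, Y j w'))) =
  Rintg P (fun w => Rintg P (fun w' => h (X i w', Y j w))).
Proof.
move=> C0 mh hC; have L := L1_XY i j C0 mh hC.
rewrite -(indep_Fubini (mX i) (mY j) (@indepXY i j) mh L).
rewrite (indep_Fubini (F := fun z => h (z.2, z.1)) (mY j) (mX i) (@indepYX i j))//.
by apply: (measurableT_comp mh); exact: measurable_fun_pair.
Qed.

(** By Fubini the kernel may be integrated over X first, which gives zero. *)
Lemma E_infl i k : Rintg P (fun w => infl k (X i w)) = 0.
Proof.
rewrite (@eq_Rint _ _ _ _ _ (fun w => Rintg P (fun w' => ckernel k (X i w, Y 0 w')))); last first.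
  by move=> w; rewrite E_ckernelY.
rewrite (Fubini_XY i 0 Cker_ge0 (measurable_ckernel k)); last by move=> x y; exact: ckernel_bound.
by rewrite (@eq_Rint _ _ _ _ _ (fun=> 0)) ?Rintg0// => w; exact: E_ckernelX.
Qed.

(** The exchange in the other direction: s averages to g over X, and to zero over Y. *)
Lemma E_cscore j k : Rintg P (fun w => cscore k (Y j w)) = 0.
Proof.
rewrite (@eq_Rint _ _ _ _ _ (fun w => Rintg P (fun w' => sratio k (X 0 w', Y j w)))); last first.
  by move=> w; rewrite E_sratioX.
rewrite -(Fubini_XY 0 j (addr_ge0 Ccscore_ge0 Crat_ge0') (measurable_sratio k)); last by move=> x y; exact: sratio_bound.
by rewrite (@eq_Rint _ _ _ _ _ (fun=> 0)) ?Rintg0// => w; exact: E_sratioY.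
Qed.

Lemma kernel_sums (q : RpM R p * mR -> R) C n : 0 <= C -> measurable_fun setT q ->
  (forall x y, box x -> `|q (x, y)| <= env C y) ->
  (forall i y, Rintg P (fun w => q (X i w, y)) = 0) ->
  (forall j, (j < n)%N -> L1 P (fun w => (\sum_(i < n) q (X i w, Y j w)) ^+ 2) /\
    Rintg P (fun w => (\sum_(i < n) q (X i w, Y j w)) ^+ 2) <= n%:R * env_mean (C + C)) /\
  ((forall x, box x -> forall j, Rintg P (fun w => q (x, Y j w)) = 0) ->
    L1 P (fun w => (\sum_(i < n) \sum_(j < n) q (X i w, Y j w)) ^+ 2) /\
    Rintg P (fun w => (\sum_(i < n) \sum_(j < n) q (X i w, Y j w)) ^+ 2) <= (n * n)%:R * env_mean (C + C)).
Proof.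
move=> C0 mq qC qX; have CC0 := addr_ge0 C0 C0.
have qk i w y : `|q (X i w, y)| <= env C y by exact: qC.
have mk : measurable_fun setT (env C : mR -> R) by exact: measurable_env.
have E2 j : (fun w => env C (Y j w) ^+ 2) = (fun w => env (C + C) (Y j w)).
  by apply/funext => w; rewrite expr2 envM.
have Lk j : L1 P (fun w => env C (Y j w) ^+ 2) by rewrite E2; exact: L1_envY.
have kV j : Rintg P (fun w => env C (Y j w) ^+ 2) <= env_mean (C + C) by rewrite E2 env_meanE.
split=> [j jn|qY]; first exact: (row_sum_sqr mX mY joint pXT pYT mq qk Lk kV qX jn).
by apply: (double_sum_sqr mX mY joint pXT pYT n mq mk qk Lk kV qX) => i j w; exact: qY.
Qed.

Lemma one_le_env C y : 0 <= C -> 1 <= env C y.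
Proof. by move=> C0; apply: env_ge1 => //; exact: dot_max_ge0. Qed.

Lemma add_env C D y : 0 <= C -> 0 <= D -> D + env C y <= env (1 + D + C) y.
Proof.
move=> C0 D0; rewrite -envM; have h := one_le_env y C0.
have h2 : 1 + D <= env (1 + D) y by apply: env_cst; [exact: dot_max_ge0|lra].
nra.
Qed.

(** Half the sum of bounds for the second moments of the kernels [q1], [q2], [q3] of
    [remainder_mean], plus 1 for the term 1/n of the plug-in bound. *)
Definition Vremainder := (env_mean (Cr + Cker + (Cr + Cker)) + env_mean (1 + 1 + Cr + (1 + 1 + Cr)) +
  (env_mean (1 + Kinfl + Cker + (1 + Kinfl + Cker)) + 1)) / 2.

Definition remainder_bound k n w : R :=
  n%:R^-1 * \sum_(j < n) (2^-1 * ((n%:R^-1 * \sum_(i < n) (env Cr (Y j w) * ckernel k (X i w, Y j w))) ^+ 2 +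
     (n%:R^-1 * \sum_(i < n) (1 - wratio (X i w, Y j w))) ^+ 2)) +
  2^-1 * (n%:R * (n%:R^-1 ^+ 2 * \sum_(i < n) \sum_(j < n) (ckernel k (X i w, Y j w) - infl k (X i w))) ^+ 2 + n%:R^-1).

Definition remainder k n w : R :=
  n%:R^-1 * \sum_(j < n) ((n%:R^-1 * \sum_(i < n) wratio (X i w, Y j w))^-1 *
     (n%:R^-1 * \sum_(i < n) sratio k (X i w, Y j w)))
  - n%:R^-1 * \sum_(j < n) cscore k (Y j w) - n%:R^-1 * \sum_(i < n) infl k (X i w).

Lemma remainder_le k n w : (0 < n)%N -> `|remainder k n w| <= remainder_bound k n w.
Proof.
move=> n0; apply: (@plug_in_bound _ n (fun i j : 'I_n => wratio (X i w, Y j w)) (fun i j : 'I_n => sratio k (X i w, Y j w))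
  (fun j : 'I_n => cscore k (Y j w)) (fun i : 'I_n => infl k (X i w)) (fun j : 'I_n => env Cr (Y j w))) => // [j|i j].
- exact: env_gt0.
- exact: wratio_lb.
Qed.

Lemma measurable_remainder k n : measurable_fun setT (remainder k n).
Proof.
have mp (h : RpM R p * mR -> R) i j : measurable_fun setT h -> measurable_fun setT (fun w => h (X i w, Y j w)).
  by move=> mh; apply: (measurableT_comp mh); exact: measurable_fun_pair.
apply: measurable_funB; first apply: measurable_funB.
- apply: measurable_funM => //; apply: measurable_sum => j; apply: measurable_funM; last first.
    by apply: measurable_funM => //; apply: measurable_sum => i; apply: mp; exact: measurable_sratio.
  apply: measurable_pos_inv; last first.
    by apply: measurable_funM => //; apply: measurable_sum => i; apply: mp; exact: measurable_wratio.
  move=> w; apply: mulr_ge0; first by rewrite invr_ge0.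
  by apply: sumr_ge0 => i _; exact: ltW (wratio_gt0 _ _).
- apply: measurable_funM => //; apply: measurable_sum => j; apply: (measurableT_comp (measurable_cscore k)); exact: mY.
- apply: measurable_funM => //; apply: measurable_sum => j; apply: (measurableT_comp (measurable_infl k)); exact: mX.
Qed.

(** Every term of the plug-in bound has expectation of order 1/n: the row means need centring in X
    only, while in the double sum the kernel minus psi is centred in both variables. *)
Lemma remainder_mean k n : (0 < n)%N ->
  L1 P (fun w => `|remainder k n w|) /\ Rintg P (fun w => `|remainder k n w|) <= Vremainder / n%:R.
Proof.
move=> n0; have CA := addr_ge0 Crat_ge0' Cker_ge0; have Kp0 : 0 <= Kinfl by exact: env_mean_ge0.
have C0 := Cker_ge0; have Crp := Crat_ge0'.
have CB : 0 <= 1 + 1 + Cr by lra.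
have CC : 0 <= 1 + Kinfl + Cker by lra.
(* The factor bounding 1/W_j depends on y alone, so [q1] remains centred in x. *)
pose q1 (z : RpM R p * mR) : R := env Cr z.2 * ckernel k z.
pose q2 (z : RpM R p * mR) : R := 1 - wratio z.
pose q3 (z : RpM R p * mR) : R := ckernel k z - infl k z.1.
have mq1 : measurable_fun setT q1.
  apply: measurable_funM; last exact: measurable_ckernel.
  by apply: (measurableT_comp (measurable_env _ _ _)); exact: measurable_snd.
have mq2 : measurable_fun setT q2 by apply: measurable_funB => //; exact: measurable_wratio.
have mq3 : measurable_fun setT q3.
  apply: measurable_funB; first exact: measurable_ckernel.
  by apply: (measurableT_comp (measurable_infl k)); exact: measurable_fst.
have b1 x y : box x -> `|q1 (x, y)| <= env (Cr + Cker) y.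
  by move=> bx; rewrite normrM -envM ler_pM ?norm_env//; exact: ckernel_bound.
have b2 x y : box x -> `|q2 (x, y)| <= env (1 + 1 + Cr) y.
  move=> bx; apply: le_trans (ler_normB _ _) _; rewrite normr1.
  by apply: le_trans (add_env y Crp ler01); rewrite lerD2l; exact: wratio_bound.
have b3 x y : box x -> `|q3 (x, y)| <= env (1 + Kinfl + Cker) y.
  move=> bx; apply: le_trans (ler_normB _ _) _; rewrite addrC.
  by apply: le_trans (add_env y C0 Kp0); apply: lerD; [exact: infl_bound|exact: ckernel_bound].
have LkX i y : L1 P (fun w => ckernel k (X i w, y)).
  by apply: (L1_XkX i (measurable_ckernel k)) => x; exact: ckernel_bound.
have LpX i : L1 P (fun w => infl k (X i w)).
  apply: (@L1_bdd _ _ _ _ _ Kinfl) => [|w]; last exact: infl_bound.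
  by apply: (measurableT_comp (measurable_infl k)).
have z1 i y : Rintg P (fun w => q1 (X i w, y)) = 0.
  by rewrite (RintegralZl (env Cr y) measurableT (LkX i y)) E_ckernelX mulr0.
have z2 i y : Rintg P (fun w => q2 (X i w, y)) = 0.
  by rewrite (RintegralB measurableT (L1_cst P 1) (L1_wratioX i y)) Rint_cst E_wratioX subrr.
have z3 i y : Rintg P (fun w => q3 (X i w, y)) = 0.
  by rewrite (RintegralB measurableT (LkX i y) (LpX i)) E_ckernelX E_infl subrr.
have z4 x : box x -> forall j, Rintg P (fun w => q3 (x, Y j w)) = 0.
  move=> bx j; have [Lk _] := Rint_Y j C0 (measurable_slice x (measurable_ckernel k)) (fun y => ckernel_bound k y bx).
  by rewrite (RintegralB measurableT Lk (L1_cst P (infl k x))) E_ckernelY// Rint_cst subrr.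
have [S1 _] := kernel_sums n CA mq1 b1 z1.
have [S2 _] := kernel_sums n CB mq2 b2 z2.
have [_ /(_ z4)[LS3 S3]] := kernel_sums n CC mq3 b3 z3.
set r := n%:R^-1 : R.
have r0 : 0 < r by rewrite invr_gt0 ltr0n.
have nr : n%:R * r = 1 by rewrite divff// pnatr_eq0 -lt0n.
have rE : r = n%:R^-1 by []; clearbody r.
pose V1 := env_mean (Cr + Cker + (Cr + Cker)); pose V2 := env_mean (1 + 1 + Cr + (1 + 1 + Cr)).
pose V3 := env_mean (1 + Kinfl + Cker + (1 + Kinfl + Cker)).
pose A j w := 2^-1 * ((r * \sum_(i < n) q1 (X i w, Y j w)) ^+ 2 + (r * \sum_(i < n) q2 (X i w, Y j w)) ^+ 2).
have HA (j : 'I_n) : L1 P (A j) /\ Rintg P (A j) <= 2^-1 * r * (V1 + V2).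
  have [L1a I1] := S1 j (ltn_ord j); have [L2a I2] := S2 j (ltn_ord j).
  rewrite (_ : A j = fun w => 2^-1 * r ^+ 2 * ((\sum_(i < n) q1 (X i w, Y j w)) ^+ 2 + (\sum_(i < n) q2 (X i w, Y j w)) ^+ 2)); last first.
    by apply/funext => w; rewrite /A; ring.
  split; first by apply: L1Z; exact: L1D.
  rewrite (RintegralZl _ measurableT (L1D L1a L2a)) (RintegralD measurableT L1a L2a).
  rewrite (_ : 2^-1 * r * (V1 + V2) = 2^-1 * r ^+ 2 * (n%:R * V1 + n%:R * V2)).
    by apply: ler_wpM2l; [rewrite mulr_ge0 ?sqr_ge0|exact: lerD].
  by rewrite (_ : 2^-1 * r = 2^-1 * (n%:R * r) * r); [ring|rewrite nr mulr1].
pose A3 w := (\sum_(i < n) \sum_(j < n) q3 (X i w, Y j w)) ^+ 2.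
have HA' (j : 'I_n) : L1 P (A j) := (HA j).1.
have E : remainder_bound k n = fun w => r * \sum_(j < n) A j w + (2^-1 * r ^+ 3 * A3 w + 2^-1 * r).
  apply/funext => w; rewrite /remainder_bound -rE; congr (_ + _); rewrite /A3 /q3/=.
  set S := \sum_(i < n) _; rewrite (_ : 2^-1 * r ^+ 3 = 2^-1 * (n%:R * r) * r ^+ 3); [ring|by rewrite nr mulr1].
have L1r : L1 P (remainder_bound k n).
  rewrite E; apply: L1D; first by apply: L1Z; apply: L1_sum.
  by apply: L1D; [exact: L1Z|exact: L1_cst].
have mr := measurable_remainder k n.
have Lr : L1 P (fun w => `|remainder k n w|).
  apply: L1_abs; apply: (L1_le _ _ L1r) => // w; exact: remainder_le.
split=> //; apply: (@le_trans _ _ (Rintg P (remainder_bound k n))).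
  by apply: le_Rintegral => // w _; exact: remainder_le.
rewrite E (RintegralD measurableT (L1Z r (L1_sum _ HA')) (L1D (L1Z _ LS3) (L1_cst P _))).
rewrite (RintegralD measurableT (L1Z _ LS3) (L1_cst P _)) Rint_cst.
rewrite (RintegralZl _ measurableT (L1_sum _ HA')) (RintegralZl _ measurableT LS3) (Rint_sum _ HA').
apply: (@le_trans _ _ (r * (n%:R * (2^-1 * r * (V1 + V2))) + (2^-1 * r ^+ 3 * ((n * n)%:R * V3) + 2^-1 * r))).
  apply: lerD.
    rewrite ler_wpM2l ?(ltW r0)// -[leRHS](_ : \sum_(j < n) (2^-1 * r * (V1 + V2)) = _).
      by apply: ler_sum => j _; exact: (HA j).2.
    by rewrite sumr_const card_ord mulr_natl.
  by rewrite lerD2r ler_wpM2l// mulr_ge0// exprn_ge0// ltW.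
rewrite /Vremainder -/V1 -/V2 -/V3 natrM le_eqVlt; apply/orP; left; apply/eqP.
have -> : n%:R = r^-1 by rewrite rE invrK.
by field; rewrite gt_eqF.
Qed.

(** * Moments of the leading terms and their joint central limit theorem *)

Lemma Rint_X0 (phi : RpM R p -> R) i : measurable_fun setT phi ->
  Rintg P (fun w => phi (X i w)) = Rintg P (fun w => phi (X 0 w)).
Proof.
move=> mphi; rewrite -!Rint_pushforward//; congr fine.
pose X' j : {mfun Om >-> RpM R p} := HB.pack (X j) (isMeasurableFun.Build _ _ _ _ _ (mX j)).
apply: (@eq_measure_integral _ _ _ setT (distribution P (X' 0)) (distribution P (X' i))) => A mA _.
exact: etrans (law_X joint pXT pYT i mA) (esym (law_X joint pXT pYT 0 mA)).
Qed.

Lemma L1_cscoreM j k l : L1 P (fun w => cscore k (Y j w) * cscore l (Y j w)) /\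
  Rintg P (fun w => cscore k (Y j w) * cscore l (Y j w)) = Rintg leb (fun y : mR => cscore k y * cscore l y * F y).
Proof.
apply: (Rint_Y (phi := fun y => cscore k y * cscore l y) j (addr_ge0 Ccscore_ge0 Ccscore_ge0)).
  by apply: (@measurable_funM _ mR R); exact: measurable_cscore.
by move=> y; rewrite normrM -envM ler_pM//; exact: cscore_bound.
Qed.

Lemma L1_inflM j k l : L1 P (fun w => infl k (X j w) * infl l (X j w)).
Proof.
apply: (@L1_bdd _ _ _ _ _ (Kinfl * Kinfl)) => [|w].
  by apply: measurable_funM; apply: (measurableT_comp (measurable_infl _)).
by rewrite normrM ler_pM//; exact: infl_bound.
Qed.

Definition cov_cscore : 'M[R]_p := \matrix_(k, l) Rintg P (fun w => cscore k (Y 0 w) * cscore l (Y 0 w)).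
Definition cov_infl : 'M[R]_p := \matrix_(k, l) Rintg P (fun w => infl k (X 0 w) * infl l (X 0 w)).

Section score.
Variables t1 t2 : 'rV[R]_p.

Definition score1 (y : mR) : R := \sum_k t1 0 k * cscore k y.
Definition score2 (x : RpM R p) : R := \sum_k t2 0 k * infl k x.
(** A Cramér-Wold direction: one scalar summand per pair (X_j, Y_j), whose sum carries both leading
    terms. *)
Definition score j w := score1 (Y j w) + score2 (X j w).

Lemma measurable_score1 : measurable_fun setT score1.
Proof. by apply: measurable_sum => k; apply: (@measurable_funM _ mR R) => //; exact: measurable_cscore. Qed.

Lemma measurable_score2 : measurable_fun setT score2.
Proof. by apply: measurable_sum => k; apply: measurable_funM => //; exact: measurable_infl. Qed.

Lemma measurable_score j : measurable_fun setT (score j).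
Proof.
by apply: measurable_funD; [exact: (measurableT_comp measurable_score1)|exact: (measurableT_comp measurable_score2)].
Qed.

Definition coef_norm := \sum_k `|t1 0 k| + \sum_k `|t2 0 k|.

Lemma coef_norm_ge0 : 0 <= coef_norm. Proof. by rewrite addr_ge0// sumr_ge0. Qed.

Definition Csum := 1 + Kinfl + Ccscore.

Lemma Kinfl_ge0 : 0 <= Kinfl. Proof. exact: env_mean_ge0. Qed.

Lemma Csum_ge0 : 0 <= Csum. Proof. by rewrite /Csum; have := Kinfl_ge0; have := Ccscore_ge0; lra. Qed.

Lemma score_bound j w : `|score j w| <= coef_norm * env Csum (Y j w).
Proof.
have h := add_env (Y j w) Ccscore_ge0 Kinfl_ge0; have e0 := env_gt0 alpha dot_max Ccscore (Y j w).
have k0 := Kinfl_ge0.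
apply: le_trans (ler_normD _ _) _; rewrite /coef_norm mulrDl !mulr_suml; apply: lerD.
  apply: le_trans (ler_norm_sum _ _ _) _; apply: ler_sum => k _.
  rewrite normrM ler_wpM2l//; apply: le_trans h; apply: le_trans (cscore_bound _ _) _; lra.
apply: le_trans (ler_norm_sum _ _ _) _; apply: ler_sum => k _.
rewrite normrM ler_wpM2l//; apply: le_trans h; apply: le_trans (infl_bound _ (XB _ _)) _; lra.
Qed.

Definition Csum4 := Csum + Csum + (Csum + Csum).

(** Supplies the fourth moment required by [clt_chf]; the fourth power of an envelope is again an
    envelope. *)
Lemma score4 j : L1 P (fun w => score j w ^+ 4) /\
  Rintg P (fun w => score j w ^+ 4) <= coef_norm ^+ 4 * env_mean Csum4.
Proof.
have C40 : 0 <= Csum4 by rewrite /Csum4; have := Csum_ge0; lra.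
have E w : env Csum4 (Y j w) = env Csum (Y j w) ^+ 4 by rewrite /Csum4 -!envM; ring.
have bd w : `|score j w ^+ 4| <= coef_norm ^+ 4 * env Csum4 (Y j w).
  by rewrite normrX E -exprMn lerXn2r ?nnegrE ?mulr_ge0 ?coef_norm_ge0 ?env_ge0//; exact: score_bound.
have LE := L1Z (coef_norm ^+ 4) (L1_envY j C40).
have L4 : L1 P (fun w => score j w ^+ 4).
  by apply: (L1_le _ _ LE) => //; apply: measurable_funX; exact: measurable_score.
split=> //; apply: le_trans (ler_norm _) _; rewrite -(env_meanE j C40).
rewrite -(RintegralZl _ measurableT (L1_envY j C40)); exact: Rint_le_abs.
Qed.

Lemma score1_sqr j : L1 P (fun w => score1 (Y j w) ^+ 2) /\
  Rintg P (fun w => score1 (Y j w) ^+ 2) = quad t1 cov_cscore.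
Proof.
have E k l : Rintg P (fun w => cscore k (Y j w) * cscore l (Y j w)) = cov_cscore k l.
  by rewrite [RHS]mxE (L1_cscoreM j k l).2 (L1_cscoreM 0 k l).2.
exact: (@quad_mean _ _ _ P p (fun k w => cscore k (Y j w)) t1 cov_cscore (fun k l => (L1_cscoreM j k l).1) E).
Qed.

Lemma score2_sqr j : L1 P (fun w => score2 (X j w) ^+ 2) /\
  Rintg P (fun w => score2 (X j w) ^+ 2) = quad t2 cov_infl.
Proof.
have E k l : Rintg P (fun w => infl k (X j w) * infl l (X j w)) = cov_infl k l.
  rewrite [RHS]mxE; have := @Rint_X0 (fun x => infl k x * infl l x) j; apply.
  by apply: measurable_funM; exact: measurable_infl.
exact: (@quad_mean _ _ _ P p (fun k w => infl k (X j w)) t2 cov_infl (L1_inflM j) E).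
Qed.

Lemma L1_cscore j k : L1 P (fun w => cscore k (Y j w)).
Proof. by apply: (Rint_Y j Ccscore_ge0 (measurable_cscore k) (cscore_bound k)).1. Qed.

Lemma L1_infl j k : L1 P (fun w => infl k (X j w)).
Proof.
apply: (@L1_bdd _ _ _ _ _ Kinfl) => [|w]; last exact: infl_bound.
exact: (measurableT_comp (measurable_infl k)).
Qed.

Lemma L1_score1 j : L1 P (fun w => score1 (Y j w)).
Proof. by apply: L1_sum => k; apply: L1Z; exact: L1_cscore. Qed.

Lemma L1_score2 j : L1 P (fun w => score2 (X j w)).
Proof. by apply: L1_sum => k; apply: L1Z; exact: L1_infl. Qed.

Lemma E_score1 j : Rintg P (fun w => score1 (Y j w)) = 0.
Proof.
rewrite Rint_sum => [|k]; last by apply: L1Z; exact: L1_cscore.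
by apply: big1 => k _; rewrite (RintegralZl _ measurableT (L1_cscore j k)) E_cscore mulr0.
Qed.

Lemma E_score2 j : Rintg P (fun w => score2 (X j w)) = 0.
Proof.
rewrite Rint_sum => [|k]; last by apply: L1Z; exact: L1_infl.
by apply: big1 => k _; rewrite (RintegralZl _ measurableT (L1_infl j k)) E_infl mulr0.
Qed.

Lemma E_score j : Rintg P (score j) = 0.
Proof. by rewrite (RintegralD measurableT (L1_score1 j) (L1_score2 j)) E_score1 E_score2 addr0. Qed.

(** X_j and Y_j are independent and both scores are centred, so the covariance is block diagonal;
    this is the source of the independence of W_1 and W_2. *)
Lemma E_score_sqr j : Rintg P (fun w => score j w ^+ 2) = quad t1 cov_cscore + quad t2 cov_infl.
Proof.
have [La Ea] := score1_sqr j; have [Lb Eb] := score2_sqr j.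
have Lab : L1 P (fun w => score2 (X j w) * score1 (Y j w)).
  apply: (L1_le _ _ (L1D La Lb)).
    by apply: measurable_funM; [exact: (measurableT_comp measurable_score2)|exact: (measurableT_comp measurable_score1)].
  move=> w; rewrite normrM -(real_normK (num_real (score1 _))) -(real_normK (num_real (score2 _))).
  by have := sqr_ge0 (`|score1 (Y j w)| - `|score2 (X j w)|); have := sqr_ge0 (`|score1 (Y j w)| + `|score2 (X j w)|); nra.
have Eab := indep_Rint_mul (mX j) (mY j) (@indepXY j j) measurable_score2 measurable_score1 (L1_score2 j) Lab (L1_score1 j).
rewrite (@eq_Rint _ _ _ _ _ (fun w => score1 (Y j w) ^+ 2 + score2 (X j w) ^+ 2 + 2 * (score2 (X j w) * score1 (Y j w)))); last first.
  by move=> w; rewrite /score; ring.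
rewrite (RintegralD measurableT (L1D La Lb) (L1Z 2 Lab)) (RintegralD measurableT La Lb) (RintegralZl 2 measurableT Lab).
by rewrite Eab E_score1 Ea Eb !mulr0 addr0.
Qed.

Lemma score_indep k : indep P (score k) (fun w => \sum_(j < k) score j w).
Proof.
have ms (I J : pred nat) j : I j -> J j -> (j < k.+1)%N ->
    @measurable_fun _ _ (g_sigma_algebraType (rects X Y k.+1 I J)) R setT (score j).
  move=> Ij Jj jk; apply: measurable_funD.
    by apply: (measurableT_comp measurable_score1); exact: measurable_Y_rects.
  by apply: (measurableT_comp measurable_score2); exact: measurable_X_rects.
apply: (indep_rects mX mY joint pXT pYT (n := k.+1) (I := pred1 k) (J := pred1 k)
  (I' := [pred i | (i < k)%N]) (J' := [pred i | (i < k)%N])).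
- by move=> i /=; case: eqP => [->|//]; rewrite ltnn.
- by move=> i /=; case: eqP => [->|//]; rewrite ltnn.
- by apply: ms => //=.
- apply: measurable_sum => j; apply: ms => //=; first by rewrite ltnW// ltnS.
Qed.

End score.

Lemma cov_cscore_sym : cov_cscore^T = cov_cscore.
Proof. by apply/matrixP => k l; rewrite !mxE; apply: eq_Rint => w; rewrite mulrC. Qed.

Lemma cov_infl_sym : cov_infl^T = cov_infl.
Proof. by apply/matrixP => k l; rewrite !mxE; apply: eq_Rint => w; rewrite mulrC. Qed.

Lemma cov_cscore_psd t : 0 <= quad t cov_cscore.
Proof. by rewrite -(score1_sqr t 0).2; apply: Rintegral_ge0 => w _; exact: sqr_ge0. Qed.

Lemma cov_infl_psd t : 0 <= quad t cov_infl.
Proof. by rewrite -(score2_sqr t 0).2; apply: Rintegral_ge0 => w _; exact: sqr_ge0. Qed.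

Definition root_n_sum n w (i : 'I_p + 'I_p) : R := Num.sqrt n%:R * (n%:R^-1 *
  \sum_(j < n) match i with inl k => cscore k (Y j w) | inr k => infl k (X j w) end).

Lemma measurable_root_n_sum n i : measurable_fun setT (fun w => root_n_sum n w i).
Proof.
apply: measurable_funM => //; apply: measurable_funM => //; apply: measurable_sum => j.
by case: i => k; [apply: (measurableT_comp (measurable_cscore k)); exact: mY|exact: (measurableT_comp (measurable_infl k))].
Qed.

Lemma root_n_sum_score (t : 'I_p + 'I_p -> R) n w : \sum_i t i * root_n_sum n w i =
  (Num.sqrt n%:R)^-1 * \sum_(j < n) score (\row_k t (inl k)) (\row_k t (inr k)) j w.
Proof.
rewrite big_sumType/= /score big_split/= mulrDr -sqrt_mulVn -!mulrA /root_n_sum.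
congr (_ + _); rewrite exchange_big/= !mulr_sumr; apply: eq_bigr => k _;
  rewrite mxE -mulr_sumr; ring.
Qed.

(** A coordinate is the score in a basis direction; its second moment is bounded uniformly in n,
    which is the tightness used for weak convergence. *)
Lemma root_n_sum_sqr n i (t := fun i' : 'I_p + 'I_p => (i' == i)%:R : R)
    (v := quad (\row_k t (inl k)) cov_cscore + quad (\row_k t (inr k)) cov_infl) :
  0 <= v /\ L1 P (fun w => root_n_sum n w i ^+ 2) /\ Rintg P (fun w => root_n_sum n w i ^+ 2) <= v.
Proof.
have v0 : 0 <= v by apply: addr_ge0; [exact: cov_cscore_psd|exact: cov_infl_psd].
pose t1 := \row_k t (inl k); pose t2 := \row_k t (inr k).
have E w : root_n_sum n w i = (Num.sqrt n%:R)^-1 * \sum_(j < n) score t1 t2 j w.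
  rewrite -root_n_sum_score (bigD1 i)//= /t eqxx mul1r big1 ?addr0// => i' /negbTE ->.
  by rewrite mul0r.
have [L I] := sum_sqr (n := n) (measurable_score t1 t2) (fun k _ => score_indep t1 t2 k)
  (fun j => (score4 t1 t2 j).1) (E_score t1 t2) (E_score_sqr t1 t2) (leqnn n).
have E2 : (fun w => root_n_sum n w i ^+ 2) = fun w => (Num.sqrt n%:R)^-1 ^+ 2 * (\sum_(j < n) score t1 t2 j w) ^+ 2.
  by apply/funext => w; rewrite E exprMn.
split=> //; rewrite E2; split; first exact: L1Z.
rewrite (RintegralZl _ measurableT L) I -/v exprVn sqr_sqrtr ?ler0n// mulrA.
(* For n = 0 the second moment is 0, whence an inequality only. *)
case: (n) => [|m]; first by rewrite mulr0 mul0r.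
by rewrite mulVf ?mul1r// pnatr_eq0.
Qed.

(** The factors come from [psd_factor] and are fixed before [h]. The cosine transforms of the sums
    approach those of the Gaussian pair at rate n^(-1/2), and the uniform second moments extend this
    to bounded continuous [h]. *)
Lemma clt_score : exists A1 A2 : 'M[R]_p, A1 *m A1^T = cov_cscore /\ A2 *m A2^T = cov_infl /\
  forall (h : 'rV[R]_p * 'rV[R]_p -> R) M, continuous h -> (forall z, `|h z| <= M) ->
  (forall n, measurable_fun setT (fun w => pair_fun h (root_n_sum n w))) /\
  (fun n => Rintg P (fun w => pair_fun h (root_n_sum n w))) @ \oo -->
    intRp (fun z1 => intRp (fun z2 =>
      h (z1 *m A1^T, z2 *m A2^T) * std_gauss_pdf z1 * std_gauss_pdf z2)).
Proof.
have [A1 E1] := psd_factor cov_cscore_sym cov_cscore_psd; have [A2 E2] := psd_factor cov_infl_sym cov_infl_psd.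
exists A1, A2; split=> //; split=> // h M ch hM.
have [Q [Qc Qh]] := gaussian_pair A1 A2.
have chf t s : test_fun P Q root_n_sum (pair_coord A1 A2) (fun x => cos (s + \sum_i t i * x i)).
  split.
  - move=> n; apply: measurable_cos; apply: measurable_funD => //; apply: measurable_sum => i.
    by apply: measurable_funM => //; exact: measurable_root_n_sum.
  - apply: measurable_cos; apply: measurable_funD => //; apply: measurable_sum => i.
    by apply: measurable_funM => //; exact: measurable_pair_coord.
  - by exists 1 => x; exact: cos_max.
  pose t1 := \row_k t (inl k); pose t2 := \row_k t (inr k).
  have -> : Rintg Q ((fun x => cos (s + \sum_i t i * x i)) \o pair_coord A1 A2) =
      expR (- ((quad t1 cov_cscore + quad t2 cov_infl) / 2)) * cos s.
    rewrite -E1 -E2 -Qc; apply: eq_Rint => z /=; rewrite big_sumType/=.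
    by congr (cos (_ + (_ + _))); apply: eq_bigr => k _; rewrite ?[t1 0 k]mxE ?[t2 0 k]mxE.
  apply/cvgrPdist_le => e e0.
  have := near_invsqrt (1 + 2 * (coef_norm t1 t2 ^+ 4 * env_mean Csum4) + (quad t1 cov_cscore + quad t2 cov_infl) ^+ 2) e0.
  apply: filterS => n [n0 ne]; rewrite distrC; apply: le_trans ne.
  have := clt_chf (n := n) (measurable_score t1 t2) (fun k _ => score_indep t1 t2 k)
    (fun j => (score4 t1 t2 j).1) (E_score t1 t2) (E_score_sqr t1 t2) (fun j => (score4 t1 t2 j).2) s n0.
  rewrite (@eq_Rint _ _ _ P _ ((fun x => cos (s + \sum_i t i * x i)) \o root_n_sum n))// => w /=.
  by rewrite root_n_sum_score.
pose v i := quad (\row_k (inl k == i)%:R) cov_cscore + quad (\row_k (inr k == i)%:R) cov_infl.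
have v0 i : 0 <= v i by exact: (root_n_sum_sqr 0 i).1.
have SV n i : Rintg P (fun w => root_n_sum n w i ^+ 2) <= \sum_i v i.
  apply: le_trans (root_n_sum_sqr n i).2.2 _; rewrite -/(v i) (bigD1 i)//= lerDl.
  by apply: sumr_ge0 => j _.
have pM x : `|pair_fun h x| <= M by exact: hM.
have [m1 m2 _ cv] := weak_convergence chf pM (pair_fun_uc ch) (sumr_ge0 _ (fun i _ => v0 i))
  (fun n i => (root_n_sum_sqr n i).2.1) SV.
have pE z : pair_fun h (pair_coord A1 A2 z) = h (z.1 *m A1^T, z.2 *m A2^T).
  by rewrite /pair_fun; congr (h (_, _)); apply/rowP => k; rewrite mxE.
split; first exact: m1.
rewrite (Qh h M)//; last first.
  by rewrite (_ : (fun z => _) = pair_fun h \o pair_coord A1 A2)//; apply/funext => z /=; rewrite pE.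
rewrite (@eq_Rint _ _ _ Q _ (pair_fun h \o pair_coord A1 A2)); first exact: cv.
by move=> z /=; rewrite pE.
Qed.

(** Markov's inequality: an L1 bound of order 1/n, multiplied by sqrt(n), vanishes in the limit. *)
Lemma remainder_op eps : 0 < eps ->
  (fun n => P [set w | eps < normv (Num.sqrt n%:R *: \row_k remainder k n w)]) @ \oo --> ((0:R)%:E).
Proof.
move=> eps0; pose A n := [set w | eps < normv (Num.sqrt n%:R *: \row_k remainder k n w)].
have mcoord n k : measurable_fun setT (fun w => (Num.sqrt n%:R *: \row_k remainder k n w : 'rV[R]_p) 0 k).
  rewrite (_ : (fun w => _) = fun w => Num.sqrt n%:R * remainder k n w); last by apply/funext => w; rewrite !mxE.
  by apply: measurable_funM => //; exact: measurable_remainder.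
have mA n : measurable (A n) by exact: measurable_normv_gt.
have -> : (fun n => P (A n)) = (fun n => (fine (P (A n)))%:E).
  by apply/funext => n; rewrite fineK// fin_num_measure.
apply/cvg_EFin; first by near=> n; rewrite fin_numE.
apply/cvgrPdist_le => e e0.
have := near_invsqrt (eps^-1 * (p%:R * Vremainder)) e0; apply: filterS => n [n0 ne] /=.
rewrite sub0r normrN ger0_norm; last by apply: fine_ge0; exact: measure_ge0.
apply: le_trans ne.
have := @markov_sum _ _ _ P p (fun w => Num.sqrt n%:R *: \row_k remainder k n w) eps ((Num.sqrt n%:R)^-1 * Vremainder) eps0 (mcoord n).
rewrite (_ : eps^-1 * (p%:R * (_ * Vremainder)) = (Num.sqrt n%:R)^-1 * (eps^-1 * (p%:R * Vremainder))); last by ring.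
have E k : (fun w => `|(Num.sqrt n%:R *: \row_k remainder k n w : 'rV[R]_p) 0 k|) = fun w => Num.sqrt n%:R * `|remainder k n w|.
  by apply/funext => w; rewrite !mxE normrM ger0_norm// sqrtr_ge0.
apply=> k; rewrite E; have [L I] := remainder_mean k n0; first exact: L1Z.
rewrite (RintegralZl _ measurableT L) -sqrt_mulVn -mulrA (mulrC _^-1) ler_wpM2l// sqrtr_ge0.
Unshelve. all: by end_near. Qed.
End core.

(* For bounded [u], measurability is read off [weak_convergence] applied to a
   constant sequence; the general case follows by truncation. *)
Lemma measurable_pair_fun d (Om : measurableType d) (R : realType) (P : probability Om R) p
    (h : 'rV[R]_p * 'rV[R]_p -> R) M (u : Om -> 'I_p + 'I_p -> R) :
  continuous h -> (forall z, `|h z| <= M) ->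
  (forall i, measurable_fun setT (fun w => u w i)) ->
  measurable_fun setT (fun w => pair_fun h (u w)).
Proof.
move=> ch hM mu; pose tr (m : nat) w i : R := if `|u w i| <= m%:R then u w i else 0.
have mtr m i : measurable_fun setT (fun w => tr m w i).
  apply: measurable_fun_ifT => //; apply: measurable_fun_ler => //.
  exact: (measurableT_comp (@normr_measurable R setT)).
have trm m w i : `|tr m w i| <= m%:R.
  by rewrite /tr; case: ifP => // _; rewrite normr0.
have mh m : measurable_fun setT (fun w => pair_fun h (tr m w)).
  have chf t c : test_fun P P (fun=> tr m) (tr m) (fun x => cos (c + \sum_i t i * x i)).
    have mc : measurable_fun setT ((fun x => cos (c + \sum_i t i * x i)) \o tr m).
      apply: measurable_cos; apply: measurable_funD => //; apply: measurable_sum => i.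
      exact: measurable_funM.
    by split=> //; [exists 1 => x; exact: cos_max|exact: cvg_cst].
  have bd i w : `|tr m w i ^+ 2| <= m%:R ^+ 2.
    by rewrite normrX lerXn2r ?nnegrE// normr_ge0.
  have LS (n : nat) i : L1 P (fun w => tr m w i ^+ 2).
    by apply: (@L1_bdd _ _ _ _ _ (m%:R ^+ 2)) => //; exact: measurable_funX.
  have SV (n : nat) i : Rintg P (fun w => tr m w i ^+ 2) <= m%:R ^+ 2.
    apply: le_trans (ler_norm _) _; rewrite -[leRHS](Rint_cst P).
    exact: (Rint_le_abs (LS 0%N i) (L1_cst P _) (bd i)).
  by have [_ m2 _ _] := weak_convergence chf (fun x => hM _ : `|pair_fun h x| <= M) (pair_fun_uc ch)
    (sqr_ge0 m%:R) LS SV.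
apply: (measurable_fun_cvg mh) => w _.
apply: cvg_near_cst; near=> m; congr (pair_fun h _); apply/funext => i; rewrite /tr ifT//.
apply: (@le_trans _ _ (\sum_i `|u w i|)).
  by rewrite (bigD1 i)//= lerDl sumr_ge0.
by near: m; exact: nbhs_infty_ger.
Unshelve. all: by end_near. Qed.

(** * Transfer to the model *)

Section off_null.
Context d (Om : measurableType d) (R : realType) (P : probability Om R).
Variable N : set Om.
Hypotheses (mN : measurable N) (PN : P N = 0%E).

Lemma le_off_null A A' : measurable A -> measurable A' -> (forall w, ~ N w -> A w -> A' w) ->
  (P A <= P A')%E.
Proof.
move=> mA mA' AA'; rewrite -(measureU0 mA' mN PN).
apply: le_measure; rewrite ?inE//; first exact: measurableU.
by move=> w Aw; have [Nw|nN] := pselect (N w); [right|left; exact: AA'].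
Qed.

Lemma eq_off_null A A' : measurable A -> measurable A' -> (forall w, ~ N w -> A w = A' w) ->
  P A = P A'.
Proof.
move=> mA mA' AA'; apply/eqP; rewrite eq_le !le_off_null// => w nN; by rewrite AA'.
Qed.

Lemma eq_Rint_off_null (f cscore : Om -> R) : measurable_fun setT f -> measurable_fun setT cscore ->
  (forall w, ~ N w -> f w = cscore w) -> (\int[P]_w (f w)%:E = \int[P]_w (cscore w)%:E)%E.
Proof.
move=> measurable_noise measurable_cscore fg; apply: ae_eq_integral => //; try exact/measurable_EFinP.
exists N; split=> // w; apply: contra_notP => nN _ /=; by rewrite fg.
Qed.
End off_null.

Lemma coord_le_normv (R : realType) p (u : 'rV[R]_p) k : `|u 0 k| <= normv u.
Proof.
rewrite -sqrtr_sqr ler_wsqrtr// /dotv (bigD1 k)//= -expr2 lerDl sumr_ge0// => j _.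
by rewrite -expr2 sqr_ge0.
Qed.

Section model.
Variables (R : realType) (p : nat) (b : 'rV[R]_p) (fX : 'rV[R]_p -> R) (B : R) (alpha : nat) (d : R).
Variables (dO : measure_display) (Om : measurableType dO) (P : probability Om R).
Variables (Xt : nat -> Om -> RpM R p) (Yt : nat -> Om -> measurableTypeR R).
Local Notation mR := (measurableTypeR R).
Local Notation leb := (@lebesgue_measure R).
Hypothesis mfX : @measurable_fun _ _ (RpM R p) R setT fX.
Hypothesis fX0 : forall x, 0 <= fX x.
Hypothesis fX1 : intRp fX = 1.
Hypothesis B0 : 0 < B.
Hypothesis fXB : intRp (fun x => \1_[set z | B < normv z] x * fX x) = 0.
Hypotheses (alpha1 : (1 <= alpha)%N) (d0 : 0 < d).
Hypothesis mX : forall i, measurable_fun setT (Xt i).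
Hypothesis mY : forall j, measurable_fun setT (Yt j).
Local Notation c := (c_alpha alpha d).
Local Notation delta := (d ^- alpha).
Local Notation f := (enoise alpha c delta).
Local Notation F := (fY alpha d b fX).
Local Notation Gv := (Gvec alpha d b fX).

Definition massX (A : set (RpM R p)) := intRp (fun x => \1_A x * fX x).
Definition massY (C : set mR) := lebRint (fun y => \1_C y * F y).

Hypothesis joint : forall n (A : nat -> set (RpM R p)) (C : nat -> set mR),
  (forall i, measurable (A i)) -> (forall j, measurable (C j)) ->
  P (rect Xt Yt n A C) = ((\prod_(i < n) massX (A i)) * (\prod_(j < n) massY (C j)))%:E.

Lemma fnoiseE : fnoise alpha d = f.
Proof. by []. Qed.

Lemma fnoise'E : fnoise' alpha d = derive1 f.
Proof. by []. Qed.

Lemma delta0 : 0 < delta. Proof. by rewrite invr_gt0 exprn_gt0. Qed.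

Lemma massXT : massX setT = 1.
Proof. by rewrite /massX -fX1; congr intRp; apply/funext => x; rewrite indicT mul1r. Qed.

(** The product formula for n = 1 without constraints yields the total mass of [fY], with no
    integral to compute. *)
Lemma massYT : massY setT = 1.
Proof.
have := @joint 1 (fun=> setT) (fun=> setT) (fun=> measurableT) (fun=> measurableT).
rewrite !big_ord1 massXT mul1r (_ : rect _ _ _ _ _ = setT) ?probability_setT => [[]//|].
by apply/seteqP; split.
Qed.

(* [Xt] is only almost surely in the ball; the truncated sample has the same law. *)
Definition trX i w : RpM R p := if normv (Xt i w) <= B then Xt i w else 0.

Lemma measurable_normv : measurable_fun setT (fun x : RpM R p => normv x).
Proof.
apply: (measurableT_comp (continuous_measurable_fun (@sqrt_continuous R))).
by apply: measurable_sum => k; apply: measurable_funM; exact: measurable_coord.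
Qed.

Lemma measurable_trX i : measurable_fun setT (trX i).
Proof.
apply: measurable_fun_ifT => //; apply: measurable_fun_ler => //.
exact: (measurableT_comp measurable_normv (mX i)).
Qed.

Lemma trX_box i w : box B (trX i w).
Proof.
move=> k; rewrite /trX; case: ifP => h; first exact: le_trans (coord_le_normv _ _) h.
by rewrite mxE normr0 ltW.
Qed.

(** One null set for all indices, so that every statistic can be transferred at once. *)
Definition Nout : set Om := \bigcup_i [set w | B < normv (Xt i w)].

Lemma measurable_out i : measurable [set w | B < normv (Xt i w)].
Proof. by apply: measurable_normv_gt => k; exact: (measurableT_comp (measurable_coord k) (mX i)). Qed.

Lemma measurable_Nout : measurable Nout.
Proof. by apply: bigcupT_measurable => i; exact: measurable_out. Qed.

Lemma PNout : P Nout = 0%E.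
Proof.
have mB : measurable ([set z | B < normv z] : set (RpM R p)).
  by apply: (@measurable_normv_gt _ (RpM R p) R p id) => k; exact: measurable_coord.
have Pi i : P [set w | B < normv (Xt i w)] = 0%E.
  by have := law_X joint massXT massYT i mB; rewrite /massX fXB.
apply: (@measure_negligible _ _ _ P _ measurable_Nout).
by apply: negligible_bigcup => i; exists [set w | B < normv (Xt i w)]; split; [exact: measurable_out|exact: Pi|by []].
Qed.

Lemma trXE w : ~ Nout w -> forall i, trX i w = Xt i w.
Proof.
by move=> nN i; rewrite /trX; case: leP => // h; exfalso; apply: nN; exists i.
Qed.

Lemma joint_trX n (A : nat -> set (RpM R p)) (C : nat -> set mR) :
  (forall i, measurable (A i)) -> (forall j, measurable (C j)) ->
  P (rect trX Yt n A C) = ((\prod_(i < n) massX (A i)) * (\prod_(j < n) massY (C j)))%:E.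
Proof.
move=> mA mC; rewrite -joint//.
have mr (X : nat -> Om -> RpM R p) : (forall i, measurable_fun setT (X i)) -> measurable (rect X Yt n A C).
  move=> mX'; apply: measurableI; (apply: fin_bigcap_measurable; first exact: finite_II) => i _.
    by rewrite -[X in measurable X]setTI; exact: mX'.
  by rewrite -[X in measurable X]setTI; exact: mY.
apply: (eq_off_null measurable_Nout PNout); [exact: mr measurable_trX|exact: mr mX|move=> w nN].
rewrite /rect/=; apply/propext; split=> -[h1 h2]; split=> // i ni /=.
  by rewrite -(trXE nN); exact: h1.
by rewrite (trXE nN); exact: h1.
Qed.

(** The product formula gives the law of [trX i] on sets; [intRp_law] extends it to integrable
    functions, which turns the iterated integrals of the statement into expectations. *)
Lemma intRp_trX (phi : RpM R p -> R) i : measurable_fun setT phi ->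
  L1 P (fun w => phi (trX i w)) -> intRp (fun x => phi x * fX x) = Rintg P (fun w => phi (trX i w)).
Proof.
move=> mphi Lphi.
pose X' : {mfun Om >-> RpM R p} := HB.pack (trX i) (isMeasurableFun.Build _ _ _ _ _ (measurable_trX i)).
have mu A : measurable A -> distribution P X' A = (intRp (fun x => \1_A x * fX x))%:E.
  exact: (law_X joint_trX massXT massYT i).
rewrite (intRp_law mfX fX0 mu mphi); last exact/(L1_pushforward P (measurable_trX i) mphi).
exact: (Rint_pushforward P (measurable_trX i) mphi).
Qed.

Lemma norm_enoise_le t : `|f t| <= `|c|.
Proof.
rewrite normrM ler_piMr// ger0_norm ?expR_ge0// expR_le1 oppr_le0 mulr_ge0 ?exprn_ge0//.
exact: ltW delta0.
Qed.

Lemma L1_enoise_trX i y : L1 P (fun w => f (y - dotv b (trX i w))).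
Proof.
apply: (@L1_bdd _ _ _ _ _ `|c|) => [|w]; last exact: norm_enoise_le.
exact: (measurableT_comp (measurable_enoise alpha c delta) (measurable_residualX b measurable_trX i y)).
Qed.

Lemma fY_mean i y : F y = Rintg P (fun w => f (y - dotv b (trX i w))).
Proof.
rewrite /fY fnoiseE; apply: (@intRp_trX (fun x => f (y - dotv b x))); last exact: L1_enoise_trX.
apply: (measurableT_comp (measurable_enoise alpha c delta)).
by apply: measurable_funB => //; exact: measurable_dotv.
Qed.

Lemma Rint_fY : Rintg leb (F : mR -> R) = 1.
Proof.
by rewrite -massYT /massY /lebRint; apply: eq_Rint => y; rewrite indicT mul1r.
Qed.

(* The Gamma integral in [c_alpha] need not be evaluated: [fY] has total mass 1
   and the sign of [c_alpha]. *)
Lemma c_alpha_gt0 : 0 < c.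
Proof.
rewrite ltNge; apply/negP => c0.
have F0 y : 0 <= - F y.
  rewrite (fY_mean 0) -(RintN (L1_enoise_trX 0 y)); apply: Rintegral_ge0 => w _.
  by rewrite -mulNr mulr_ge0 ?expR_ge0// oppr_ge0.
have : (\int[leb]_y (F y)%:E = - \int[leb]_y (- F y)%:E)%E.
  rewrite -integral_ge0N => [|y _]; last by rewrite lee_fin.
  by apply: eq_integral => y _; rewrite -EFinN opprK.
have : (0 <= \int[leb]_y (- F y)%:E)%E by apply: integral_ge0 => y _; rewrite lee_fin.
have := Rint_fY; rewrite /Rintegral => + + E; rewrite E fineN => h1 h2.
have := fine_ge0 h2; lra.
Qed.

Lemma Gvec_mean i y k : Gv y 0 k = Rintg P (fun w => trX i w 0 k * derive1 f (y - dotv b (trX i w))).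
Proof.
have ms : measurable_fun setT (fun x : RpM R p => x 0 k * derive1 f (y - dotv b x)).
  apply: measurable_funM; first exact: measurable_coord.
  apply: (measurableT_comp (measurable_derive1_enoise alpha c delta)).
  by apply: measurable_funB => //; exact: measurable_dotv.
rewrite mxE fnoise'E; apply: (intRp_trX ms).
apply: (@L1_bdd _ _ _ _ _ (B * (env alpha (dot_max b B) (alpha%:R * delta) y * c))) => [|w].
  exact: (measurableT_comp ms (measurable_trX i)).
have bx := trX_box i w.
rewrite normrM; apply: ler_pM => //.
have h : `|dotv b (trX i w)| <= dot_max b B by exact: dot_box.
apply: (le_trans (derive1_enoise_bound alpha delta0 c_alpha_gt0 (dot_max_ge0 b (ltW B0)) y h)).
by rewrite ler_wpM2l ?env_ge0//; exact: (enoise_le alpha delta0 c_alpha_gt0).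
Qed.

Let B0' : 0 <= B. Proof. exact: ltW. Qed.

Lemma fY_gt0 y : 0 < F y.
Proof. exact: (density_gt0 delta0 c_alpha_gt0 B0' measurable_trX trX_box fY_mean). Qed.

Lemma measurable_fY : measurable_fun setT (F : mR -> R).
Proof. exact: (measurable_density measurable_trX fY_mean). Qed.

(** The product formula provides the [fine] of an integral. Total mass 1 excludes an infinite
    integral of [fY], so the extended integral over [C] is that same number. *)
Lemma law_Yt j C : measurable C -> P (Yt j @^-1` C) = (\int[leb]_(y in C) (F y)%:E)%E.
Proof.
move=> mC; have LF : L1 leb (F : mR -> R).
  apply: ge0_Rint_neq0; [by rewrite Rint_fY oner_neq0|exact: measurable_fY|move=> y; exact: ltW (fY_gt0 y)].
have LC : L1 leb (fun y : mR => \1_C y * F y).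
  apply: (L1_le _ _ LF) => [|y].
    apply: (@measurable_funM _ mR R); [exact: measurable_indic|exact: measurable_fY].
  have F0 := ltW (fY_gt0 y); rewrite indicE normrM (ger0_norm F0) ler_piMl//.
  by case: (_ \in _); rewrite ?normr1 ?normr0.
rewrite (law_Y joint massXT massYT j mC) /massY /lebRint -(L1_EFin LC).
rewrite [RHS]integral_mkcond; apply: eq_integral => y _.
by rewrite patchE indicE; case: (_ \in _); rewrite ?mul1r ?mul0r.
Qed.

Let psiE k x : psi alpha d b fX x 0 k = infl alpha c delta b F Gv k x.
Proof. by rewrite mxE. Qed.

Let measurable_infl' k : measurable_fun setT (infl alpha c delta b F Gv k).
Proof. exact: (measurable_infl delta0 c_alpha_gt0 B0' measurable_trX trX_box fY_mean Gvec_mean). Qed.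

Lemma Epsi0 k : Epsi alpha d b fX 0 k = 0.
Proof.
rewrite mxE (_ : (fun x => _) = fun x => infl alpha c delta b F Gv k x * fX x); last first.
  by apply/funext => x; rewrite psiE.
rewrite (@intRp_trX _ 0 (measurable_infl' k)).
  exact: (E_infl alpha1 delta0 c_alpha_gt0 B0' measurable_trX mY joint_trX massXT massYT trX_box fY_mean Gvec_mean law_Yt).
exact: (L1_infl alpha1 delta0 c_alpha_gt0 B0' measurable_trX mY trX_box fY_mean Gvec_mean law_Yt).
Qed.

(** Pointwise, g_k g_l F = G_k G_l / F. *)
Lemma Gamma1E : Gamma1 alpha d b fX = cov_cscore P Yt F Gv.
Proof.
apply/matrixP => k l; rewrite [LHS]mxE [RHS]mxE.
rewrite (L1_cscoreM alpha1 delta0 c_alpha_gt0 B0' measurable_trX mY trX_box fY_mean Gvec_mean law_Yt 0 k l).2.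
apply: eq_Rint => y; rewrite /cscore; have := fY_gt0 y.
move: (F y) (Gv y 0 k) (Gv y 0 l) => a u v a0; field; by rewrite gt_eqF.
Qed.

(** [Hvec] is the opposite of psi, and the signs cancel in the products. *)
Lemma Gamma2E : Gamma2 alpha d b fX = cov_infl alpha c delta b P trX F Gv.
Proof.
apply/matrixP => k l; rewrite [LHS]mxE [RHS]mxE.
have HE j x : Hvec alpha d b fX x 0 j = - infl alpha c delta b F Gv j x.
  rewrite mxE opprK; apply: eq_Rint => y; rewrite /cscore fnoiseE; ring.
rewrite (_ : (fun x => _) = fun x => (infl alpha c delta b F Gv k x * infl alpha c delta b F Gv l x) * fX x); last first.
  by apply/funext => x; rewrite !HE mulrNN.
apply: (@intRp_trX (fun x => infl alpha c delta b F Gv k x * infl alpha c delta b F Gv l x) 0).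
  exact: measurable_funM.
exact: (L1_inflM alpha1 delta0 c_alpha_gt0 B0' measurable_trX mY trX_box fY_mean Gvec_mean law_Yt).
Qed.

Lemma SstatE n Xs Ys k : Sstat alpha d b n Xs Ys 0 k = n%:R^-1 * \sum_(j < n)
  ((n%:R^-1 * \sum_(i < n) f (Ys j - dotv b (Xs i)))^-1 *
   (n%:R^-1 * \sum_(i < n) derive1 f (Ys j - dotv b (Xs i)) * Xs i 0 k)).
Proof.
rewrite mxE summxE; congr (_ * _); apply: eq_bigr => j _; rewrite mxE; congr (_ * _).
rewrite mxE summxE; congr (_ * _); by apply: eq_bigr => i _; rewrite mxE.
Qed.

Lemma T1statE n Ys k : T1stat alpha d b fX n Ys 0 k = n%:R^-1 * \sum_(j < n) cscore F Gv k (Ys j).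
Proof. by rewrite mxE summxE; congr (_ * _); apply: eq_bigr => j _; rewrite mxE mulrC. Qed.

Lemma T2statE n Xs k : T2stat alpha d b fX n Xs 0 k =
  n%:R^-1 * \sum_(i < n) infl alpha c delta b F Gv k (Xs i).
Proof.
rewrite mxE [X in _ + X]mxE Epsi0 subr0 mxE summxE; congr (_ * _).
by apply: eq_bigr => i _; exact: psiE.
Qed.

Definition gap n (X : nat -> Om -> RpM R p) w : 'rV[R]_p :=
  Sstat alpha d b n (fun i => X i w) (fun j => Yt j w)
  - T1stat alpha d b fX n (fun j => Yt j w) - T2stat alpha d b fX n (fun i => X i w).

(** Numerator and denominator of the statistic are both divided by F(Y_j), which turns them into the
    means of s and w. *)
Lemma gap_remainder n w : gap n trX w = \row_k remainder alpha c delta b trX Yt F Gv k n w.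
Proof.
apply/rowP => k; rewrite [RHS]mxE /gap mxE [X in _ + X]mxE mxE [X in _ + X + _]mxE.
rewrite SstatE T1statE T2statE /remainder; congr (_ * _ - _ - _).
apply: eq_bigr => j _; have F0 := fY_gt0 (Yt j w).
have -> : \sum_(i < n) wratio alpha c delta b F (trX i w, Yt j w) =
    (\sum_(i < n) f (Yt j w - dotv b (trX i w))) * (F (Yt j w))^-1 by rewrite mulr_suml.
have -> : \sum_(i < n) sratio alpha c delta b F k (trX i w, Yt j w) =
    (\sum_(i < n) derive1 f (Yt j w - dotv b (trX i w)) * trX i w 0 k) * (F (Yt j w))^-1.
  by rewrite mulr_suml; apply: eq_bigr => i _; rewrite /sratio/= (mulrC (trX i w 0 k)).
rewrite (mulrA _ _ (F _)^-1) (mulrA _ _ (F _)^-1) [in RHS]invfM invrK mulrACA.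
by rewrite divff ?mulr1// gt_eqF.
Qed.

Definition pair_stat n (X : nat -> Om -> RpM R p) w : 'rV[R]_p * 'rV[R]_p :=
  (Num.sqrt n%:R *: T1stat alpha d b fX n (fun j => Yt j w),
   Num.sqrt n%:R *: T2stat alpha d b fX n (fun i => X i w)).

Lemma pair_statE n X h w : h (pair_stat n X w) = pair_fun h (root_n_sum alpha c delta b X Yt F Gv n w).
Proof.
rewrite /pair_fun /pair_stat; congr (h (_, _)); apply/rowP => k; rewrite [LHS]mxE [RHS]mxE.
  by rewrite T1statE.
by rewrite T2statE.
Qed.

Lemma measurable_gap n (X : nat -> Om -> RpM R p) k : (forall i, measurable_fun setT (X i)) ->
  measurable_fun setT (fun w => gap n X w 0 k).
Proof.
move=> mX'.
have measurable_noise : measurable_fun setT (f : R -> R) by exact: measurable_enoise.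
have measurable_noise' : measurable_fun setT (derive1 f : R -> R) by exact: measurable_derive1_enoise.
have ms i j : measurable_fun setT (fun w => Yt j w - dotv b (X i w)).
  by apply: measurable_funB; [exact: mY|apply: (measurableT_comp (measurable_dotv b)); exact: mX'].
rewrite (_ : (fun w => _) = fun w => n%:R^-1 * \sum_(j < n)
  ((n%:R^-1 * \sum_(i < n) f (Yt j w - dotv b (X i w)))^-1 *
   (n%:R^-1 * \sum_(i < n) derive1 f (Yt j w - dotv b (X i w)) * X i w 0 k)) -
   n%:R^-1 * \sum_(j < n) cscore F Gv k (Yt j w) -
   n%:R^-1 * \sum_(i < n) infl alpha c delta b F Gv k (X i w)); last first.
  by apply/funext => w; rewrite /gap mxE [X in _ + X]mxE mxE [X in _ + X + _]mxE SstatE T1statE T2statE.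
apply: measurable_funB; first apply: measurable_funB.
- apply: measurable_funM => //; apply: measurable_sum => j; apply: measurable_funM.
    apply: measurable_pos_inv => [w|].
      rewrite mulr_ge0 ?invr_ge0// sumr_ge0// => i _.
      by apply: ltW; exact: (enoise_gt0 alpha delta c_alpha_gt0).
    by apply: measurable_funM => //; apply: measurable_sum => i; exact: (measurableT_comp measurable_noise).
  apply: measurable_funM => //; apply: measurable_sum => i; apply: measurable_funM.
    exact: (measurableT_comp measurable_noise').
  exact: (measurableT_comp (measurable_coord k)).
- apply: measurable_funM => //; apply: measurable_sum => j; apply: measurableT_comp (mY j).
  exact: (measurable_cscore delta0 c_alpha_gt0 B0' measurable_trX trX_box fY_mean Gvec_mean).
- by apply: measurable_funM => //; apply: measurable_sum => i; exact: (measurableT_comp (measurable_infl' k)).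
Qed.

(** The gaps computed from [Xt] and from [trX] agree off [Nout], so the two events have equal
    probability. *)
Lemma expansion eps : 0 < eps ->
  (fun n => P [set w | eps < normv (Num.sqrt n%:R *: gap n Xt w)]) @ \oo --> ((0:R)%:E).
Proof.
move=> eps0; have := remainder_op alpha1 delta0 c_alpha_gt0 B0' measurable_trX mY joint_trX massXT massYT trX_box
  fY_mean Gvec_mean law_Yt eps0.
rewrite [X in X @ _ --> _ -> _](_ : _ = fun n => P [set w | eps < normv (Num.sqrt n%:R *: gap n Xt w)])//.
apply/funext => n.
have mset (X : nat -> Om -> RpM R p) : (forall i, measurable_fun setT (X i)) ->
    measurable [set w | eps < normv (Num.sqrt n%:R *: gap n X w)].
  move=> mX'; apply: measurable_normv_gt => k.
  rewrite (_ : (fun w => _) = fun w => Num.sqrt n%:R * gap n X w 0 k); last by apply/funext => w; rewrite mxE.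
  by apply: measurable_funM => //; exact: measurable_gap.
rewrite (_ : [set w | _] = [set w | eps < normv (Num.sqrt n%:R *: gap n trX w)]); last first.
  by apply/seteqP; split=> w /=; rewrite gap_remainder.
apply: (eq_off_null measurable_Nout PNout); [exact: mset measurable_trX|exact: mset mX|move=> w nN /=].
have -> : gap n trX w = gap n Xt w; last by [].
have EX : (fun i => trX i w) = (fun i => Xt i w) by apply/funext => i; exact: trXE.
by rewrite /gap EX.
Qed.

(** The integrands for [Xt] and [trX] agree off [Nout]. Equating their integrals asks for
    measurability on the [Xt] side too, which [measurable_pair_fun] provides. *)
Lemma weak_limit : exists A1 A2 : 'M[R]_p,
  A1 *m A1^T = Gamma1 alpha d b fX /\ A2 *m A2^T = Gamma2 alpha d b fX /\
  forall h : 'rV[R]_p * 'rV[R]_p -> R, continuous h -> (exists M : R, forall z, `|h z| <= M) ->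
    (fun n : nat => (\int[P]_w (h (pair_stat n Xt w))%:E)%E) @ \oo -->
      (intRp (fun z1 => intRp (fun z2 =>
          h (z1 *m A1^T, z2 *m A2^T) * std_gauss_pdf z1 * std_gauss_pdf z2)))%:E.
Proof.
have [A1 [A2 [E1 [E2 H]]]] := clt_score alpha1 delta0 c_alpha_gt0 B0' measurable_trX mY joint_trX massXT massYT trX_box
  fY_mean Gvec_mean law_Yt.
exists A1, A2; rewrite Gamma1E Gamma2E; split=> //; split=> // h ch [M hM].
have [mh cv] := H h M ch hM.
have mSX n (X : nat -> Om -> RpM R p) : (forall i, measurable_fun setT (X i)) ->
    measurable_fun setT (fun w => pair_fun h (root_n_sum alpha c delta b X Yt F Gv n w)).
  move=> mX'; apply: (measurable_pair_fun P ch hM) => i.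
  apply: measurable_funM => //; apply: measurable_funM => //; apply: measurable_sum => j.
  case: i => k.
    apply: (measurableT_comp _ (mY j)); exact: (measurable_cscore delta0 c_alpha_gt0 B0' measurable_trX trX_box fY_mean Gvec_mean).
  exact: (measurableT_comp (measurable_infl' k)).
have E n : (\int[P]_w (h (pair_stat n Xt w))%:E =
    (Rintg P (fun w => pair_fun h (root_n_sum alpha c delta b trX Yt F Gv n w)))%:E)%E.
  rewrite -L1_EFin; last by apply: (@L1_bdd _ _ _ _ _ M) => [|w]; [exact: mh|exact: hM].
  rewrite (_ : (fun w => _) = fun w => (pair_fun h (root_n_sum alpha c delta b Xt Yt F Gv n w))%:E); last first.
    by apply/funext => w; rewrite pair_statE.
  apply: (eq_Rint_off_null measurable_Nout PNout); [exact: mSX mX|exact: mSX measurable_trX|move=> w nN].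
  have EX : (fun i => trX i w) = (fun i => Xt i w) by apply/funext => i; exact: trXE.
  have EP : pair_stat n Xt w = pair_stat n trX w by rewrite /pair_stat EX.
  exact: etrans (esym (pair_statE n Xt h w)) (etrans (congr1 h EP) (pair_statE n trX h w)).
rewrite (funext E); apply: cvg_EFin; [exact: nearW|exact: cv].
Qed.
End model.

Theorem theorem4 (R : realType) (p : nat) (b : 'rV[R]_p)
  (fX : 'rV[R]_p -> R) (B : R) (alpha : nat) (d : R)
  (dO : measure_display) (Omega : measurableType dO) (P : probability Omega R)
  (Xt : nat -> Omega -> 'rV[R]_p) (Yt : nat -> Omega -> R) :
  (1 <= p)%N ->
  (* X has a Lebesgue density fX on R^p *)
  @measurable_fun _ _ (RpM R p) R setT fX ->
  (forall x, 0 <= fX x) ->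
  intRp fX = 1 ->
  (* P(||X|| <= B) = 1 *)
  0 < B ->
  intRp (fun x => \1_[set z | B < normv z] x * fX x) = 0 ->
  (* P(v^T X = 0) = 0 for v <> 0 *)
  (forall v : 'rV[R]_p, v != 0 ->
     intRp (fun x => \1_[set z | dotv v z = 0] x * fX x) = 0) ->
  (* noise density parameters *)
  (1 <= alpha)%N -> 0 < d ->
  (* the samples are random variables on (Omega, P) *)
  (forall i, @measurable_fun _ _ Omega (RpM R p) setT (Xt i)) ->
  (forall j, measurable_fun setT (Yt j)) ->
  (* X~_i i.i.d. with density fX, Y~_j i.i.d. with density fY, the two
     samples independent: joint law on every finite set of indices *)
  (forall (n : nat) (A : nat -> set (RpM R p)) (C : nat -> set R),
     (forall i, measurable (A i)) -> (forall j, measurable (C j)) ->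
     P ((\bigcap_(i in [set i | (i < n)%N]) (Xt i @^-1` A i)) `&`
        (\bigcap_(j in [set j | (j < n)%N]) (Yt j @^-1` C j))) =
     ((\prod_(i < n) intRp (fun x => \1_(A i) x * fX x)) *
      (\prod_(j < n) lebRint (fun y => \1_(C j) y * fY alpha d b fX y)))%:E) ->
  (* (1) expansion with remainder o_P(n^{-1/2}) *)
  (forall eps : R, 0 < eps ->
     (fun n : nat => P [set w | eps < normv (Num.sqrt n%:R *:
        (Sstat alpha d b n (fun i => Xt i w) (fun j => Yt j w)
         - T1stat alpha d b fX n (fun j => Yt j w)
         - T2stat alpha d b fX n (fun i => Xt i w)))])
     @ \oo --> ((0:R)%:E))
  /\
  (* (2) sqrt n T1 ->d W1, sqrt n T2 ->d W2, W1, W2 independent centered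
     Gaussian with covariances Gamma1, Gamma2 (W_k = A_k Z_k, Z_1, Z_2
     independent standard Gaussian, A_k A_k^T = Gamma_k) *)
  (exists A1 A2 : 'M[R]_p,
     A1 *m A1^T = Gamma1 alpha d b fX /\ A2 *m A2^T = Gamma2 alpha d b fX /\
     forall h : 'rV[R]_p * 'rV[R]_p -> R,
       continuous h -> (exists M : R, forall z, `|h z| <= M) ->
       (fun n : nat => (\int[P]_w
          (h (Num.sqrt n%:R *: T1stat alpha d b fX n (fun j => Yt j w),
              Num.sqrt n%:R *: T2stat alpha d b fX n (fun i => Xt i w)))%:E)%E)
       @ \oo -->
       (intRp (fun z1 => intRp (fun z2 =>
          h (z1 *m A1^T, z2 *m A2^T) * std_gauss_pdf z1 * std_gauss_pdf z2)))%:E).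
Proof.
move=> _ mfX fX0 fX1 B0 fXB _ alpha1 d0 mX mY joint.
split; first exact: (expansion mfX fX0 fX1 B0 fXB alpha1 d0 mX mY joint).
exact: (weak_limit mfX fX0 fX1 B0 fXB alpha1 d0 mX mY joint).
Qed.
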